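(* Let $\alpha\in(1/2,1]$. There exists a family of random variables $\{\widetilde L^f_t : f\in\mathcal S_\alpha,\ t\in[0,1]\}$ such that: (i) for each $f\in\mathcal S_\alpha$, almost surely $\widetilde L^f_t=L^f_t$ for all $t\in[0,1]$; (ii) with probability one, $f\mapsto\widetilde L^f_1$ is a continuous map on $\mathcal S_\alpha$ with respect to the supremum norm; and (iii) with probability one, $\sup_{f\in\mathcal S_\alpha}\widetilde L^f_1<\infty$.
   Context: $W=(W_t)_{t\ge 0}$ is a one-dimensional Brownian motion started at $0$. For $\alpha\in(0,1]$, $\mathcal S_\alpha$ is the set of functions $f:[0,1]\to\mathbb R$ with $\sup_{0\le t\le 1}|f(t)|\le 1$ and $|f(s)-f(t)|\le|s-t|^\alpha$ for all $s,t\in[0,1]$. The supremum norm is $\|f\|=\sup_{0\le t\le1}|f(t)|$. For measurable $f:[0,1]\to\mathbb R$ and $\varepsilon>0$ put $D^f_t(\varepsilon)=\frac1{2\varepsilon}\int_0^t\mathbf 1_{(f(s)-\varepsilon,f(s)+\varepsilon)}(W_s)\,ds$. The local time $L^f=(L^f_t)_{0\le t\le1}$ of $W$ along the curve $f$ is the nondecreasing continuous process (unique up to indistinguishability) such that $\mathbb E\big[\sup_{0\le t\le1}|D^f_t(\varepsilon)-L^f_t|^2\big]\to0$ as $\varepsilon\to0$. *)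

(* Defs.v *)
From HB Require Import structures.
From mathcomp Require Export all_boot all_order all_algebra.
From mathcomp Require Export all_classical all_reals all_analysis.
Export Order.TTheory GRing.Theory Num.Theory.
Export numFieldNormedType.Exports.

Set Implicit Arguments.
Unset Strict Implicit.
Unset Printing Implicit Defensive.

Local Open Scope classical_set_scope.
Local Open Scope ring_scope.

Section Curves.
Context {R : realType}.
Implicit Types (f : R -> R) (alpha : R).

(* A function [0, 1] -> R is encoded by a total function R -> R of which only
   the values on [0, 1] are used. The supremum is taken in \bar R, so that an
   unbounded function has norm +oo. *)
Definition sup_norm f : \bar R :=
  ereal_sup [set (`|f t|)%:E | t in `[0, 1]].

Definition holder_class alpha : set (R -> R) :=
  [set f | (sup_norm f <= 1)%E /\
    forall s t : R, s \in `[0, 1] -> t \in `[0, 1] ->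
      `|f s - f t| <= `|s - t| `^ alpha].

Definition sup_norm_continuous (S : set (R -> R)) (F : (R -> R) -> R) : Prop :=
  forall f, S f -> forall e : R, 0 < e -> exists2 d : R, 0 < d &
    forall g, S g -> (sup_norm (f \- g)%R < d%:E)%E -> `|F f - F g| < e.

End Curves.

Section Processes.
Context {R : realType} {d : measure_display} {T : measurableType d}.
Variable P : probability T R.

(* Taking B i = setT for some of the i gives the product rule for every
   subfamily. *)
Definition mutually_independent (n : nat) (X : 'I_n -> T -> R) : Prop :=
  forall B : 'I_n -> set R, (forall i, measurable (B i)) ->
    P (\bigcap_(i in [set: 'I_n]) (X i @^-1` B i)) =
    (\prod_(i < n) P (X i @^-1` B i))%E.

(* One-dimensional Brownian motion started at 0; only the times t >= 0 are
   used. The second parameter of [normal_prob] is the standard deviation. *)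
Definition brownian_motion (W : R -> {RV P >-> R}) : Prop :=
  [/\ {ae P, forall w, W 0 w = 0},
      forall (n : nat) (t : nat -> R), 0 <= t 0%N ->
        {homo t : i j / (i <= j)%N >-> i <= j} ->
        mutually_independent (fun (i : 'I_n) w => W (t i.+1) w - W (t i) w),
      forall s t : R, 0 <= s -> s < t ->
        forall B : set R, measurable B ->
          P ((fun w => W t w - W s w) @^-1` B) =
          normal_prob 0 (Num.sqrt (t - s)) B &
      {ae P, forall w, {within `[0, +oo[, continuous (fun t : R => W t w)}}].

Definition occupation (W : R -> {RV P >-> R}) (f : R -> R) (e t : R) (w : T)
    : R :=
  (2 * e)^-1 *
  \int[lebesgue_measure]_(s in `[0, t])
    \1_(`]f s - e, f s + e[%classic : set R) (W s w).

Definition is_local_time (W : R -> {RV P >-> R}) (f : R -> R)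
    (L : R -> {RV P >-> R}) : Prop :=
  [/\ {ae P, forall w, forall s t : R, s \in `[0, 1] -> t \in `[0, 1] ->
        s <= t -> L s w <= L t w},
      {ae P, forall w, {within `[0, 1], continuous (fun t : R => L t w)}} &
      (\int[P]_w ereal_sup
         [set (`|occupation W f e t w - L t w| ^+ 2)%:E | t in `[0%R, 1%R]])%E
        @[e --> 0^'+] --> 0%E].

End Processes.

(* Main.v *)
(** Cut time and space into dyadic intervals of length 2^-n, and let
    [level_occ x n f] be the sum over the time intervals of 2^n times the time
    that the path x spends there in the space cell containing the value of f at
    the left end. For two cells at distance at most h, the difference of the
    normalized occupation times over a time span tau has exponential moments at
    scale h^(1/4) tau^(3/8): on a fine time grid the exponential becomes a product
    whose conditional means obey a backward recursion, which is controlled by the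
    1/4-Hoelder regularity of the Gaussian density. A union bound makes the
    estimate hold almost surely for all dyadic data at once. When n is increased by one
    and f is replaced by another curve at distance 2^(-alpha n), only the time intervals
    on which the path comes near f matter, and there are about 2^(n/2) level_occ of
    them, so that level_occ changes by at most
      C 2^(n/2) 2^(-alpha n/4) 2^(-3n/8) sup level_occ,
    which is summable exactly when alpha > 1/2. Hence almost surely level_occ
    converges for all alpha-Hoelder curves simultaneously, with a bounded and
    uniformly continuous limit. Averaging over adjacent cells shows that
    this limit is also the pathwise limit of the occupation densities, so by Fatou's lemma
    it is a version of the local time at time 1. *)

Require Import Defs.
From mathcomp Require Import measurable_realfun ring lra zify.

Set Implicit Arguments.
Unset Strict Implicit.
Unset Printing Implicit Defensive.

Local Open Scope classical_set_scope.
Local Open Scope ring_scope.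

(** * Gaussian laws and independence *)

(** The exponent 1/4 is one choice among all gamma in (0, 1/2). Each time of the recursion
    contributes h^gamma |x - x'|^gamma sigma^(-1 - 2 gamma), where sigma is the square root of the
    elapsed time; this is integrable in time exactly for gamma < 1/2. The resulting scale is h^gamma
    tau^((1 - gamma)/2). For h = 2^(-alpha n), tau = 2^-n and 2^(n/2) time intervals the change per
    level is 2^(gamma (1/2 - alpha) n), so the threshold alpha > 1/2 does not depend on gamma; the
    value 1/4 turns the estimates into polynomial inequalities in fourth roots. The time integral is
    an exact average, over the offset, of sums along a grid. Hence independence of finitely many
    Gaussian increments and Jensen's inequality suffice, and no limit of grids is taken. The bound
    for one level involves the supremum of [level_occ] over shifted curves at the previous level.
    The recursion therefore runs over a class of curves that is closed under shifts, without a bound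
    on their size, and starts from the trivial bound 2^n. *)

Section Lebesgue_translation.
Context {R : realType}.
Local Notation mu := (@lebesgue_measure R).

Lemma lebesgue_measureD (x : R) (A : set R) : measurable A ->
  mu ((+%R x) @^-1` A) = mu A.
Proof.
move=> mA.
have mx : measurable_fun setT ((+%R x) : measurableTypeR R -> measurableTypeR R).
  exact: measurable_funD.
transitivity (pushforward mu ((+%R x) : measurableTypeR R -> measurableTypeR R) A) => //.
apply/esym/lebesgue_measure_unique => //= _ [[a b]] _ <-.
rewrite /pushforward.
rewrite (_ : _ @^-1` _ = `]a - x, b - x]%classic); last first.
  apply/seteqP; split => y/=; rewrite !in_itv/=; by rewrite ltrBlDl lerBrDl.
rewrite !lebesgue_measure_itv/= !lte_fin ltrD2r.
case: ifP => // _; rewrite -EFinB -EFinD; congr EFin.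
by rewrite opprB addrA subrK.
Qed.

Lemma ge0_integralD_translation (x : R) (f : R -> \bar R) (A : set R) :
  measurable A -> measurable_fun setT f -> (forall y, 0 <= f y)%E ->
  (\int[mu]_(y in (+%R x) @^-1` A) f (x + y)%R = \int[mu]_(y in A) f y)%E.
Proof.
move=> mA mf f0.
have mx : measurable_fun setT ((+%R x) : measurableTypeR R -> measurableTypeR R).
  exact: measurable_funD.
rewrite -[LHS](ge0_integral_pushforward mx mu mA)//; last exact: measurable_funTS.
apply: eq_measure_integral => B mB _; exact: lebesgue_measureD.
Qed.

End Lebesgue_translation.

Section normal_density.
Context {R : realType}.
Local Notation mu := (@lebesgue_measure R).

(** The change of variables goes through the Radon-Nikodym derivative, which agrees almost
    everywhere with [normal_pdf] because both have the same integral over every measurable set. *)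
Lemma ge0_integral_normal_prob (m s : R) (f : R -> \bar R) :
  measurable_fun setT f -> (forall y, 0 <= f y)%E ->
  (\int[normal_prob m s]_y f y = \int[mu]_y (f y * (normal_pdf m s y)%:E))%E.
Proof.
move=> mf f0.
have dom : normal_prob m s `<< (mu : {measure set _ -> \bar R}) := @normal_prob_dominates R m s.
rewrite -(Radon_Nikodym_SigmaFinite.change_of_variables dom)//.
set g := Radon_Nikodym_SigmaFinite.f _ _.
have gint := Radon_Nikodym_SigmaFinite.f_integrable dom.
have ae : ae_eq mu setT g (EFin \o normal_pdf m s).
  apply: integral_ae_eq => //.
    apply/measurable_EFinP; exact: measurable_normal_pdf.
  move=> E _ mE; rewrite -(Radon_Nikodym_SigmaFinite.f_integral dom)//.
apply: ge0_ae_eq_integral => //.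
- apply: emeasurable_funM => //; exact: (measurable_int _ gint).
- apply: emeasurable_funM => //; apply/measurable_EFinP; exact: measurable_normal_pdf.
- by move=> x _; rewrite mule_ge0// Radon_Nikodym_SigmaFinite.f_ge0.
- by move=> x _; rewrite mule_ge0// lee_fin normal_pdf_ge0.
- by apply: filterS ae => x /= H _; rewrite -H.
Qed.

Lemma ge0_integral_normal_law {d} {T : measurableType d} (P : probability T R)
    (X : T -> R) (m s : R) (f : R -> \bar R) :
  measurable_fun setT X ->
  (forall B, measurable B -> P (X @^-1` B) = normal_prob m s B) ->
  measurable_fun setT f -> (forall y, 0 <= f y)%E ->
  (\int[P]_w f (X w) = \int[mu]_y (f y * (normal_pdf m s y)%:E))%E.
Proof.
move=> mX XE mf f0.
have mX' : measurable_fun setT (X : T -> measurableTypeR R) by exact: mX.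
pose PX : probability (measurableTypeR R) R :=
  @distribution _ _ T (measurableTypeR R) R P
    (@mfun_Sub _ _ T (measurableTypeR R) X (mem_set mX')).
pose PN : probability (measurableTypeR R) R := normal_prob m s.
rewrite -ge0_integral_normal_prob//.
transitivity (\int[PX]_y f y)%E.
  by rewrite (ge0_integral_pushforward mX').
transitivity (\int[PN]_y f y)%E => //.
by apply: eq_measure_integral => B mB _; exact: XE.
Qed.

End normal_density.

Section independence.
Context {R : realType} {d : measure_display} {T : measurableType d}.
Variable P : probability T R.
Variables (m : nat) (X : T -> R) (V : 'I_m -> T -> R).
Hypothesis mX : measurable_fun setT X.
Hypothesis mV : forall i, measurable_fun setT (V i).

(** A pi-system generating the sigma-algebra of the vector [V]. The space [TV] below is [T] with
    this coarser sigma-algebra, so that independence of [X] and [V] becomes an identity between two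
    laws on [R * TV]. *)
Definition cylinders : set (set T) :=
  [set A | exists2 B : 'I_m -> set R, forall i, measurable (B i) &
     A = \bigcap_(i in [set: 'I_m]) (V i @^-1` B i)].

Lemma cylinders_setI : setI_closed cylinders.
Proof.
move=> _ _ [B mB ->] [C mC ->]; exists (fun i => B i `&` C i).
  by move=> i; exact: measurableI.
by rewrite -bigcapI.
Qed.

Lemma cylinders_sub : <<s cylinders >> `<=` @measurable _ T.
Proof.
apply: smallest_sub; first exact: sigma_algebra_measurable.
move=> _ [B mB ->]; apply: fin_bigcap_measurable => // i _.
by rewrite -[X in measurable X]setTI; exact: mV.
Qed.

Local Notation TV := (g_sigma_algebraType cylinders).

Lemma measurable_cylinders i : measurable_fun setT (V i : TV -> R).
Proof.
move=> _ B mB; rewrite setTI; apply: sub_sigma_algebra.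
exists (fun j => if j == i then B else setT); first by move=> j; case: ifP.
apply/seteqP; split => [w Bw j _ /=|w /(_ i I)/=]; last by rewrite eqxx.
by case: eqP => // ->.
Qed.

Hypothesis indep : forall (B : set R) (C : 'I_m -> set R),
  measurable B -> (forall i, measurable (C i)) ->
  (P (X @^-1` B `&` \bigcap_(i in [set: 'I_m]) (V i @^-1` C i)) =
   P (X @^-1` B) * P (\bigcap_(i in [set: 'I_m]) (V i @^-1` C i)))%E.

Lemma indep_cylinders (B : set R) (A : set T) : measurable B -> <<s cylinders >> A ->
  (P (X @^-1` B `&` A) = P (X @^-1` B) * P A)%E.
Proof.
move=> mB; have mXB : measurable (X @^-1` B) by rewrite -[X in measurable X]setTI; exact: mX.
have finP (C : set T) : measurable C -> P C \is a fin_num by move=> ?; exact: fin_num_measure.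
apply: (@dynkin_induction _ TV cylinders (fun A : set T => P (X @^-1` B `&` A) = P (X @^-1` B) * P A)%E) => //.
- exact: cylinders_setI.
- by rewrite setIT probability_setT mule1.
- by move=> _ [C mC ->]; exact: indep.
- move=> S mS PS; have mS' : @measurable _ T S by exact: (cylinders_sub mS).
  rewrite -setDE measureD//; last by rewrite ltey_eq finP.
  transitivity (P (X @^-1` B) - P (X @^-1` B) * P S)%E; first by congr (_ - _)%E.
  rewrite probability_setC//.

  rewrite -[X in (X - _)%E]mule1 -muleBr ?finP// ?fin_num_adde_defl//.
- move=> F mF tF PF; have mF' n : @measurable _ T (F n) by exact: (cylinders_sub (mF n)).
  rewrite setI_bigcupr measure_bigcup//; last 2 first.
    by move=> i _; exact: measurableI.
    exact: trivIset_setIl.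
  rewrite measure_bigcup//.
  rewrite -[X in (X * _)%E](fineK (finP _ mXB)) -nneseriesZl//.
  by apply: eq_eseriesr => i _; rewrite fineK ?finP//; exact: PF.
Qed.

(** The law of (X, id) on [R * TV] is a product measure by uniqueness on rectangles, and Tonelli's
    theorem separates the two variables. Measurability for [TV] expresses that [G] depends on the
    second argument through [V] only. *)
Lemma ge0_indep_integral (G : R * TV -> \bar R) :
  measurable_fun setT G -> (forall z, 0 <= G z)%E ->
  (\int[P]_w G (X w, w) = \int[P]_w \int[P]_w' G (X w, w'))%E.
Proof.
move=> mG G0.
have mid : measurable_fun setT (id : T -> TV).
  by move=> _ A mA; rewrite setTI; exact: (cylinders_sub mA).
pose PX : probability R R := distribution P (mfun_Sub (mem_set mX)).
pose PV : probability TV R := distribution P (mfun_Sub (mem_set mid)).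
have mp : measurable_fun setT (fun w : T => (X w, w) : R * TV).
  by apply/measurable_fun_pair.
pose J : probability (R * TV)%type R := distribution P (mfun_Sub (mem_set mp)).
transitivity (\int[J]_z G z)%E.
  by rewrite (ge0_integral_pushforward mp).
transitivity (\int[PX \x PV]_z G z)%E.
  apply: eq_measure_integral => A mA _; apply/esym.
  apply: product_measure_unique => // B C mB mC.
  by rewrite /J /PX /PV /= /distribution /pushforward /= -indep_cylinders.
rewrite fubini_tonelli1// (ge0_integral_pushforward mX)//; last 2 first.
- exact: measurable_fun_fubini_tonelli_F.
- by move=> y _; exact: integral_ge0.
apply: eq_integral => w _ /=; rewrite /fubini_F.
rewrite (ge0_integral_pushforward mid)//.
by apply: measurableT_comp => //; exact: pair1_measurable.
Qed.

End independence.

(** * Regularity of the Gaussian density *)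

Section root4.
Context {R : realType}.
Implicit Types x y : R.

(** The absolute value makes the fourth root even and multiplicative on the whole line, so Hoelder
    bounds of order 1/4 can be scaled and multiplied without sign conditions. *)
Definition root4 x : R := `|x| `^ 4^-1.

Lemma root4_ge0 x : 0 <= root4 x. Proof. exact: powR_ge0. Qed.

Lemma root4_gt0 x : x != 0 -> 0 < root4 x.
Proof. by move=> x0; rewrite powR_gt0// normr_gt0. Qed.

Lemma root4X x : root4 x ^+ 4 = `|x|.
Proof.
rewrite /root4 -powR_mulrn ?powR_ge0// -powRrM mulVf ?powRr1//.
Qed.

Lemma root4M x y : root4 (x * y) = root4 x * root4 y.
Proof. by rewrite /root4 normrM powRM. Qed.

Lemma root4_1 : root4 1 = 1.
Proof. by rewrite /root4 normr1 powR1. Qed.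

Lemma root4V x : x != 0 -> root4 x^-1 = (root4 x)^-1.
Proof.
move=> x0; apply: (mulfI (lt0r_neq0 (root4_gt0 x0))).
by rewrite -root4M divff// root4_1 divff// lt0r_neq0// root4_gt0.
Qed.

Lemma ler_root4 x y : `|x| <= `|y| -> root4 x <= root4 y.
Proof. by move=> xy; rewrite /root4 ge0_ler_powR ?invr_ge0// nnegrE. Qed.

(** Interpolation: a quantity that is both bounded by 1 and Lipschitz is Hoelder of order 1/4. *)
Lemma min1_root4 x a : a <= 1 -> a <= `|x| -> a <= root4 x.
Proof.
move=> a1 ax; have [x1|x1] := leP 1 `|x|.
  by apply: le_trans a1 _; rewrite -root4_1 ler_root4// normr1.
apply: le_trans ax _.
have r1 : root4 x <= 1 by rewrite -root4_1 ler_root4// normr1 ltW.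
by rewrite -root4X exprS ler_piMr ?exprn_ile1// ?root4_ge0.
Qed.

End root4.

Section gauss_bounds.
Context {R : realType}.
Implicit Types x y h k : R.

Let g x : R := expR (- (x ^+ 2 / 2)).

Let g_ge0 x : 0 <= g x. Proof. exact: expR_ge0. Qed.
Let g_le1 x : g x <= 1.
Proof. by rewrite expR_le1 oppr_le0 divr_ge0// sqr_ge0. Qed.

Let g' x := - x * g x.
Let g'' x := (x ^+ 2 - 1) * g x.

Let dg x : is_derive x 1 g (g' x).
Proof.
rewrite /g /g'.
apply: is_derive_eq.
rewrite !scaler1 /GRing.scale /= /g; by field.
Qed.

Let dg' x : is_derive x 1 g' (g'' x).
Proof.
have dgx := dg x; rewrite /g'.
apply: is_derive_eq.
rewrite /g'' /g' /GRing.scale /=; ring.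
Qed.

Let g''_le2 x : `|g'' x| <= 2.
Proof.
have xg : x ^+ 2 * g x <= 2.
  rewrite /g expRN ler_pdivrMr ?expR_gt0//.
  have := expR_ge1Dx (x ^+ 2 / 2); set e := expR _; lra.
have x2 := sqr_ge0 x; have := g_ge0 x; have := g_le1 x.
rewrite /g'' ler_norml => g1 g0; apply/andP; split; nra.
Qed.

Let mvt (f f' : R -> R) (M : R) : (forall x, is_derive x 1 f (f' x)) ->
  (forall x, `|f' x| <= M) -> forall x y, `|f x - f y| <= M * `|x - y|.
Proof.
move=> df fM.
suff H x y : x < y -> `|f y - f x| <= M * `|y - x|.
  move=> x y; have [xy|xy|->] := ltgtP x y.
  - by rewrite distrC (distrC x); exact: H.
  - exact: H.
  - by rewrite !subrr normr0 mulr0.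
move=> xy; have [|c _ ->] := MVT xy (fun x _ => df x).
  apply: continuous_subspaceT => z; apply: differentiable_continuous.
  by apply/derivable1_diffP; exact: (@ex_derive _ _ _ _ _ _ _ (df z)).
by rewrite normrM ler_wpM2r.
Qed.

Let g'_le1 x : `|g' x| <= 1.
Proof.
have xg : x ^+ 2 * g x ^+ 2 <= 1.
  rewrite /g -expRM_natl mulrN expRN ler_pdivrMr ?expR_gt0//.
  by rewrite mul1r; apply: le_trans (expR_ge1Dx _); lra.
by rewrite -(@ler_sqr _ _ 1) ?nnegrE// real_normK ?num_real// expr1n /g' exprMn sqrrN.
Qed.

Let g_lip x y : `|g x - g y| <= `|x - y|.
Proof. by rewrite -[leRHS]mul1r; exact: (mvt dg g'_le1). Qed.

Let g_diff1 x y : `|g x - g y| <= 1.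
Proof. 
have := g_ge0 x; have := g_ge0 y; have := g_le1 x; have := g_le1 y.
by rewrite ler_norml => *; lra.
Qed.

Let g_root4 x y : `|g x - g y| <= root4 (x - y).
Proof. by rewrite min1_root4. Qed.

(** Since [g''] is bounded by 2, the function y -> g (y + h) - g y has derivative at most 2 |h|; a
    second use of the mean value theorem gives the factor |k|. *)
Let g_double x h k : `|(g (x + h + k) - g (x + h)) - (g (x + k) - g x)| <= 2 * `|h| * `|k|.
Proof.
pose F y := g (y + h) - g y.
have dF (z : R) : is_derive z 1 F (g' (z + h) - g' z).
  rewrite /F; apply: is_deriveB.
  have := @is_derive1_comp _ g (fun y => y + h) z _ _ (dg (z + h)) _.
  by move=> /(_ 1); rewrite mulr1; apply; apply: is_derive_eq; rewrite addr0.
  exact: dg.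
have F' : forall z, `|g' (z + h) - g' z| <= 2 * `|h|.
  move=> z; have := mvt dg' g''_le2 (z + h) z; by rewrite addrAC subrr add0r.
have := mvt dF F' (x + k) x.
rewrite (_ : x + k - x = k); last by ring.
rewrite /F (addrAC x k h); congr (_ <= _); congr `|_|; ring.
Qed.

(** The four bounds 2, 2 |h|, 2 |k| and 2 |h| |k| combine to 2 min(1, |h|) min(1, |k|), and each
    minimum is at most a fourth root. *)
Let g_double_root4 x h k :
  `|(g (x + h + k) - g (x + h)) - (g (x + k) - g x)| <= 2 * root4 h * root4 k.
Proof.
set D := `|_|.
have Dh : D <= 2 * `|h|.
  have -> : D = `|(g (x + h + k) - g (x + k)) - (g (x + h) - g x)|.
    by rewrite /D; congr `|_|; ring.
  apply: le_trans (ler_normB _ _) _.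
  have := g_lip (x + h + k) (x + k); have := g_lip (x + h) x.
  rewrite (_ : x + h - x = h); last by ring.
  by rewrite (_ : x + h + k - (x + k) = h); [lra|ring].
have Dk : D <= 2 * `|k|.
  apply: le_trans (ler_normB _ _) _.
  have := g_lip (x + h + k) (x + h); have := g_lip (x + k) x.
  rewrite (_ : x + k - x = k); last by ring.
  by rewrite (_ : x + h + k - (x + h) = k); [lra|ring].
have D2 : D <= 2.
  apply: le_trans (ler_normB _ _) _.
  by have := g_diff1 (x + h + k) (x + h); have := g_diff1 (x + k) x; lra.
have Dhk := g_double x h k; rewrite -/D in Dhk.
have mh : Num.min 1 `|h| <= root4 h by rewrite min1_root4// ge_min lexx ?orbT.
have mk : Num.min 1 `|k| <= root4 k by rewrite min1_root4// ge_min lexx ?orbT.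
have h0 := normr_ge0 h; have k0 := normr_ge0 k.
apply: (@le_trans _ _ (2 * Num.min 1 `|h| * Num.min 1 `|k|)).
  by rewrite /Num.min; case: ifP => _; case: ifP => _; lra.
rewrite -!mulrA ler_pM2l//; apply: ler_pM => //; by rewrite le_min ler01 /=.
Qed.

Variable s : R.
Hypothesis s0 : 0 < s.
Local Notation p := (normal_pdf 0 s).

Let normal_pdf_gE x : p x = normal_peak s * g (x / s).
Proof.
rewrite normal_pdfE ?gt_eqF// /normal_fun subr0 /g; congr (_ * expR _).
by field; rewrite gt_eqF.
Qed.

Let normal_peak_le : normal_peak s <= s^-1.
Proof.
rewrite /normal_peak lef_pV2 ?posrE ?sqrtr_gt0//; last first.
  by rewrite mulrn_wgt0// mulr_gt0 ?exprn_gt0 ?pi_gt0.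
suff : Num.sqrt (s ^+ 2) <= Num.sqrt (s ^+ 2 * pi *+ 2).
  by rewrite sqrtr_sqr ger0_norm// ltW.
rewrite ler_wsqrtr// -mulrnAr ler_peMr ?sqr_ge0//.
have := @pi_ge2 R; rewrite mulr2n; lra.
Qed.

Let scale_bound a b : 0 <= b -> `|a| <= b -> `|normal_peak s * a| <= s^-1 * b.
Proof.
by move=> b0 ab; rewrite normrM ler_pM// ger0_norm// normal_peak_ge0.
Qed.

Lemma normal_pdf_le x : `|p x| <= s^-1.
Proof.
by rewrite normal_pdf_gE -[s^-1]mulr1 scale_bound// ger0_norm.
Qed.

Lemma normal_pdf_holder x y : `|p x - p y| <= s^-1 * (root4 (x - y) / root4 s).
Proof.
rewrite !normal_pdf_gE -mulrBr scale_bound//.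
  by rewrite divr_ge0 ?root4_ge0.
by apply: le_trans (g_root4 _ _) _; rewrite -mulrBl root4M root4V// gt_eqF.
Qed.

Lemma normal_pdf_double_holder x h k :
  `|(p (x + h + k) - p (x + h)) - (p (x + k) - p x)| <=
  2 * s^-1 * (root4 h / root4 s) * (root4 k / root4 s).
Proof.
rewrite (_ : 2 * _ * _ * _ = s^-1 * (2 * (root4 h / root4 s) * (root4 k / root4 s))); last by ring.
rewrite !normal_pdf_gE -!mulrBr.
have -> : (x + h + k) / s = x / s + h / s + k / s by ring.
have -> : (x + h) / s = x / s + h / s by ring.
have -> : (x + k) / s = x / s + k / s by ring.
have s4 : s != 0 by rewrite gt_eqF.
rewrite scale_bound ?mulr_ge0 ?invr_ge0 ?root4_ge0//.
by apply: le_trans (g_double_root4 _ _ _) _; rewrite !root4M !root4V.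
Qed.

End gauss_bounds.

(** * Exponential moments of occupation differences *)

Section average.
Context {R : realType}.
Local Notation mu := (@lebesgue_measure R).
Implicit Types (a b : R) (f g : R -> R).

Definition average a b f : R := (b - a)^-1 * \int[mu]_(z in `[a, b[) f z.

Lemma itv_co_lty a b : (mu `[a, b[%classic < +oo)%E.
Proof. by rewrite lebesgue_measure_itv/=; case: ifP => _; rewrite ?ltry// -EFinB ltry. Qed.

Lemma bounded_integrable_itv a b f M : measurable_fun setT f ->
  (forall z, `|f z| <= M) -> mu.-integrable `[a, b[ (EFin \o f).
Proof.
move=> mf fM; apply: measurable_bounded_integrable => //.
- exact: itv_co_lty.
- exact: measurable_funTS.
- exists M; split; first exact: num_real.
  by move=> y My z _; apply: le_trans (fM z) _; exact: ltW.
Qed.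

Lemma average_bounds a b f M l u : a < b -> measurable_fun setT f ->
  (forall z, `|f z| <= M) ->
  (forall z, z \in `[a, b[ -> l <= f z <= u) -> l <= average a b f <= u.
Proof.
move=> ab mf fM lfu.
have fi := bounded_integrable_itv a b mf fM.
have ci (r : R) : mu.-integrable `[a, b[ (EFin \o cst r).
  by apply: (@bounded_integrable_itv _ _ _ `|r|).
have E (r : R) : \int[mu]_(z in `[a, b[) (cst r) z = r * (b - a).
  rewrite Rintegral_cst//; congr (_ * _).
  by rewrite /= lebesgue_measure_itv/= lte_fin ab -EFinB.
have ba : 0 < b - a by rewrite subr_gt0.
rewrite /average mulrC ler_pdivlMr// ler_pdivrMr// -!E; apply/andP; split.
  by apply: le_Rintegral => // z zab; have /andP[] := lfu z zab.
by apply: le_Rintegral => // z zab; have /andP[] := lfu z zab.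
Qed.

Lemma averageB a b f g M : measurable_fun setT f -> measurable_fun setT g ->
  (forall z, `|f z| <= M) -> (forall z, `|g z| <= M) ->
  average a b (f \- g) = average a b f - average a b g.
Proof.
move=> mf mg fM gM; rewrite /average -mulrBr -RintegralB//;
  exact: bounded_integrable_itv.
Qed.

Lemma average_dist a b a' b' f M D : a < b -> a' < b' -> measurable_fun setT f ->
  (forall z, `|f z| <= M) ->
  (forall z z', z \in `[a, b[ -> z' \in `[a', b'[ -> `|f z - f z'| <= D) ->
  `|average a b f - average a' b' f| <= D.
Proof.
move=> ab ab' mf fM fD.
have H z : z \in `[a, b[ -> f z - D <= average a' b' f <= f z + D.
  move=> zab; apply: (average_bounds ab' mf fM) => z' z'ab.
  by have := fD _ _ zab z'ab; rewrite ler_norml; lra.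
have : average a' b' f - D <= average a b f <= average a' b' f + D.
  by apply: (average_bounds ab mf fM) => z zab; have := H _ zab; lra.
by rewrite ler_norml; lra.
Qed.

End average.

Section sum_root4.
Context {R : realType}.

(** A Riemann sum of t^(-3/4). If s and r are the fourth roots of consecutive grid points, then e =
    r^4 - s^4 <= 4 r^3 (r - s), and the differences r - s telescope. *)
Lemma sum_root4 (e : R) n : 0 < e ->
  \sum_(m < n) e * (root4 (m.+1%:R * e))^-1 ^+ 3 <= 4 * root4 (n%:R * e).
Proof.
move=> e0; elim: n => [|n IH]; first by rewrite big_ord0 mulr_ge0// root4_ge0.
rewrite big_ord_recr/=; apply: le_trans (lerD IH (lexx _)) _.
set s := root4 (n%:R * e); set r := root4 (n.+1%:R * e).
have s0 : 0 <= s by exact: root4_ge0.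
have r0 : 0 < r by rewrite root4_gt0// gt_eqF// mulr_gt0// ltr0n.
have sr : s <= r.
  by rewrite ler_root4// !ger0_norm ?mulr_ge0 ?(ltW e0)// ler_pM2r// ler_nat.
suff : e * r^-1 ^+ 3 <= 4 * (r - s) by lra.
have -> : e = r ^+ 4 - s ^+ 4.
  rewrite /r /s !root4X !ger0_norm ?mulr_ge0 ?(ltW e0)//.
  by rewrite -natr1; ring.
rewrite exprVn ler_pdivrMr ?exprn_gt0//.
have -> : r ^+ 4 - s ^+ 4 = (r - s) * (r ^+ 3 + r ^+ 2 * s + r * s ^+ 2 + s ^+ 3) by ring.
have -> : 4 * (r - s) * r ^+ 3 = (r - s) * (4 * r ^+ 3) by ring.
apply: ler_wpM2l; first by rewrite subr_ge0.
have H1 : r ^+ 2 * s <= r ^+ 3 by rewrite [leRHS]exprSr ler_wpM2l// sqr_ge0.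
have H2 : r * s ^+ 2 <= r ^+ 3.
  by rewrite [leRHS]exprS ler_wpM2l ?(ltW r0)// lerXn2r// nnegrE// ltW.
have H3 : s ^+ 3 <= r ^+ 3 by rewrite lerXn2r// nnegrE// ltW.
lra.
Qed.

End sum_root4.

Section holder_arithmetic.
Context {R : realType}.
Implicit Types u v p q A C D r s t V : R.

Lemma dist_mul_le u v p q A C D M : `|u - v| <= A -> `|p| <= C -> `|v| <= M ->
  `|p - q| <= D -> `|u * p - v * q| <= A * C + M * D.
Proof.
move=> uv pC vM pq; rewrite (_ : u * p - v * q = (u - v) * p + v * (p - q)); last by ring.
by apply: le_trans (ler_normD _ _) _; rewrite !normrM lerD// ler_pM.
Qed.

(** In the application [s] is the fourth root of |z - z'| and [r] a bound for it, [V] is the inverse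
    fourth root of the standard deviation, and [t] bounds its fourth root. The spare factor t V >= 1
    raises the power of [V] from 5 to 6, so that both estimates lead to the same sum over time. *)
Let holder_bound1 r s t V : 0 <= r -> 0 <= s -> s <= r -> 0 <= V -> 0 < t -> t^-1 <= V ->
  s / t * V ^+ 4 + 2 * (V ^+ 4 * (s * V)) <= 3 * r * t * V ^+ 6.
Proof.
move=> r0 s0 sr V0 t0 tV.
have tV1 : 1 <= t * V by rewrite -ler_pdivrMl// mulr1.
have H1 : s / t * V ^+ 4 <= r * V * V ^+ 4.
  apply: ler_wpM2r; first exact: exprn_ge0.
  by apply: ler_pM => //; rewrite invr_ge0 ltW.
have H2 : s * V ^+ 5 <= r * V ^+ 5 by apply: ler_wpM2r => //; exact: exprn_ge0.
have H3 : r * V ^+ 5 <= r * V ^+ 5 * (t * V).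
  by rewrite ler_peMr// mulr_ge0// exprn_ge0.
have E1 : r * V * V ^+ 4 = r * V ^+ 5 by ring.
have E2 : V ^+ 4 * (s * V) = s * V ^+ 5 by ring.
have E3 : 3 * r * t * V ^+ 6 = 3 * (r * V ^+ 5 * (t * V)) by ring.
rewrite E2 E3; lra.
Qed.

Let holder_bound2 r s t V r' : 0 <= r -> 0 <= s -> s <= r -> 0 <= V -> 0 < t -> t^-1 <= V ->
  0 <= r' ->
  s / t * (V ^+ 4 * (r' * V)) + 2 * (2 * V ^+ 4 * (s * V) * (r' * V)) <=
  5 * r * r' * V ^+ 6.
Proof.
move=> r0 s0 sr V0 t0 tV r'0.
have H1 : s / t * (V ^+ 4 * (r' * V)) <= r * V * (V ^+ 4 * (r' * V)).
  apply: ler_wpM2r; first by rewrite !mulr_ge0// exprn_ge0.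
  by apply: ler_pM => //; rewrite invr_ge0 ltW.
have H2 : s * (r' * V ^+ 6) <= r * (r' * V ^+ 6).
  by apply: ler_wpM2r => //; rewrite mulr_ge0// exprn_ge0.
have E1 : r * V * (V ^+ 4 * (r' * V)) = r * (r' * V ^+ 6) by ring.
have E2 : 2 * (2 * V ^+ 4 * (s * V) * (r' * V)) = 4 * (s * (r' * V ^+ 6)) by ring.
have E3 : 5 * r * r' * V ^+ 6 = 5 * (r * (r' * V ^+ 6)) by ring.
rewrite E2 E3; lra.
Qed.

(** Here [u] and [v] stand for the values at z and z' of the mean at a later time: bounded by 2 and
    Hoelder with constant 1/t. The estimate compares its Gaussian averages over two nearby cells. *)
Lemma normal_pdf_dist_le (sg r t : R) (x z z' : R) (u v : R) : 0 < sg ->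
  root4 (z - z') <= r -> 0 < t -> root4 sg <= t -> `|v| <= 2 ->
  `|u - v| <= root4 (z - z') / t ->
  `|u * normal_pdf 0 sg (z - x) - v * normal_pdf 0 sg (z' - x)| <=
  3 * r * t * (root4 sg)^-1 ^+ 6.
Proof.
move=> sg0 zr t0 sgt v2 uv.
have B0 : 0 < root4 sg by rewrite root4_gt0// gt_eqF.
have sE : sg^-1 = (root4 sg)^-1 ^+ 4 by rewrite exprVn root4X ger0_norm// ltW.
have H1 := normal_pdf_le sg0 (z - x).
have H2 := normal_pdf_holder sg0 (z - x) (z' - x).
have E : z - x - (z' - x) = z - z' by ring.
rewrite E sE in H2; rewrite sE in H1.
apply: le_trans (dist_mul_le uv H1 v2 H2) _; apply: holder_bound1 => //.
- exact: le_trans (root4_ge0 _) zr.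
- exact: root4_ge0.
- by rewrite invr_ge0 ltW.
- by rewrite lef_pV2 ?posrE.
Qed.

(** The same comparison for the difference between two starting points x and x'; it propagates the
    Hoelder bound backward in time. *)
Lemma normal_pdf_double_dist_le (sg r t : R) (x x' z z' : R) (u v : R) : 0 < sg ->
  root4 (z - z') <= r -> 0 < t -> root4 sg <= t -> `|v| <= 2 ->
  `|u - v| <= root4 (z - z') / t ->
  `|(u * normal_pdf 0 sg (z - x) - u * normal_pdf 0 sg (z - x')) -
    (v * normal_pdf 0 sg (z' - x) - v * normal_pdf 0 sg (z' - x'))| <=
  5 * r * root4 (x - x') * (root4 sg)^-1 ^+ 6.
Proof.
move=> sg0 zr t0 sgt v2 uv.
have B0 : 0 < root4 sg by rewrite root4_gt0// gt_eqF.
have sE : sg^-1 = (root4 sg)^-1 ^+ 4 by rewrite exprVn root4X ger0_norm// ltW.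
have H1 := normal_pdf_holder sg0 (z - x) (z - x').
have H2 := normal_pdf_double_holder sg0 (z' - x) (z - z') (x - x').
have E1 : z - x - (z - x') = - (x - x') by ring.
have E2 : z' - x + (z - z') + (x - x') = z - x' by ring.
have E3 : z' - x + (z - z') = z - x by ring.
have E4 : z' - x + (x - x') = z' - x' by ring.
rewrite E1 /root4 normrN -/(root4 _) -/(root4 _) sE in H1; rewrite E2 E3 E4 sE in H2.
rewrite -!mulrBr.
set P1 := normal_pdf 0 sg (z - x) in H1 H2 *.
set P2 := normal_pdf 0 sg (z - x') in H1 H2 *.
set P3 := normal_pdf 0 sg (z' - x) in H1 H2 *.
set P4 := normal_pdf 0 sg (z' - x') in H1 H2 *.
rewrite (_ : P2 - P1 - (P4 - P3) = - (P1 - P2 - (P3 - P4))) ?normrN in H2; last by ring.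
apply: le_trans (dist_mul_le uv H1 v2 H2) _; apply: holder_bound2 => //.
- exact: le_trans (root4_ge0 _) zr.
- exact: root4_ge0.
- by rewrite invr_ge0 ltW.
- by rewrite lef_pV2 ?posrE.
- exact: root4_ge0.
Qed.

End holder_arithmetic.

(** * The backward recursion for a Gaussian walk *)

Section gaussian_walk.
Context {R : realType} {d : measure_display} {T : measurableType d}.
Variable P : probability T R.
Local Notation mu := (@lebesgue_measure R).
Variables (S : nat -> T -> R) (e : R) (K : nat).
Hypothesis e0 : 0 < e.
Hypothesis mS : forall i, measurable_fun setT (S i).
Hypothesis S_law : forall k i, (k < i)%N -> forall B, measurable B ->
  P ((fun w => S i w - S k w) @^-1` B) =
  normal_prob 0 (Num.sqrt ((i - k)%:R * e)) B.
Hypothesis S_indep : forall k i m, (k < i)%N ->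
  forall (B : set R) (C : 'I_m -> set R), measurable B ->
  (forall j, measurable (C j)) ->
  P ((fun w => S i w - S k w) @^-1` B `&`
     \bigcap_(j in [set: 'I_m]) ((fun w => S (i + j).+1 w - S (i + j)%N w) @^-1` C j)) =
  (P ((fun w => S i w - S k w)%R @^-1` B) *
   P (\bigcap_(j in [set: 'I_m]) ((fun w => S (i + j).+1 w - S (i + j)%N w)%R @^-1` C j)))%E.

Variables (a b a' b' c h : R).
Hypothesis ab : a < b.
Hypothesis ab' : a' < b'.
Hypothesis c0 : 0 <= c.
Hypothesis h_dist : forall z z', z \in `[a, b[ -> z' \in `[a', b'[ -> `|z - z'| <= h.
Hypothesis c_small : c * ((b - a)^-1 + (b' - a')^-1) <= 1.

(** Its integral along a path is the difference of the normalized occupation times of the two cells.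
    Its Lebesgue integral vanishes, so against a density only the variation between the cells
    counts. *)
Definition cell_diff (z : R) : R :=
  (b - a)^-1 * \1_(`[a, b[%classic) z - (b' - a')^-1 * \1_(`[a', b'[%classic) z.
Local Notation psi := cell_diff.

Lemma measurable_cell_diff : measurable_fun setT psi.
Proof.
by apply: measurable_funB; apply: measurable_funM => //; exact: measurable_indic.
Qed.

Let psi_le1 z : `|c * psi z| <= 1.
Proof.
rewrite normrM (ger0_norm c0); apply: le_trans c_small; apply: ler_wpM2l => //.
have H (u v : R) : u < v -> `|(v - u)^-1 * \1_(`[u, v[%classic) z| <= (v - u)^-1.
  move=> uv; have vu : 0 <= (v - u)^-1 by rewrite invr_ge0 subr_ge0 ltW.
  rewrite normrM (ger0_norm vu) ler_piMr// indicE.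
  by case: (_ \in _); rewrite ?normr1 ?normr0.
by apply: le_trans (ler_normB _ _) _; apply: lerD; exact: H.
Qed.

(** Factors [1 + c * psi] take the place of exponentials because dropping one of them changes the
    product by a term linear in [psi], which is an exact difference of two cell averages after
    taking means. *)
Definition walk_prod (i : nat) (x : R) (w : T) : R :=
  \prod_(i.+1 <= j < K.+1) (1 + c * psi (x + (S j w - S i w))).

Lemma walk_prod_ge0 i x w : 0 <= walk_prod i x w.
Proof.
by apply: prodr_ge0 => j _; have := psi_le1 (x + (S j w - S i w)); rewrite ler_norml; lra.
Qed.

Lemma walk_prod_le i x w : walk_prod i x w <= 2 ^+ (K - i).
Proof.
rewrite /walk_prod -subSS -prodr_const_nat; apply: ler_prod => j _.
by have := psi_le1 (x + (S j w - S i w)); rewrite ler_norml; lra.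
Qed.

Lemma measurable_walk_prod i :
  measurable_fun setT (fun z : R * T => walk_prod i z.1 z.2).
Proof.
apply: measurable_prod => j _.
apply: measurable_funD => //; apply: measurable_funM => //.
apply: (measurableT_comp measurable_cell_diff).
apply: measurable_funD; first exact: measurable_fst.
apply: measurable_funB; by apply: (measurableT_comp (mS _)); exact: measurable_snd.
Qed.

(** A discrete Feynman-Kac function: the conditional mean of the factors after time [i] when the
    walk is at [x] at time [i]. *)
Definition walk_mean i x : R := \int[P]_w walk_prod i x w.

Let mprod i x : measurable_fun setT (walk_prod i x).
Proof.
exact: (measurableT_comp (measurable_walk_prod i) (pair1_measurable x)).
Qed.

Let iprod i x : P.-integrable setT (EFin \o walk_prod i x).
Proof.
apply: measurable_bounded_integrable => //.
  by apply: le_lt_trans (probability_le1 _ _) _ => //; rewrite ltry.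
exists (2 ^+ (K - i)); split; first exact: num_real.
move=> y My w _ /=; rewrite ger0_norm ?walk_prod_ge0//.
by apply: le_trans (walk_prod_le _ _ _) _; exact: ltW.
Qed.

Lemma walk_meanE i x : (walk_mean i x)%:E = (\int[P]_w (walk_prod i x w)%:E)%E.
Proof. by rewrite /walk_mean /Rintegral fineK//; exact: (integrable_fin_num measurableT (iprod i x)). Qed.

Lemma walk_mean_ge0 i x : 0 <= walk_mean i x.
Proof. by apply: Rintegral_ge0 => w _; exact: walk_prod_ge0. Qed.

Lemma walk_mean_le i x : walk_mean i x <= 2 ^+ (K - i).
Proof.
rewrite -lee_fin walk_meanE.
rewrite -[leRHS]mule1 -(probability_setT P) -integral_cst//.
apply: ge0_le_integral => //.
- by move=> w _; rewrite lee_fin walk_prod_ge0.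
- by apply/measurable_EFinP.
- by move=> w _; rewrite lee_fin walk_prod_le.
Qed.

Lemma measurable_walk_mean i : measurable_fun setT (walk_mean i).
Proof.
apply/measurable_EFinP.
rewrite (_ : EFin \o _ = fubini_F P (fun z : R * T => (walk_prod i z.1 z.2)%:E)).
  apply: measurable_fun_fubini_tonelli_F.
    by apply/measurable_EFinP; exact: measurable_walk_prod.
  by move=> z; rewrite lee_fin walk_prod_ge0.
by apply/funext => x; rewrite /= walk_meanE.
Qed.

Let sigma k i : R := Num.sqrt ((i - k)%:R * e).
Let p k i := normal_pdf 0 (sigma k i).

Definition future (i : nat) : 'I_(K - i) -> T -> R :=
  fun j w => S (i + j).+1 w - S (i + j)%N w.

Lemma measurable_future i j : measurable_fun setT (@future i j).
Proof. exact: measurable_funB. Qed.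

(** Each [S (i + n) - S i] is a sum of the increments in [future i], so the product is measurable
    for the sigma-algebra they generate, as [ge0_indep_integral] demands. *)
Lemma measurable_walk_prod_future i :
  measurable_fun setT (fun z : R * g_sigma_algebraType (cylinders (@future i)) =>
    walk_prod i z.1 z.2).
Proof.
set TV := g_sigma_algebraType _.
have mSV n : (n <= K - i)%N ->
    measurable_fun setT ((fun w => S (i + n)%N w - S i w) : TV -> R).
  elim: n => [_|n IH nK].
    by rewrite addn0 (_ : (fun w => _) = cst 0)//; apply/funext => w; rewrite subrr.
  rewrite (_ : (fun w => _) =
      (fun w => future (Ordinal nK) w + (S (i + n)%N w - S i w))); last first.
    by apply/funext => w; rewrite /future addnS /=; ring.
  apply: measurable_funD.
    exact: (@measurable_cylinders _ _ _ _ (@future i) (Ordinal nK)).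
  by apply: IH; exact: ltnW.
rewrite (_ : (fun z : R * TV => _) = (fun z : R * TV =>
   \prod_(l < K - i) (1 + c * psi (z.1 + (S (i + l.+1)%N z.2 - S i z.2))))).
  apply: measurable_prod => l _.
  apply: measurable_funD => //; apply: measurable_funM => //.
  apply: (measurableT_comp measurable_cell_diff).
  apply: measurable_funD; first exact: measurable_fst.
  exact: (measurableT_comp (mSV _ (ltn_ord l)) measurable_snd).
apply/funext => z; rewrite /walk_prod -(add0n i.+1) big_addn subSS big_mkord.
by apply: eq_bigr => l _; rewrite addnC addSn -addnS.
Qed.

(** The Markov property at time [i]: the later factors depend on independent increments and average
    to [walk_mean i], and the position has a Gaussian density. The weight [q] is non-negative since
    it will be the normalized indicator of one cell at a time; [psi] itself changes sign. *)
Lemma walk_markov k i x (q : R -> R) : (k < i)%N -> measurable_fun setT q ->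
  (forall z, 0 <= q z) ->
  (\int[P]_w (q (x + (S i w - S k w)) * walk_prod i (x + (S i w - S k w)) w)%:E =
   \int[mu]_z (q z * walk_mean i z * p k i (z - x))%:E)%E.
Proof.
move=> ki mq q0.
pose X w := S i w - S k w.
have mX : measurable_fun setT X by exact: measurable_funB.
pose TV := g_sigma_algebraType (cylinders (@future i)).
pose G (z : R * TV) : \bar R := (q (x + z.1) * walk_prod i (x + z.1) z.2)%:E.
have G0 z : (0 <= G z)%E by rewrite lee_fin mulr_ge0// walk_prod_ge0.
have m1 : measurable_fun setT (fun z : R * TV => x + z.1).
  by apply: measurable_funD => //; exact: measurable_fst.
have mG : measurable_fun setT G.
  apply/measurable_EFinP; apply: measurable_funM.
    exact: (measurableT_comp mq).
  apply: (measurableT_comp (@measurable_walk_prod_future i)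
    (_ : measurable_fun setT (fun z : R * TV => (x + z.1, z.2)))).
  by apply/measurable_fun_pair => //=; exact: measurable_snd.
pose f z := q z * walk_mean i z * p k i (z - x).
have mf : measurable_fun setT f.
  apply: measurable_funM; first by apply: measurable_funM => //; exact: measurable_walk_mean.
  by apply: (measurableT_comp (measurable_normal_pdf _ _)); exact: measurable_funB.
have f0 z : 0 <= f z by rewrite !mulr_ge0 ?walk_mean_ge0 ?normal_pdf_ge0.
have mqv : measurable_fun setT (fun y => (q (x + y) * walk_mean i (x + y))%:E).
  apply/measurable_EFinP; apply: measurable_funM.
    by apply: (measurableT_comp mq); exact: measurable_funD.
  by apply: (measurableT_comp (measurable_walk_mean i)); exact: measurable_funD.
have qv0 y : (0 <= (q (x + y) * walk_mean i (x + y))%:E)%E.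
  by rewrite lee_fin mulr_ge0// walk_mean_ge0.
transitivity (\int[P]_w G (X w, w))%E.
  exact: eq_integral.
rewrite (ge0_indep_integral mX (@measurable_future i) _ mG G0); last by move=> B C mB mC; exact: S_indep.
transitivity (\int[P]_w (q (x + X w) * walk_mean i (x + X w))%:E)%E.
  apply: eq_integral => w _; rewrite /G /=.
  under eq_integral do rewrite EFinM.
  rewrite ge0_integralZl_EFin//.
  - by rewrite EFinM walk_meanE.
  - by move=> w' _; rewrite lee_fin walk_prod_ge0.
  - by apply/measurable_EFinP.
apply: etrans (ge0_integral_normal_law mX (@S_law _ _ ki) mqv qv0) _.
rewrite -[RHS](ge0_integralD_translation x measurableT).
- by apply: eq_integral => y _; rewrite -EFinM addrAC subrr add0r.
- exact/measurable_EFinP.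
- by move=> y; rewrite lee_fin; exact: f0.
Qed.

Lemma walk_mean_last x : walk_mean K x = 1.
Proof.
apply: EFin_inj; rewrite walk_meanE.
under eq_integral => w _ do rewrite /walk_prod big_geq//.
rewrite integral_cst// mul1e; exact: probability_setT.
Qed.

(* Interpolates, for i from k to K, between [walk_mean k x] and 1. *)
Definition walk_tail k i x : R := \int[P]_w walk_prod i (x + (S i w - S k w)) w.

Lemma measurable_walk_tail_fun k i x :
  measurable_fun setT (fun w => walk_prod i (x + (S i w - S k w)) w).
Proof.
apply: (measurableT_comp (measurable_walk_prod i)
  (_ : measurable_fun setT (fun w => (x + (S i w - S k w), w)))).
apply/measurable_fun_pair => //=; apply: measurable_funD => //.
exact: measurable_funB.
Qed.

Lemma bounded_integrable (f : T -> R) M : measurable_fun setT f ->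
  (forall w, `|f w| <= M) -> P.-integrable setT (EFin \o f).
Proof.
move=> mf fM; apply: measurable_bounded_integrable => //.
  by apply: le_lt_trans (probability_le1 _ _) _ => //; rewrite ltry.
exists M; split; first exact: num_real.
by move=> y My w _ /=; apply: le_trans (fM w) _; exact: ltW.
Qed.

Let sigma_gt0 k i : (k < i)%N -> 0 < sigma k i.
Proof. by move=> ki; rewrite sqrtr_gt0 mulr_gt0// ltr0n subn_gt0. Qed.

Let mvp k i x : measurable_fun setT (fun z => walk_mean i z * p k i (z - x)).
Proof.
apply: measurable_funM; first exact: measurable_walk_mean.
by apply: (measurableT_comp (measurable_normal_pdf _ _)); exact: measurable_funB.
Qed.

Let vp_le k i x : (k < i)%N -> forall z,
  `|walk_mean i z * p k i (z - x)| <= 2 ^+ (K - i) * (sigma k i)^-1.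
Proof.
move=> ki z; rewrite normrM ler_pM//.
  by rewrite ger0_norm ?walk_mean_ge0 ?walk_mean_le.
exact: normal_pdf_le (sigma_gt0 ki) _.
Qed.

Let avg_prod (u v : R) k i x : u < v -> (k < i)%N ->
  \int[P]_w ((v - u)^-1 * \1_(`[u, v[%classic) (x + (S i w - S k w)) *
     walk_prod i (x + (S i w - S k w)) w) =
  average u v (fun z => walk_mean i z * p k i (z - x)).
Proof.
move=> uv ki; rewrite /average /Rintegral.
have vu0 : 0 <= (v - u)^-1 by rewrite invr_ge0 subr_ge0 ltW.
have mq : measurable_fun setT (fun z : R => (v - u)^-1 * \1_(`[u, v[%classic) z).
  by apply: measurable_funM => //; exact: measurable_indic.
have q0 (z : R) : 0 <= (v - u)^-1 * \1_(`[u, v[%classic) z by rewrite mulr_ge0.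
rewrite (walk_markov x ki mq q0).
transitivity (fine (\int[mu]_z (((v - u)^-1)%:E *
    (\1_(`[u, v[%classic) z * (walk_mean i z * p k i (z - x)))%:E))%E).
  congr fine; apply: eq_integral => z _; rewrite -EFinM; congr EFin; ring.
rewrite ge0_integralZl_EFin//; last 2 first.
- by move=> z _; rewrite lee_fin !mulr_ge0 ?walk_mean_ge0 ?normal_pdf_ge0.
- apply/measurable_EFinP; apply: measurable_funM; first exact: measurable_indic.
  exact: mvp.
rewrite [X in (_ * X)%E](_ : _ = (\int[mu]_(z in `[u, v[) (walk_mean i z * p k i (z - x))%:E)%E).
  by rewrite fineM//; apply: integrable_fin_num => //; exact: (bounded_integrable_itv _ _ (mvp _ _ _) (vp_le x ki)).
rewrite [RHS]integral_mkcond; apply: eq_integral => z _.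
rewrite patchE indicE; case: ifPn => _; rewrite ?mul1r ?mul0r//.
Qed.

(** The two products differ by the factor at time [i], and the Markov property evaluates its part
    [c * psi] on each cell separately. *)
Lemma walk_tail_step k i x : (k < i <= K)%N ->
  walk_tail k i.-1 x - walk_tail k i x =
  c * (average a b (fun z => walk_mean i z * p k i (z - x)) -
       average a' b' (fun z => walk_mean i z * p k i (z - x))).
Proof.
move=> /andP[ki iK]; rewrite -!avg_prod//.
have mX : measurable_fun setT (fun w => x + (S i w - S k w)).
  by apply: measurable_funD => //; exact: measurable_funB.
have I (u v : R) : P.-integrable setT (EFin \o (fun w : T =>
    (v - u)^-1 * \1_(`[u, v[%classic) (x + (S i w - S k w)) *
     walk_prod i (x + (S i w - S k w)) w)).
  apply: (@bounded_integrable _ (`|(v - u)^-1| * 2 ^+ (K - i))).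
    apply: measurable_funM; last exact: measurable_walk_tail_fun.
    apply: measurable_funM => //; apply: (measurableT_comp _ mX).
    exact: measurable_indic.
  move=> w; rewrite !normrM ler_pM ?mulr_ge0//.
    by rewrite ler_piMr// indicE; case: (_ \in _); rewrite ?normr1 ?normr0.
  by rewrite ger0_norm ?walk_prod_ge0 ?walk_prod_le.
have I2 l : P.-integrable setT (EFin \o (fun w : T => walk_prod l (x + (S l w - S k w)) w)).
  apply: (@bounded_integrable _ (2 ^+ (K - l))); first exact: measurable_walk_tail_fun.
  by move=> w; rewrite ger0_norm ?walk_prod_ge0 ?walk_prod_le.
rewrite -[X in c * X]RintegralB// -RintegralZl//; last first.
  exact: (integrableB measurableT (I a b) (I a' b')).
rewrite /walk_tail -[LHS]RintegralB//; apply: eq_Rintegral => w _ /=.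
have -> : walk_prod i.-1 (x + (S i.-1 w - S k w)) w =
    (1 + c * psi (x + (S i w - S k w))) * walk_prod i (x + (S i w - S k w)) w.
  rewrite /walk_prod prednK; last by case: (i) ki.
  rewrite big_ltn//; congr ((1 + c * psi _) * _); first ring.
  by apply: eq_bigr => j _; congr (1 + c * psi _); ring.
rewrite /psi; ring.
Qed.

(** The eighth root of the total time [K%:R * e]. *)
Let t8 := root4 (Num.sqrt (K%:R * e)).
Hypothesis K0 : (0 < K)%N.
Hypothesis small : 20 * (c / e) * root4 h * t8 ^+ 3 <= 1.

Let t8_gt0 : 0 < t8.
Proof. by rewrite root4_gt0// gt_eqF// sqrtr_gt0 mulr_gt0// ltr0n. Qed.

Let root4_sqrt (y : R) : 0 <= y -> root4 (Num.sqrt y) ^+ 2 = root4 y.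
Proof. by move=> y0; rewrite expr2 -root4M -expr2 sqr_sqrtr. Qed.

Let B k i := root4 (sigma k i).

Let B_le k i : (i <= K)%N -> B k i <= t8.
Proof.
move=> iK; apply: ler_root4; rewrite !ger0_norm ?sqrtr_ge0//.
by rewrite ler_wsqrtr// ler_pM2r// ler_nat; lia.
Qed.

(** The induction must carry the Hoelder bound together with the upper bound, since the means are
    compared at points of different cells. The constant [1 / t8] is the one that reproduces itself:
    summing the changes gives [20 * (c / e) * root4 h * t8 ^+ 2], which [small] bounds by
    [1 / t8]. *)
Let good i := (forall z, `|walk_mean i z| <= 2) /\
  (forall z z', `|walk_mean i z - walk_mean i z'| <= root4 (z - z') / t8).

Let root4_h z z' : z \in `[a, b[ -> z' \in `[a', b'[ -> root4 (z - z') <= root4 h.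
Proof.
move=> zab z'ab; apply: ler_root4; apply: le_trans (ler_norm h); exact: h_dist.
Qed.

Let term1 k i x : (k < i <= K)%N -> good i ->
  `|average a b (fun z => walk_mean i z * p k i (z - x)) -
    average a' b' (fun z => walk_mean i z * p k i (z - x))| <=
  3 * root4 h * t8 * (B k i)^-1 ^+ 6.
Proof.
move=> kiK [v2 vH]; have /andP[ki iK] := kiK.
apply: (average_dist ab ab' (mvp _ _ _) (vp_le x ki)) => z z' zab z'ab.
apply: normal_pdf_dist_le => //.
- exact: sigma_gt0.
- exact: root4_h.
- exact: B_le.
Qed.

Let term2 k i x x' : (k < i <= K)%N -> good i ->
  `|(average a b (fun z => walk_mean i z * p k i (z - x)) -
     average a' b' (fun z => walk_mean i z * p k i (z - x))) -
    (average a b (fun z => walk_mean i z * p k i (z - x')) -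
     average a' b' (fun z => walk_mean i z * p k i (z - x')))| <=
  5 * root4 h * root4 (x - x') * (B k i)^-1 ^+ 6.
Proof.
move=> kiK [v2 vH]; have /andP[ki iK] := kiK.
set f := fun z => walk_mean i z * p k i (z - x).
set g := fun z => walk_mean i z * p k i (z - x').
have -> : average a b f - average a' b' f - (average a b g - average a' b' g) =
    average a b (f \- g) - average a' b' (f \- g).
  rewrite (averageB a b (mvp _ _ _) (mvp _ _ _) (vp_le x ki) (vp_le x' ki)).
  rewrite (averageB a' b' (mvp _ _ _) (mvp _ _ _) (vp_le x ki) (vp_le x' ki)).
  move: (average a b f) (average a b g) (average a' b' f) (average a' b' g) => A1 A2 A3 A4.
  ring.
have fgM z : `|(f \- g) z| <= 2 * (2 ^+ (K - i) * (sigma k i)^-1).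
  apply: le_trans (ler_normB _ _) _.
  by have := vp_le x ki z; have := vp_le x' ki z; rewrite -/(f z) -/(g z); lra.
apply: (average_dist ab ab' (measurable_funB (mvp _ _ _) (mvp _ _ _)) fgM) => z z' zab z'ab.
apply: (@normal_pdf_double_dist_le _ _ _ t8) => //.
- exact: sigma_gt0.
- exact: root4_h.
- exact: B_le.
Qed.

(** The sixth power of [B k i] is the power 3/4 of the elapsed time [(i - k)%:R * e], and [t8 ^+ 2]
    is the power 1/4 of the total time. *)
Let sum_B k : (k < K)%N ->
  \sum_(k.+1 <= i < K.+1) (B k i)^-1 ^+ 6 <= 4 / e * t8 ^+ 2.
Proof.
move=> kK; rewrite -[k.+1]add0n big_addn subSS big_mkord.
apply: (@le_trans _ _ (e^-1 * \sum_(m < K - k) e * (root4 (m.+1%:R * e))^-1 ^+ 3)).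
  rewrite big_distrr/=; apply: ler_sum => m _.
  rewrite mulrA mulVf ?gt_eqF// mul1r.
  rewrite (_ : 6 = 2 * 3)%N// exprM exprVn root4_sqrt ?mulr_ge0 ?(ltW e0)//.
  by rewrite addnS subSn ?leq_addl// addnK.
rewrite mulrAC mulrC; apply: ler_wpM2r; first by rewrite invr_ge0 ltW.
apply: le_trans (sum_root4 _ e0) _; apply: ler_wpM2l => //.
rewrite root4_sqrt ?mulr_ge0 ?(ltW e0)//; apply: ler_root4.
rewrite !ger0_norm ?mulr_ge0 ?(ltW e0)//.
by rewrite ler_pM2r// ler_nat leq_subr.
Qed.

Let mean_sum k x : (k <= K)%N -> walk_mean k x - 1 =
  \sum_(k.+1 <= i < K.+1) c * (average a b (fun z => walk_mean i z * p k i (z - x)) -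
       average a' b' (fun z => walk_mean i z * p k i (z - x))).
Proof.
move=> kK.
have -> : walk_mean k x = walk_tail k k x.
  by apply: eq_Rintegral => w _; rewrite subrr addr0.
have -> : 1 = walk_tail k K x.
  rewrite -(walk_mean_last x); apply: eq_Rintegral => w _.
  by rewrite /walk_prod !big_geq.
rewrite -opprB -(telescope_sumr (walk_tail k ^~ x) kK) -sumrN [RHS]big_add1/=.
apply: eq_big_nat => i /andP[ki iK].
by rewrite opprB -walk_tail_step// ltnS ki.
Qed.

(* Backward induction on k: [mean_sum] expresses [walk_mean k - 1] through the
   Gaussian averages of the later [walk_mean i] over the two cells. *)
Lemma walk_mean_bounds k : (k <= K)%N -> good k.
Proof.
move=> kK; rewrite -(subKn kK); move: (K - k)%N (leq_subr k K) => {k kK} n.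
elim/ltn_ind: n => n IH nK.
have kK : (K - n <= K)%N by exact: leq_subr.
move: kK; set k := (K - n)%N => kK.
have gi i : (k.+1 <= i < K.+1)%N -> good i.
  move=> /andP[ki iK]; rewrite -(@subKn i K)//; apply: IH; rewrite ?leq_subr//.
  by rewrite /k in ki; lia.
have sB : \sum_(k.+1 <= i < K.+1) (B k i)^-1 ^+ 6 <= 4 / e * t8 ^+ 2.
  have [kK'|] := ltnP k K; first exact: sum_B.
  by move=> Kk; rewrite big_geq// mulr_ge0// ?divr_ge0 ?exprn_ge0 ?(ltW e0) ?(ltW t8_gt0).
have r0 := root4_ge0 h; have t0 := ltW t8_gt0.
have D1 x : `|walk_mean k x - 1| <= 1.
  rewrite mean_sum//; apply: le_trans (ler_norm_sum _ _ _) _.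
  apply: (@le_trans _ _ (c * (3 * root4 h * t8) * \sum_(k.+1 <= i < K.+1) (B k i)^-1 ^+ 6)).
    rewrite big_distrr/= big_nat_cond [leRHS]big_nat_cond; apply: ler_sum => i /andP[iK _].
    rewrite normrM (ger0_norm c0) -mulrA; apply: ler_wpM2l => //.
    by apply: term1 => //; exact: gi.
  apply: le_trans (_ : c * (3 * root4 h * t8) * (4 / e * t8 ^+ 2) <= _).
    by apply: ler_wpM2l => //; rewrite !mulr_ge0.
  apply: le_trans small.
  (* The constant 12 is 3 from [term1] times 4 from [sum_B]; the larger 20 = 5 * 4 comes from
     [term2] and fixes the constant in [small]. *)
  rewrite [leLHS](_ : _ = 12 * (c / e * root4 h * t8 ^+ 3)); last by ring.
  rewrite [leRHS](_ : _ = 20 * (c / e * root4 h * t8 ^+ 3)); last by ring.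
  by apply: ler_wpM2r; [rewrite !mulr_ge0 ?invr_ge0 ?exprn_ge0 ?(ltW e0)|rewrite ler_nat].
split=> [x|x x'].
  by have := D1 x; rewrite !ler_norml; lra.
rewrite (_ : _ - _ = (walk_mean k x - 1) - (walk_mean k x' - 1)); last by ring.
rewrite !mean_sum// -sumrB; apply: le_trans (ler_norm_sum _ _ _) _.
have rx := root4_ge0 (x - x').
apply: (@le_trans _ _ (c * (5 * root4 h * root4 (x - x')) * \sum_(k.+1 <= i < K.+1) (B k i)^-1 ^+ 6)).
  rewrite big_distrr/= big_nat_cond [leRHS]big_nat_cond; apply: ler_sum => i /andP[iK _].
  rewrite -mulrBr normrM (ger0_norm c0) -mulrA; apply: ler_wpM2l => //.
  by apply: term2 => //; exact: gi.
apply: le_trans (_ : c * (5 * root4 h * root4 (x - x')) * (4 / e * t8 ^+ 2) <= _).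
  by apply: ler_wpM2l => //; rewrite !mulr_ge0.
rewrite ler_pdivlMr//.
rewrite [leLHS](_ : _ = (20 * (c / e) * root4 h * t8 ^+ 3) * root4 (x - x')); last by ring.
by rewrite ler_piMl.
Qed.

End gaussian_walk.

(** * Brownian motion along a time grid *)

Section brownian_walk.
Context {R : realType} {d : measure_display} {T : measurableType d}.
Variable P : probability T R.
Variable W : R -> {RV P >-> R}.
Hypothesis bmW : brownian_motion W.

Lemma brownian_indep (s u t e : R) (m : nat) : 0 <= s -> s <= u -> u <= t -> 0 <= e ->
  forall (B : set R) (C : 'I_m -> set R), measurable B ->
  (forall j, measurable (C j)) ->
  forall V : 'I_m -> T -> R,
  (forall j w, V j w = W (t + j.+1%:R * e) w - W (t + j%:R * e) w) ->
  P ((fun w => W u w - W s w) @^-1` B `&`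
     \bigcap_(j in [set: 'I_m]) (V j @^-1` C j)) =
  (P ((fun w => W u w - W s w)%R @^-1` B) *
   P (\bigcap_(j in [set: 'I_m]) (V j @^-1` C j)))%E.
Proof.
move=> s0 su ut e0 B C mB mC V VE; case: bmW => _ ind _ _.
pose tm (n : nat) : R := if n is 0 then s else if n is 1 then u else t + (n - 2)%:R * e.
(* The increment from [u] to [t] enters the independence with the event setT. *)
have tm0 : 0 <= tm 0 by [].
have tmm : {homo tm : i j / (i <= j)%N >-> i <= j}.
  apply: homo_leq => //; first by move=> ? ? ?; exact: le_trans.
  case=> [//|[|n]]; first by rewrite /tm subnn mul0r addr0.
  by rewrite /tm lerD2l ler_wpM2r// ler_nat; lia.
pose D B' (i : 'I_(m.+2)) : set R := match unlift ord0 i with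
  | None => B'
  | Some i' => match unlift ord0 i' with None => setT | Some j => C j end end.
have mD B' : measurable B' -> forall i, measurable (D B' i).
  move=> mB' i; rewrite /D; case: (unlift _ _) => // i'; by case: (unlift _ _).
have E B' : measurable B' -> P ((fun w => W u w - W s w) @^-1` B' `&`
     \bigcap_(j in [set: 'I_m]) (V j @^-1` C j)) =
  (P ((fun w => W u w - W s w)%R @^-1` B') *
   \prod_(j < m) P (V j @^-1` C j))%E.
  move=> mB'; have := ind m.+2 tm tm0 tmm (D B') (mD _ mB').
  rewrite big_ord_recl big_ord_recl.
  have Dl0 : D B' ord0 = B' by rewrite /D unlift_none.
  have Dl1 : D B' (lift ord0 ord0) = setT by rewrite /D liftK unlift_none.
  have Dl2 j : D B' (lift ord0 (lift ord0 j)) = C j by rewrite /D !liftK.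
  have tl2 (j : 'I_m) : (fun w => W (tm (lift ord0 (lift ord0 j)).+1) w - W (tm (lift ord0 (lift ord0 j))) w) = V j.
    apply/funext => w; by rewrite VE /tm !lift0 /= !subSS !subn0.
  rewrite Dl0 Dl1 preimage_setT probability_setT mul1e.
  under eq_bigr do rewrite tl2 Dl2.
  move=> <-; congr (P _); apply/seteqP; split=> w.
    move=> [Bw Vw] i _ /=; case: (unliftP ord0 i) => [i'|] ->.
      case: (unliftP ord0 i') => [j|] ->.
        have := Vw j I; rewrite -[V j](tl2 j) /= Dl2; exact.
      by rewrite Dl1.
    by rewrite Dl0.
  move=> H; split; first by have := H ord0 I; rewrite Dl0.
  by move=> j _; have := H (lift ord0 (lift ord0 j)) I; rewrite /= Dl2 -[V j](tl2 j).
rewrite E//; congr (_ * _)%E.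
(* Taking the whole line for the first event identifies the product over [j] as the probability of
   the second event. *)
by have := E setT measurableT; rewrite preimage_setT setTI probability_setT mul1e.
Qed.

End brownian_walk.

(** Converts the product of [1 + c * psi] back into an exponential, at the price of a quadratic term
    that is small on a fine grid. It holds because (1 + y)(1 - y + 2 y^2) = 1 + y^2 (1 + 2 y). *)
Lemma expR_sub_sqr_le {R : realType} (y : R) : - 2^-1 <= y -> expR (y - 2 * y ^+ 2) <= 1 + y.
Proof.
move=> y2; have := expR_ge1Dx (- (y - 2 * y ^+ 2)); rewrite expRN.
have y0 : 0 <= (1 + 2 * y) by lra.
have q0 : 0 < 1 + - (y - 2 * y ^+ 2) by nra.
move=> H; have : expR (y - 2 * y ^+ 2) <= (1 + - (y - 2 * y ^+ 2))^-1.
  by rewrite -[leLHS]invrK lef_pV2 ?posrE ?invr_gt0 ?expR_gt0.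
move=> /le_trans; apply; rewrite -div1r ler_pdivrMr//.
have : 0 <= y ^+ 2 * (1 + 2 * y) by rewrite mulr_ge0// sqr_ge0.
lra.
Qed.

Section walk_exponential.
Context {R : realType} {d : measure_display} {T : measurableType d}.
Variable P : probability T R.
Variable W : R -> {RV P >-> R}.
Hypothesis bmW : brownian_motion W.
Variables (a b a' b' lam h tau : R).
Hypothesis ab : a < b.
Hypothesis ab' : a' < b'.
Hypothesis lam0 : 0 <= lam.
Hypothesis tau0 : 0 < tau.
Hypothesis h_dist : forall z z', z \in `[a, b[ -> z' \in `[a', b'[ -> `|z - z'| <= h.
Hypothesis lam_small : 20 * lam * root4 h * root4 (Num.sqrt tau) ^+ 3 <= 1.

Local Notation psi := (cell_diff a b a' b').
Let Psi := (b - a)^-1 + (b' - a')^-1.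

Let Psi0 : 0 <= Psi.
Proof. by rewrite addr_ge0// invr_ge0 subr_ge0 ltW. Qed.

Lemma cell_diff_le z : `|psi z| <= Psi.
Proof.
have H (u v : R) : u < v -> `|(v - u)^-1 * \1_(`[u, v[%classic) z| <= (v - u)^-1.
  move=> uv; have vu : 0 <= (v - u)^-1 by rewrite invr_ge0 subr_ge0 ltW.
  rewrite normrM (ger0_norm vu) ler_piMr// indicE.
  by case: (_ \in _); rewrite ?normr1 ?normr0.
by apply: le_trans (ler_normB _ _) _; apply: lerD; exact: H.
Qed.

Lemma walk_exp_bound (K : nat) (t : R) : (0 < K)%N -> 0 <= t ->
  let e := tau / K.+1%:R in lam * e * Psi <= 2^-1 ->
  (\int[P]_w (expR (lam * (e * \sum_(j < K.+1) psi (W (t + j%:R * e) w))))%:E <=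
   (4 * expR (2 * (lam * tau * Psi) ^+ 2 / K.+1%:R))%:E)%E.
Proof.
move=> K0 t0 e cs.
have e0 : 0 < e by rewrite divr_gt0.
pose S (i : nat) : T -> R := W (t + i%:R * e).
have mS i : measurable_fun setT (S i) by exact: measurable_funPT.
pose c := lam * e.
have c0 : 0 <= c by rewrite mulr_ge0// ltW.
have c_small : c * Psi <= 1 by apply: le_trans cs _; lra.
have bmW' := bmW; case: bmW => W0 _ Wlaw _.
have S_law k i : (k < i)%N -> forall B, measurable B ->
  P ((fun w => S i w - S k w) @^-1` B) =
  normal_prob 0 (Num.sqrt ((i - k)%:R * e)) B.
  move=> ki B mB.
  have tk : 0 <= t + k%:R * e by rewrite addr_ge0// mulr_ge0// ltW.
  have tki : t + k%:R * e < t + i%:R * e by rewrite ltrD2l ltr_pM2r// ltr_nat.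
  rewrite (_ : (i - k)%:R * e = t + i%:R * e - (t + k%:R * e)).
    exact: (Wlaw _ _ tk tki B mB).
  by rewrite natrB ?(ltnW ki)//; ring.
have S_indep k i m : (k < i)%N -> forall (B : set R) (C : 'I_m -> set R), measurable B ->
  (forall j, measurable (C j)) ->
  P ((fun w => S i w - S k w) @^-1` B `&`
     \bigcap_(j in [set: 'I_m]) ((fun w => S (i + j).+1 w - S (i + j)%N w) @^-1` C j)) =
  (P ((fun w => S i w - S k w)%R @^-1` B) *
   P (\bigcap_(j in [set: 'I_m]) ((fun w => S (i + j).+1 w - S (i + j)%N w)%R @^-1` C j)))%E.
  move=> ki B C mB mC.
  apply: (@brownian_indep _ _ _ _ _ bmW' _ _ (t + i%:R * e) e) => //.
  - by rewrite addr_ge0// mulr_ge0// ltW.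
  - by rewrite lerD2l ler_wpM2r ?(ltW e0)// ler_nat ltnW.
  - exact: ltW.
  - by move=> j w; rewrite /S -addnS !natrD !mulrDl !addrA.
have small : 20 * (c / e) * root4 h * root4 (Num.sqrt (K%:R * e)) ^+ 3 <= 1.
  apply: le_trans lam_small; rewrite /c mulfK ?gt_eqF//.
  apply: ler_wpM2l; first by rewrite !mulr_ge0// root4_ge0.
  rewrite lerXn2r ?nnegrE ?root4_ge0//; apply: ler_root4.
  rewrite !ger0_norm ?sqrtr_ge0//; apply: ler_wsqrtr.
  by rewrite /e mulrCA ler_piMr ?(ltW tau0)// ler_pdivrMr ?ltr0n// mul1r ler_nat.
have good := @walk_mean_bounds _ _ _ P S e K e0 mS S_law S_indep a b a' b' c h ab ab' c0 h_dist c_small K0 small 0 (leq0n _).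
have mean2 x : walk_mean P S K a b a' b' c 0 x <= 2.
  by case: good => /(_ x); rewrite ler_norml => /andP[].
pose prd := walk_prod S K a b a' b' c 0.
have c2 z : `|c * psi z| <= 2^-1.
  by rewrite normrM (ger0_norm c0); apply: le_trans cs; apply: ler_wpM2l => //; exact: cell_diff_le.
have prd0 z w : 0 <= prd z w by exact: walk_prod_ge0.
set C := expR (2 * (lam * tau * Psi) ^+ 2 / K.+1%:R).
have pointwise w : expR (lam * (e * \sum_(j < K.+1) psi (S j w))) <= 2 * C * prd (S 0%N w) w.
  apply: (@le_trans _ _ (C * \prod_(j < K.+1) (1 + c * psi (S j w)))).
    apply: (@le_trans _ _ (C * \prod_(j < K.+1) expR (c * psi (S j w) - 2 * (c * psi (S j w)) ^+ 2))).
      rewrite -expR_sum /C -expRD ler_expR.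
      rewrite [X in _ + X](_ : _ = c * (\sum_(j < K.+1) psi (S j w)) -
          2 * \sum_(j < K.+1) (c * psi (S j w)) ^+ 2); last first.
        by rewrite [c * _]mulr_sumr [2 * _]mulr_sumr -sumrB.
      rewrite [leLHS]mulrA -/c.
      rewrite -[X in X + _]mulrA.
      suff : \sum_(j < K.+1) (c * psi (S j w)) ^+ 2 <= (lam * tau * Psi) ^+ 2 / K.+1%:R.
        move: (\sum_(j < K.+1) psi (S j w)) (\sum_(j < K.+1) (c * psi (S j w)) ^+ 2).
        by move: (_ / _) => u v1 v2 ?; lra.
      apply: (@le_trans _ _ (\sum_(j < K.+1) (c * Psi) ^+ 2)).
        apply: ler_sum => j _.
        have cc : `|c * psi (S j w)| <= c * Psi.
          by rewrite normrM (ger0_norm c0); apply: ler_wpM2l => //; exact: cell_diff_le.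
        rewrite -[leLHS]real_normK ?num_real//.
        by apply: lerXn2r cc; rewrite nnegrE// mulr_ge0.
      rewrite sumr_const card_ord -[leLHS]mulr_natl /c /e.
      have n0 : (K.+1%:R : R) != 0 by rewrite pnatr_eq0.
      rewrite le_eqVlt; apply/orP; left; apply/eqP.
      by move: n0; move: (K.+1%:R : R) => N n0; field.
    apply: ler_wpM2l; first exact: expR_ge0.
    apply: ler_prod => j _; rewrite expR_ge0 expR_sub_sqr_le//.
    by have := c2 (S j w); rewrite ler_norml; lra.
  rewrite big_ord_recl.
  have -> : \prod_(j < K) (1 + c * psi (S (lift ord0 j) w)) = prd (S 0%N w) w.
    rewrite /prd /walk_prod big_add1 big_mkord; apply: eq_bigr => j _.
    by rewrite lift0; congr (1 + c * psi _); ring.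
  rewrite [leRHS](_ : _ = C * (2 * prd (S 0%N w) w)); last by ring.
  apply: ler_wpM2l; first exact: expR_ge0.
  apply: ler_wpM2r => //; have := c2 (S 0%N w); rewrite ler_norml; lra.
have C0 : 0 <= 2 * C by rewrite mulr_ge0// expR_ge0.
have mprd : measurable_fun setT (fun w => prd (S 0%N w) w).
  apply: (measurableT_comp (@measurable_walk_prod _ _ _ S K mS a b a' b' c 0)
    (_ : measurable_fun setT (fun w => (S 0%N w, w)))).
  by apply/measurable_fun_pair.
have msum : measurable_fun setT (fun w => \sum_(j < K.+1) psi (S j w)).
  apply: measurable_sum => j.
  exact: (measurableT_comp (measurable_cell_diff _ _ _ _) (mS j)).
have mexp : measurable_fun setT
    (fun w => expR (lam * (e * \sum_(j < K.+1) psi (W (t + j%:R * e) w)))).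
  apply: (measurableT_comp (@measurable_expR R)).
  exact: (measurable_funM (measurable_cst _) (measurable_funM (measurable_cst _) msum)).
apply: (@le_trans _ _ (\int[P]_w ((2 * C)%:E * (prd (S 0%N w) w)%:E))%E).
  apply: ge0_le_integral => //.
  - exact/measurable_EFinP.
  - by apply/measurable_EFinP; apply: measurable_funM.
  - by move=> w _; rewrite -EFinM lee_fin; exact: pointwise.
rewrite ge0_integralZl_EFin//; last 2 first.
- by move=> w _; rewrite lee_fin.
- exact/measurable_EFinP.
suff : (\int[P]_w (prd (S 0%N w) w)%:E <= 2%:E)%E.
  move=> H; apply: (@le_trans _ _ ((2 * C)%:E * 2%:E)%E).
    by apply: lee_wpmul2l.
  by rewrite -EFinM lee_fin; lra.
(* The starting position enters as the increment from time 0, which is independent of the later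
   increments and almost surely equal to [W t]. *)
pose X w := W t w - W 0 w.
have mX : measurable_fun setT X.
  by apply: measurable_funB; exact: measurable_funPT.
pose TV := g_sigma_algebraType (cylinders (@future _ _ T S K 0)).
pose G (z : R * TV) : \bar R := (prd z.1 z.2)%:E.
have mG : measurable_fun setT G.
  by apply/measurable_EFinP; exact: (@measurable_walk_prod_future _ _ _ S K).
have G0 z : (0 <= G z)%E by rewrite lee_fin.
have ind (B : set R) (D : 'I_(K - 0) -> set R) : measurable B -> (forall j, measurable (D j)) ->
  P (X @^-1` B `&` \bigcap_(j in [set: 'I_(K - 0)]) (@future _ _ T S K 0 j @^-1` D j)) =
  (P (X @^-1` B) * P (\bigcap_(j in [set: 'I_(K - 0)]) (@future _ _ T S K 0 j @^-1` D j)))%E.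
  move=> mB mD; apply: (@brownian_indep _ _ _ _ _ bmW' _ _ t e) => //.
  exact: ltW.
have -> : (\int[P]_w (prd (S 0%N w) w)%:E = \int[P]_w G (X w, w))%E.
  apply: ge0_ae_eq_integral => //.
  - exact/measurable_EFinP.
  - have mid : measurable_fun setT (id : T -> TV).
      move=> _ A mA; rewrite setTI; apply: (cylinders_sub _ mA) => j.
      exact: measurable_future.
    apply: (measurableT_comp mG (_ : measurable_fun setT (fun w => (X w, w) : R * TV))).
    by apply/measurable_fun_pair.
  - by move=> w _; rewrite lee_fin.
  - by apply: filterS W0 => w W0w _; rewrite /G /X /S /= W0w mul0r addr0 subr0.
rewrite (ge0_indep_integral mX _ ind mG G0); last by move=> j; exact: measurable_future.
rewrite -[leRHS]mule1 -(probability_setT P) -integral_cst//.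
apply: ge0_le_integral => //.
- by move=> w _; exact: integral_ge0.
- have := measurableT_comp (@measurable_walk_mean _ _ _ P S K mS a b a' b' c ab ab' c0 c_small 0) mX.
  move/measurable_EFinP; apply: eq_measurable_fun => w _ /=.
  by rewrite walk_meanE.
- move=> w _; rewrite -(@walk_meanE _ _ _ P S K mS) // lee_fin; exact: mean2.
Qed.

End walk_exponential.

(** * From grid sums to time integrals *)

Section interval_integrals.
Context {R : realType}.
Local Notation mu := (@lebesgue_measure R).
Implicit Types (a b x M : R) (f : R -> R).

Lemma Rintegral_translation a b x f M : measurable_fun setT f ->
  (forall z, `|f z| <= M) ->
  \int[mu]_(z in `[x + a, x + b[) f z = \int[mu]_(y in `[a, b[) f (x + y).
Proof.
move=> mf fM.
have mx : measurable_fun setT (+%R x : R -> R) by exact: measurable_funD.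
have mfx : measurable_fun setT (fun y => f (x + y)) by exact: (measurableT_comp mf).
have pre : (+%R x) @^-1` `[x + a, x + b[%classic = `[a, b[%classic :> set R.
  by apply/seteqP; split=> y /=; rewrite !in_itv/= lerD2l ltrD2l.
have ci (u v : R) : mu.-integrable `[u, v[ (EFin \o cst M).
  by apply: (@bounded_integrable_itv _ _ _ _ `|M|).
have fi := bounded_integrable_itv (x + a) (x + b) mf fM.
have fxi := bounded_integrable_itv a b mfx (fun z => fM (x + z)).
(* Adding [M] makes the integrand non-negative, as the translation lemma requires; [C] removes it
   again. *)
have H : \int[mu]_(z in `[x + a, x + b[) (f z + M) = \int[mu]_(y in `[a, b[) (f (x + y) + M).
  rewrite /Rintegral -(ge0_integralD_translation x (A := `[x + a, x + b[%classic) (f := fun z => (f z + M)%:E)).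
  - by rewrite pre.
  - by [].
  - by apply/measurable_EFinP; exact: measurable_funD.
  - by move=> y; rewrite lee_fin; have := fM y; rewrite ler_norml; lra.
have C : \int[mu]_(z in `[x + a, x + b[) (cst M) z = \int[mu]_(y in `[a, b[) (cst M) y.
  rewrite !Rintegral_cst//= -[X in _ * fine (X _)]/mu -[in RHS]pre; congr (_ * fine _).
  exact/esym/lebesgue_measureD.
move: H; rewrite (RintegralD _ fi (ci _ _))// (RintegralD _ fxi (ci _ _))//.
by rewrite C => /addIr.
Qed.

Lemma Rintegral_itv_split a b c f M : a <= b -> b <= c -> measurable_fun setT f ->
  (forall z, `|f z| <= M) ->
  \int[mu]_(z in `[a, c[) f z = \int[mu]_(z in `[a, b[) f z + \int[mu]_(z in `[b, c[) f z.
Proof.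
move=> ab bc mf fM.
have E : `[a, c[%classic = `[a, b[%classic `|` `[b, c[%classic.
  by rewrite (@itv_bndbnd_setU _ _ _ (BLeft b))// !bnd_simp.
rewrite E Rintegral_setU//.
- by rewrite -E; exact: bounded_integrable_itv mf fM.
- apply/disj_setPLR => z /=; rewrite !in_itv/= => /andP[_ zb].
  by apply/negP; rewrite negb_and -ltNge zb.
Qed.

(** Cutting the interval into pieces of length [e] and translating each to the origin gives an exact
    average over grids with offset [r], in place of a limit of Riemann sums. *)
Lemma Rintegral_itv_grid s e n f M : 0 <= e -> measurable_fun setT f ->
  (forall z, `|f z| <= M) ->
  \int[mu]_(z in `[s, s + n%:R * e[) f z =
  \int[mu]_(r in `[0, e[) \sum_(j < n) f (s + r + j%:R * e).
Proof.
move=> e0 mf fM.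
have mfj t : measurable_fun setT (fun r => f (s + r + t)).
  by apply: (measurableT_comp mf); apply: measurable_funD => //; exact: measurable_funD.
elim: n => [|n IH].
  rewrite mul0r addr0 set_itvco0 Rintegral_set0.
  rewrite (@eq_Rintegral _ _ _ _ _ (cst 0)) ?Rintegral0//; last first.
    by move=> r _; rewrite big_ord0.
  by rewrite Rintegral_cst// mul0r.
rewrite (@Rintegral_itv_split _ (s + n%:R * e) _ _ M)//; last 2 first.
- by rewrite lerDl mulr_ge0.
- by rewrite lerD2l ler_wpM2r// ler_nat.
rewrite IH.
have -> : s + n.+1%:R * e = s + n%:R * e + e by rewrite -natr1; ring.
rewrite -{1}[s + n%:R * e]addr0 (Rintegral_translation 0 e (s + n%:R * e) mf fM).
rewrite -RintegralD//.
- by apply: eq_Rintegral => r _; rewrite big_ord_recr/= (addrAC s r).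
- apply: (@bounded_integrable_itv _ _ _ _ (n%:R * M)).
    by apply: measurable_sum => j.
  move=> r; apply: le_trans (ler_norm_sum _ _ _) _.
  apply: le_trans (ler_sum _ (fun j _ => fM _)) _.
  by rewrite sumr_const card_ord mulr_natl.
- apply: (@bounded_integrable_itv _ _ _ _ M) => //.
  by apply: (measurableT_comp mf); exact: measurable_funD.
Qed.

(** Jensen's inequality, by integrating the tangent line of [expR] at the mean [m]. *)
Lemma average_expR a b f M : a < b -> measurable_fun setT f -> (forall z, `|f z| <= M) ->
  expR (average a b f) <= average a b (expR \o f).
Proof.
move=> ab mf fM; set m := average a b f.
have mE : measurable_fun setT (expR \o f) by exact: measurableT_comp.
have EM z : `|(expR \o f) z| <= expR M.
  by rewrite ger0_norm ?expR_ge0//= ler_expR; apply: le_trans (ler_norm _) (fM _).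
have ba : 0 < b - a by rewrite subr_gt0.
have ci (r : R) : mu.-integrable `[a, b[ (EFin \o cst r).
  by apply: (@bounded_integrable_itv _ _ _ _ `|r|).
have fi := bounded_integrable_itv a b mf fM.
have E (r : R) : \int[mu]_(z in `[a, b[) (cst r) z = r * (b - a).
  rewrite Rintegral_cst//; congr (_ * _).
  by rewrite /= lebesgue_measure_itv/= lte_fin ab -EFinB.
have I1 : mu.-integrable `[a, b[ (EFin \o (fun z => expR m * f z)).
  apply: (@bounded_integrable_itv _ _ _ _ (expR m * M)).
    exact: measurable_funM.
  by move=> z; rewrite normrM ger0_norm ?expR_ge0// ler_wpM2l ?expR_ge0.
have H : \int[mu]_(z in `[a, b[) (cst (expR m * (1 - m)) z + expR m * f z) <=
         \int[mu]_(z in `[a, b[) (expR \o f) z.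
  apply: le_Rintegral => //.
  - exact: (integrableD _ (ci _) I1).
  - exact: bounded_integrable_itv mE EM.
  - move=> z _ /=; have := expR_ge1Dx (f z - m); rewrite expRB ler_pdivlMr ?expR_gt0//.
    lra.
move: H; rewrite RintegralD// E RintegralZl// => H.
have mE' : \int[mu]_(z in `[a, b[) f z = m * (b - a).
  by rewrite /m /average mulrC mulrA divff ?mul1r// gt_eqF.
rewrite /average mulrC ler_pdivlMr//; apply: le_trans H.
by rewrite mE' le_eqVlt; apply/orP; left; apply/eqP; ring.
Qed.

End interval_integrals.

Section occupation_time.
Context {R : realType}.
Local Notation mu := (@lebesgue_measure R).
Implicit Types (x : R -> R) (s t a b : R).

Definition occ x s t a b : R :=
  \int[mu]_(u in `[s, t[) \1_(`[a, b[%classic) (x u).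

Lemma occ_indic_integrable x s t a b : measurable_fun setT x ->
  mu.-integrable `[s, t[ (EFin \o (fun u => \1_(`[a, b[%classic) (x u))).
Proof.
move=> mx; apply: (@bounded_integrable_itv _ _ _ _ 1).
  by apply: (measurableT_comp _ mx); exact: measurable_indic.
by move=> z; rewrite indicE; case: (_ \in _); rewrite ?normr1 ?normr0.
Qed.

Lemma integral_cell_diff x s t a b a' b' : measurable_fun setT x ->
  \int[mu]_(u in `[s, t[) cell_diff a b a' b' (x u) =
  (b - a)^-1 * occ x s t a b - (b' - a')^-1 * occ x s t a' b'.
Proof.
move=> mx; rewrite /occ -!RintegralZl//; try exact: occ_indic_integrable.
rewrite -RintegralB//.
- exact: (integrableZl _ _ (occ_indic_integrable s t a b mx)).
- exact: (integrableZl _ _ (occ_indic_integrable s t a' b' mx)).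
Qed.

End occupation_time.

Section path_exponential.
Context {R : realType} {d : measure_display} {T : measurableType d}.
Local Notation mu := (@lebesgue_measure R).
Variable P : probability T R.
Variable W : R -> {RV P >-> R}.
Hypothesis bmW : brownian_motion W.
Variable Y : R -> T -> R.
Hypothesis mY : measurable_fun setT (fun z : R * T => Y z.1 z.2).
Hypothesis YW : forall t, 0 <= t -> {ae P, forall w, Y t w = W t w}.

Lemma measurable_path w : measurable_fun setT (Y ^~ w).
Proof. exact: (measurableT_comp mY (pair2_measurable w)). Qed.

Lemma measurable_occ s t a b : measurable_fun setT (fun w => occ (Y ^~ w) s t a b).
Proof.
pose H (z : R * T) : \bar R :=
  (\1_(`[s, t[%classic) z.1 * \1_(`[a, b[%classic) (Y z.1 z.2))%:E.
have mH : measurable_fun setT (H : measurableTypeR R * T -> \bar R).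
  have mH' : measurable_fun setT H.
    apply/measurable_EFinP; apply: measurable_funM.
      by apply: (measurableT_comp _ measurable_fst); exact: measurable_indic.
    by apply: (measurableT_comp _ mY); exact: measurable_indic.
  exact: mH'.
have H0 z : (0 <= H z)%E by rewrite lee_fin mulr_ge0.
have mG := @measurable_fun_fubini_tonelli_G _ _ (measurableTypeR R) T R mu H mH H0.
apply/measurable_EFinP; apply: (eq_measurable_fun _ _ mG) => w _.
rewrite /fubini_G /= /occ /Rintegral fineK; last first.
  by apply: integrable_fin_num => //; exact: occ_indic_integrable (measurable_path w).
rewrite [RHS]integral_mkcond; apply: eq_integral => r _.
by rewrite /H patchE indicE /=; case: ifPn => _; rewrite ?mul1r ?mul0r.
Qed.

(** By Jensen's inequality the exponential is at most the average over the offset of exponentials of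
    grid sums, and [walk_exp_bound] is uniform in the offset. One sufficiently fine grid is
    enough. *)
Lemma path_exp_bound (a b a' b' lam h s tau : R) : a < b -> a' < b' -> 0 <= lam ->
  0 <= s -> 0 < tau ->
  (forall z z', z \in `[a, b[ -> z' \in `[a', b'[ -> `|z - z'| <= h) ->
  20 * lam * root4 h * root4 (Num.sqrt tau) ^+ 3 <= 1 ->
  (\int[P]_w (expR (lam * \int[mu]_(t in `[s, (s + tau)%R[) cell_diff a b a' b' (Y t w)))%:E <=
   (4 * expR 1)%:E)%E.
Proof.
move=> ab ab' lam0 s0 tau0 hd lsmall.
set psi := cell_diff a b a' b'.
pose Psi := (b - a)^-1 + (b' - a')^-1.
have Psi0 : 0 <= Psi by rewrite addr_ge0// invr_ge0 subr_ge0 ltW.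
have psiM z : `|psi z| <= Psi by exact: cell_diff_le.
pose A := lam * tau * Psi.
have A0 : 0 <= A by rewrite !mulr_ge0// ltW.
(* The term 2 A ensures [lam * e * Psi <= 2^-1]; the term 2 A^2 keeps the quadratic error in the
   exponent below 1. *)
pose K := (Num.truncn (2 * A + 2 * A ^+ 2)).+1.
have KA : 2 * A + 2 * A ^+ 2 <= K.+1%:R.
  apply: le_trans (_ : K%:R <= _); last by rewrite ler_nat.
  by apply/ltW; rewrite /K truncnS_gt.
have K1 : (0 : R) < K.+1%:R by rewrite ltr0n.
pose e := tau / K.+1%:R.
have e0 : 0 < e by rewrite divr_gt0.
have Ke : tau = K.+1%:R * e by rewrite /e mulrCA divff ?mulr1// gt_eqF.
have A20 : 0 <= A ^+ 2 by exact: sqr_ge0.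
have cs : lam * e * Psi <= 2^-1.
  have -> : lam * e * Psi = A / K.+1%:R by rewrite /A /e; ring.
  by rewrite ler_pdivrMr//; lra.
have ex : expR (2 * A ^+ 2 / K.+1%:R) <= expR 1.
  by rewrite ler_expR ler_pdivrMr//; lra.
have eE : e = tau / K.+1%:R by [].
have K0 : (0 < K)%N by [].
clearbody e K.
pose F (r : R) (w : T) : R := lam * (e * \sum_(j < K.+1) psi (Y (s + r + j%:R * e) w)).
have mF : measurable_fun setT (fun z : R * T => F z.1 z.2).
  do 2 (apply: measurable_funM; first exact: measurable_cst).
  apply: measurable_sum => j; apply: (measurableT_comp (measurable_cell_diff _ _ _ _)).
  have m1 : measurable_fun setT (fun z : R * T => s + z.1 + j%:R * e).
    apply: measurable_funD => //; apply: measurable_funD => //; exact: measurable_fst.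
  exact: (measurableT_comp mY (measurable_fun_pair m1 (@measurable_snd _ _ R T))).
have mFw w : measurable_fun setT (F ^~ w).
  exact: (measurableT_comp mF (pair2_measurable w)).
have FM r w : `|F r w| <= A.
  rewrite /F !normrM (ger0_norm lam0) (ger0_norm (ltW e0)) /A Ke -!mulrA ler_wpM2l//.
  rewrite mulrCA ler_wpM2l// ?(ltW e0)//; apply: le_trans (ler_norm_sum _ _ _) _.
  apply: le_trans (ler_sum _ (fun j _ => psiM _)) _.
  by rewrite sumr_const card_ord mulr_natl.
have avg w : lam * \int[mu]_(t in `[s, (s + tau)%R[) psi (Y t w) = average 0 e (F ^~ w).
  have mpsi : measurable_fun setT (fun t => psi (Y t w)).
    exact: (measurableT_comp (measurable_cell_diff _ _ _ _) (measurable_path w)).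
  rewrite Ke (Rintegral_itv_grid s K.+1 (ltW e0) mpsi (fun t => psiM _)).
  rewrite /average subr0 /F.
  have I1 : mu.-integrable `[0, e[ (EFin \o (fun r => \sum_(j < K.+1) psi (Y (s + r + j%:R * e) w))).
    apply: (@bounded_integrable_itv _ _ _ _ (K.+1%:R * Psi)).
      apply: measurable_sum => j; apply: (measurableT_comp mpsi).
      by apply: measurable_funD => //; exact: measurable_funD.
    move=> r; apply: le_trans (ler_norm_sum _ _ _) _.
    apply: le_trans (ler_sum _ (fun j _ => psiM _)) _.
    by rewrite sumr_const card_ord mulr_natl.
  under [in RHS]eq_Rintegral do rewrite mulrA.
  rewrite RintegralZl// mulrA [_^-1 * _]mulrC -!mulrA; congr (lam * _).
  by rewrite mulrA divff ?mul1r// gt_eqF.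
pose G (z : R * T) : \bar R := (\1_(`[0, e[%classic) z.1 * expR (F z.1 z.2))%:E.
have mG : measurable_fun setT G.
  apply/measurable_EFinP; apply: measurable_funM.
    by apply: (measurableT_comp _ (measurable_fst)); exact: measurable_indic.
  exact: measurableT_comp.
have G0 z : (0 <= G z)%E by rewrite lee_fin mulr_ge0// expR_ge0.
have GE w : (\int[mu]_r G (r, w) = \int[mu]_(r in `[0%R, e[) (expR (F r w))%:E)%E.
  rewrite [RHS]integral_mkcond; apply: eq_integral => r _.
  by rewrite /G patchE indicE /=; case: ifPn => _; rewrite ?mul1r ?mul0r.
have mGw w : measurable_fun setT (fun r => G (r, w)).
  exact: (measurableT_comp mG (pair2_measurable w)).
have mGr r : measurable_fun setT (fun w => G (r, w)).
  exact: (measurableT_comp mG (pair1_measurable r)).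
have mG' : measurable_fun setT (G : measurableTypeR R * T -> \bar R) by exact: mG.
have mI : measurable_fun setT (fun w => \int[mu]_r G (r, w))%E.
  have := @measurable_fun_fubini_tonelli_G _ _ (measurableTypeR R) T R mu G mG' G0.
  by [].
have point w : ((expR (lam * \int[mu]_(t in `[s, (s + tau)%R[) psi (Y t w)))%:E <=
    (e^-1)%:E * \int[mu]_r G (r, w))%E.
  have mE : measurable_fun setT (expR \o (F ^~ w)) by exact: measurableT_comp.
  have EM z : `|(expR \o (F ^~ w)) z| <= expR A.
    by rewrite ger0_norm ?expR_ge0//= ler_expR; apply: le_trans (ler_norm _) (FM _ _).
  have := average_expR e0 (mFw w) (fun z => FM z w); rewrite -avg -lee_fin => /le_trans; apply.
  rewrite /average subr0 EFinM GE /Rintegral fineK//.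
  by apply: integrable_fin_num => //; exact: bounded_integrable_itv mE EM.
have mexp : measurable_fun setT (fun w => expR (lam * \int[mu]_(t in `[s, (s + tau)%R[) psi (Y t w))).
  apply: (measurableT_comp (@measurable_expR R)).
  apply: (measurable_funM (measurable_cst _)).
  rewrite (_ : (fun w => _) = (fun w => (b - a)^-1 * occ (Y ^~ w) s (s + tau) a b -
     (b' - a')^-1 * occ (Y ^~ w) s (s + tau) a' b')); last first.
    by apply/funext => w; rewrite /psi integral_cell_diff//; exact: measurable_path.
  apply: (measurable_funB (measurable_funM (measurable_cst _) (measurable_occ _ _ _ _))).
  exact: (measurable_funM (measurable_cst _) (measurable_occ _ _ _ _)).
apply: (@le_trans _ _ (\int[P]_w ((e^-1)%:E * \int[mu]_r G (r, w)))%E).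
  apply: ge0_le_integral => //.
  - exact/measurable_EFinP.
  - by apply: emeasurable_funM.
rewrite ge0_integralZl_EFin//; last 2 first.
- by move=> w _; exact: integral_ge0.
- by rewrite invr_ge0 ltW.
rewrite -(@fubini_tonelli _ _ (measurableTypeR R) T R mu P G mG' G0).
have inner r : (\int[P]_w G (r, w) <= (4 * expR 1 * \1_(`[0%R, e[%classic) r)%:E)%E.
  rewrite indicE; have [/set_mem re|re] := boolP (r \in _); last first.
    rewrite mulr0 (eq_integral (cst 0%E)) ?integral0// => w _.
    by rewrite /G indicE /= (negbTE re) mul0r.
  have /andP[r0 _] : 0 <= r < e by move: re; rewrite /= in_itv.
  rewrite mulr1.
  pose FW w := expR (lam * (e * \sum_(j < K.+1) psi (W (s + r + j%:R * e) w))).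
  have mFW : measurable_fun setT (EFin \o FW).
    apply/measurable_EFinP; apply: (measurableT_comp (@measurable_expR R)).
    do 2 (apply: measurable_funM; first exact: measurable_cst).
    apply: measurable_sum => j; apply: (measurableT_comp (measurable_cell_diff _ _ _ _)).
    exact: measurable_funPT.
  have ae : ae_eq P setT (fun w => G (r, w)) (EFin \o FW).
    have : {ae P, forall w, forall j : 'I_K.+1, Y (s + r + j%:R * e) w = W (s + r + j%:R * e) w}.
      apply: filter_forall => j; apply: YW.
      by rewrite !addr_ge0// mulr_ge0// ltW.
    apply: filterS => w H _; rewrite /G /FW /= indicE mem_set// mul1r /F.
    by congr (expR (lam * (e * _)))%:E; apply: eq_bigr => j _; rewrite H.
  rewrite (ge0_ae_eq_integral _ _ _ _ _ ae)//; last first.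
    by move=> w _; rewrite lee_fin expR_ge0.
  have sr0 : 0 <= s + r by rewrite addr_ge0.
  have := walk_exp_bound bmW ab ab' lam0 tau0 hd lsmall K0 sr0.
  rewrite -eE => /(_ cs) /le_trans; apply.
  by rewrite lee_fin ler_wpM2l.
have m4 : measurable_fun setT (EFin \o (fun r : R => 4 * expR 1 * \1_(`[0, e[%classic) r : R)).
  by apply/measurable_EFinP; apply: measurable_funM => //; exact: measurable_indic.
apply: (@le_trans _ _ ((e^-1)%:E * \int[mu]_r (4 * expR 1 * \1_(`[0%R, e[%classic) r)%:E)%E).
  apply: lee_wpmul2l; first by rewrite lee_fin invr_ge0 ltW.
  apply: ge0_le_integral => //.
  - by move=> r _; exact: integral_ge0.
  - exact: (@measurable_fun_fubini_tonelli_F _ _ (measurableTypeR R) T R P G mG' G0).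
under eq_integral do rewrite EFinM.
have m1 : measurable_fun setT (EFin \o (fun r : R => \1_(`[0, e[%classic) r : R)).
  by apply/measurable_EFinP; exact: measurable_indic.
rewrite ge0_integralZl_EFin//.
rewrite integral_indic//= setIT lebesgue_measure_itv/= lte_fin e0 oppr0 adde0.
by rewrite -!EFinM lee_fin mulrCA mulVf ?mulr1// gt_eqF.
Qed.
End path_exponential.

(** * Occupation along a curve at dyadic scales *)

Section occ_theory.
Context {R : realType}.
Local Notation mu := (@lebesgue_measure R).
Variable x : R -> R.
Hypothesis mx : measurable_fun setT x.
Implicit Types (s t a b c : R).

Lemma occ_ge0 s t a b : 0 <= occ x s t a b.
Proof. by apply: Rintegral_ge0 => u _. Qed.

Let mind a b : measurable_fun setT (fun u => \1_(`[a, b[%classic) (x u) : R).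
Proof. by apply: (measurableT_comp _ mx); exact: measurable_indic. Qed.

Let ind1 a b u : `|\1_(`[a, b[%classic) (x u) : R| <= 1.
Proof. by rewrite indicE; case: (_ \in _); rewrite ?normr1 ?normr0. Qed.

Lemma occ_time_split s t u a b : s <= t -> t <= u ->
  occ x s u a b = occ x s t a b + occ x t u a b.
Proof. by move=> st tu; exact: Rintegral_itv_split st tu (mind a b) (ind1 a b). Qed.

Lemma occ_cell_split s t a b c : a <= b -> b <= c ->
  occ x s t a c = occ x s t a b + occ x s t b c.
Proof.
move=> ab bc; rewrite /occ -RintegralD//; try exact: occ_indic_integrable.
apply: eq_Rintegral => u _ /=; rewrite !indicE !mem_setE !in_itv/=.
by have [] := leP a (x u); have [] := ltP (x u) b; have [] := leP b (x u);
  have [] := ltP (x u) c => /=; lra.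
Qed.

Lemma occ_full s t a b : s <= t -> (forall u, u \in `[s, t[ -> x u \in `[a, b[) ->
  occ x s t a b = t - s.
Proof.
move=> st H; rewrite /occ (@eq_Rintegral _ _ _ _ _ (cst 1)).
  rewrite Rintegral_cst//= mul1r lebesgue_measure_itv/= lte_fin.
  by move: st; rewrite le_eqVlt => /predU1P[->|->]; rewrite ?ltxx ?subrr.
by move=> u /set_mem/= ust; rewrite indicE mem_set//=; exact: H.
Qed.

Lemma occ_eq0 s t a b : (forall u, u \in `[s, t[ -> x u \notin `[a, b[) ->
  occ x s t a b = 0.
Proof.
move=> H; rewrite /occ (@eq_Rintegral _ _ _ _ _ (cst 0)).
  by rewrite Rintegral_cst// mul0r.
move=> u /set_mem/= ust; rewrite indicE memNset//=.
by move=> /= xu; have := H _ ust; rewrite xu.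
Qed.

Definition cell n (k : int) : R := k%:~R / 2 ^+ n.
Definition tick n (j : nat) : R := j%:R / 2 ^+ n.

Lemma pow2_gt0 n : (0 : R) < 2 ^+ n. Proof. exact: exprn_gt0. Qed.
Local Hint Resolve pow2_gt0 : core.

Lemma tick_le n i j : (i <= j)%N -> tick n i <= tick n j.
Proof. by move=> ij; rewrite /tick ler_pM2r ?invr_gt0// ler_nat. Qed.

Lemma cell_le n (k l : int) : k <= l -> cell n k <= cell n l.
Proof. by move=> kl; rewrite /cell ler_pM2r ?invr_gt0// ler_int. Qed.

Lemma occ_cells n s t (k : int) L :
  \sum_(l < L) occ x s t (cell n (k + l%:Z)) (cell n (k + l%:Z + 1)) =
  occ x s t (cell n k) (cell n (k + L%:Z)).
Proof.
elim: L => [|L IH].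
  rewrite big_ord0 addr0 occ_eq0// => u _; rewrite in_itv/=.
  by apply/negP => /andP[/le_lt_trans H /H]; rewrite ltxx.
rewrite big_ord_recr/= IH -occ_cell_split.
- by rewrite -addrA (_ : L%:Z + 1 = L.+1%:Z)//; lia.
- by apply: cell_le; lia.
- by apply: cell_le; lia.
Qed.

Definition fcell n (y : R) : int := Num.floor (2 ^+ n * y).

Lemma fcellP n y : cell n (fcell n y) <= y < cell n (fcell n y + 1).
Proof.
have /andP[] := floor_itv (2 ^+ n * y); rewrite -/(fcell n y) /cell => H1 H2.
by rewrite ler_pdivrMr// ltr_pdivlMr// !(mulrC y) H1 H2.
Qed.

Lemma fcell_shift n y (l : int) : fcell n (y + cell n l) = fcell n y + l.
Proof.
rewrite /fcell mulrDr /cell mulrCA divff ?gt_eqF// mulr1 floorDrz ?intr_int//.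
by rewrite intrKfloor.
Qed.

Lemma cellS n k : cell n (k + 1) = cell n k + (2 ^+ n)^-1.
Proof. by rewrite /cell intrD mulrDl mul1r. Qed.

Lemma cellD n k l : cell n (k + l) = cell n k + cell n l.
Proof. by rewrite /cell intrD mulrDl. Qed.

Lemma cellN n k : cell n (- k) = - cell n k.
Proof. by rewrite /cell mulrNz mulNr. Qed.

(* 2^n is the inverse of the length of a cell; the curve is frozen on each
   dyadic time interval. *)
Definition level_occ n (f : R -> R) : R :=
  \sum_(j < 2 ^ n) 2 ^+ n * occ x (tick n j) (tick n j.+1)
    (cell n (fcell n (f (tick n j)))) (cell n (fcell n (f (tick n j)) + 1)).

Lemma level_occ_ge0 n f : 0 <= level_occ n f.
Proof. by apply: sumr_ge0 => j _; rewrite mulr_ge0 ?occ_ge0// ltW. Qed.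

Definition band n m (f : R -> R) : R :=
  \sum_(j < 2 ^ n) occ x (tick n j) (tick n j.+1)
    (cell n (fcell n (f (tick n j)) - m%:Z)) (cell n (fcell n (f (tick n j)) + m%:Z + 1)).

(** Shifting a curve by whole cells shifts its frozen cells, so a band is tiled by the cells of 2 m
    + 1 shifted curves. A bound on [level_occ] that is uniform over curves thus bounds the time
    spent near a single curve. *)
Lemma band_level_occ n m f :
  band n m f = (2 ^+ n)^-1 *
    \sum_(l < m.*2.+1) level_occ n (fun t => f t + cell n (l%:Z - m%:Z)).
Proof.
rewrite /level_occ exchange_big/= mulr_sumr; apply: eq_bigr => j _.
rewrite -mulr_sumr mulrA mulVf ?gt_eqF// mul1r.
set k := fcell n (f (tick n j)).
rewrite (_ : k + m%:Z + 1 = k - m%:Z + m.*2.+1%:Z); last by lia.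
rewrite -occ_cells; apply: eq_bigr => l _.
have -> : k - m%:Z + l%:Z = k + (l%:Z - m%:Z) by lia.
by rewrite fcell_shift.
Qed.

Lemma tick_half n i : tick n.+1 (2 * i) = tick n i.
Proof. by rewrite /tick exprS natrM -mulf_div divff// mul1r. Qed.

Lemma sum_half (F : nat -> R) n :
  \sum_(i < 2 * n) F i = \sum_(j < n) (F (2 * j)%N + F (2 * j).+1).
Proof.
elim: n => [|n IH]; first by rewrite muln0 !big_ord0.
by rewrite mulnS !big_ord_recr/= IH addrA.
Qed.

(** Both levels are to be compared on the same time intervals, those of level n + 1; [i./2] is the
    coarse interval that contains the fine interval [i]. *)
Lemma level_occ_half n f : level_occ n f =
  \sum_(i < 2 ^ n.+1) 2 ^+ n * occ x (tick n.+1 i) (tick n.+1 i.+1)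
    (cell n (fcell n (f (tick n i./2)))) (cell n (fcell n (f (tick n i./2)) + 1)).
Proof.
rewrite expnS (sum_half (fun i => 2 ^+ n * occ x (tick n.+1 i) (tick n.+1 i.+1)
    (cell n (fcell n (f (tick n i./2)))) (cell n (fcell n (f (tick n i./2)) + 1)))).
apply: eq_bigr => j _.
have -> : (2 * j)./2 = j by rewrite mul2n doubleK.
have -> : (2 * j).+1./2 = j by rewrite mul2n /= uphalf_double.
rewrite -mulrDr; congr (_ * _).
rewrite -{1}(tick_half n j) -{1}(tick_half n j.+1) mulnS.
by rewrite -occ_time_split//; apply: tick_le.
Qed.

End occ_theory.

Lemma half_ltn_pow n i : (i < 2 ^ n.+1)%N -> (i./2 < 2 ^ n)%N.
Proof. by rewrite expnS; lia. Qed.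

Lemma double_half_leq i : (2 * i./2 <= i)%N.
Proof. lia. Qed.

Lemma leq_double_halfS i : (i.+1 <= 2 * (i./2).+1)%N.
Proof. lia. Qed.

(** * Comparison of two successive dyadic levels *)

Section curve_recursion.
Context {R : realType}.
Variable x : R -> R.
Hypothesis mx : measurable_fun setT x.
Variables (a r p C1 C2 : R).
Hypothesis a_ge : 2^-1 <= a.
Hypothesis ar : a <= r.
Hypothesis r_lt1 : r < 1.
Hypothesis r_ge : 1 <= 2 * r.
Hypothesis p0 : 0 <= p.
Hypothesis C1_ge0 : 0 <= C1.
Hypothesis C2_ge0 : 0 <= C2.
Hypothesis x_osc : forall n j s, (j < 2 ^ n)%N -> s \in `[tick n j, tick n j.+1[ ->
  `|x s - x (tick n j)| <= C1 * r ^+ n.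
Hypothesis x_reg : forall n i (k k' : int), (i < 2 ^ n.+1)%N ->
  `|k| <= 8 ^+ n.+1 -> `|k'| <= 8 ^+ n.+1 -> `|cell n.+1 k' - cell n k| <= 4 * a ^+ n ->
  `|2 ^+ n.+1 * occ x (tick n.+1 i) (tick n.+1 i.+1) (cell n.+1 k') (cell n.+1 (k' + 1)) -
    2 ^+ n * occ x (tick n.+1 i) (tick n.+1 i.+1) (cell n k) (cell n (k + 1))| <=
  C2 * p ^+ n.

(** Hoelder continuity read off at dyadic scales, with [a] in the role of 2^-alpha. The bound |f| <=
    1 is dropped so that the class is closed under the shifts of [band_level_occ]. The ratios [r]
    and [p] govern the oscillation of the path and its occupation differences. *)
Definition curve (f : R -> R) : Prop := forall n (s t : R), s \in `[0, 1] -> t \in `[0, 1] ->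
  `|s - t| <= (2 ^+ n)^-1 -> `|f s - f t| <= a ^+ n.

Lemma curve_shift f c : curve f -> curve (fun t => f t + c).
Proof. by move=> hf n s t s01 t01 st; rewrite opprD addrACA subrr addr0; exact: hf. Qed.

Let a0 : 0 < a. Proof. by apply: lt_le_trans a_ge; rewrite invr_gt0. Qed.
Let r0 : 0 < r. Proof. exact: lt_le_trans ar. Qed.
Let a1 : a < 1. Proof. exact: le_lt_trans ar r_lt1. Qed.

Let half_le n : (2 ^+ n)^-1 <= a ^+ n.
Proof. by rewrite -exprVn lerXn2r// nnegrE ?invr_ge0// ltW. Qed.

Let a_le_r n : a ^+ n <= r ^+ n.
Proof. by rewrite lerXn2r// nnegrE ltW. Qed.

Let tick01 n j : (j <= 2 ^ n)%N -> (tick n j : R) \in `[0, 1].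
Proof.
move=> jn; rewrite in_itv/= /tick divr_ge0//= ler_pdivrMr ?exprn_gt0// mul1r.
by rewrite -natrX ler_nat.
Qed.

Let tickS n j : tick n j.+1 = tick n j + (2 ^+ n)^-1 :> R.
Proof. by rewrite /tick -natr1 mulrDl mul1r. Qed.

Let bd := `|x 0| + C1.

Let x_bd (s : R) : s \in `[0, 1[ -> `|x s| <= bd.
Proof.
move=> s01; have := x_osc (n := 0) (j := 0) (s := s) isT.
rewrite /tick expr0 !divr1 mulr1 => /(_ s01) H.
by rewrite -(subrK (x 0) (x s)); apply: le_trans (ler_normD _ _) _; rewrite /bd; lra.
Qed.

(** Of order (2 r)^n, which is about 2^(n/2) for r near 2^(-1/2): since [a <= r], the oscillation of
    the path dominates that of the curve. *)
Let band_width n : nat := (Num.truncn ((5 + 2 * C1) * (2 * r) ^+ n)).+2.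

Let band_widthP n : 2 ^+ n * (5 * a ^+ n + 2 * C1 * r ^+ n) + 1 <= (band_width n)%:R.
Proof.
apply: (@le_trans _ _ ((5 + 2 * C1) * (2 * r) ^+ n + 1)); last first.
  by rewrite /band_width -[in leRHS]natr1; apply: lerD => //; apply/ltW/truncnS_gt.
rewrite lerD2r exprMn mulrCA; apply: ler_wpM2l; first exact: exprn_ge0.
by have := a_le_r n; lra.
Qed.

Let band_width_le n : (2 * band_width n).+1%:R <= (15 + 4 * C1) * (2 * r) ^+ n.
Proof.
have rn : 1 <= (2 * r) ^+ n by exact: exprn_ege1.
have : (Num.truncn ((5 + 2 * C1) * (2 * r) ^+ n))%:R <= (5 + 2 * C1) * (2 * r) ^+ n.
  rewrite truncn_le; apply: mulr_ge0; last exact: le_trans rn.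
  by have := C1_ge0; lra.
have -> : (2 * band_width n).+1%:R = 2 * (band_width n)%:R + 1 :> R.
  by rewrite [LHS]mulrSr natrM.
have -> : (band_width n)%:R = (Num.truncn ((5 + 2 * C1) * (2 * r) ^+ n))%:R + 2 :> R.
  by rewrite /band_width -[in LHS]addn2 natrD.
lra.
Qed.

Let hit n (f : R -> R) (i : nat) : Prop :=
  exists2 s, s \in `[tick n.+1 i, tick n.+1 i.+1[ & `|x s - f (tick n i./2)| <= 5 * a ^+ n.

Let half_tick n i (s : R) : (i < 2 ^ n.+1)%N -> s \in `[tick n.+1 i, tick n.+1 i.+1[ ->
  [/\ (i./2 < 2 ^ n)%N & s \in `[tick n i./2, tick n (i./2).+1[ ].
Proof.
move=> iN; rewrite !in_itv/= => /andP[s1 s2]; split.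
  exact: half_ltn_pow.
rewrite -(tick_half n i./2) -(tick_half n (i./2).+1); apply/andP; split.
  by apply: le_trans s1; apply/tick_le/double_half_leq.
by apply: lt_le_trans s2 _; apply/tick_le/leq_double_halfS.
Qed.

Section step.
Variables (n : nat) (f g : R -> R) (M : R).
Hypothesis hf : curve f.
Hypothesis fg : forall t : R, t \in `[0, 1] -> `|f t - g t| <= a ^+ n.
Hypothesis hM : forall h, curve h -> level_occ x n h <= M.
Hypothesis n_large : bd + 12 <= 4 ^+ n.+1.

Let k i := fcell n (f (tick n i./2)).
Let k' i := fcell n.+1 (g (tick n.+1 i)).
Let D i := 2 ^+ n.+1 * occ x (tick n.+1 i) (tick n.+1 i.+1) (cell n.+1 (k' i)) (cell n.+1 (k' i + 1)) -
    2 ^+ n * occ x (tick n.+1 i) (tick n.+1 i.+1) (cell n (k i)) (cell n (k i + 1)).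

Let fcell_dist m (y : R) : `|cell m (fcell m y) - y| <= (2 ^+ m)^-1.
Proof. by have := fcellP m y; rewrite cellS ler_norml; lra. Qed.

Let pV m : (0 : R) < (2 ^+ m)^-1.
Proof. by rewrite invr_gt0 exprn_gt0. Qed.

Let halfS : (2 ^+ n.+1 : R)^-1 <= a ^+ n.
Proof.
apply: le_trans (half_le n); rewrite lef_pV2 ?posrE ?exprn_gt0// exprS.
by rewrite ler_peMl ?exprn_ge0// ler1n.
Qed.

Let gf i : (i < 2 ^ n.+1)%N -> `|g (tick n.+1 i) - f (tick n i./2)| <= 2 * a ^+ n.
Proof.
move=> iN.
have t1 : (tick n.+1 i : R) \in `[0, 1] by apply: tick01; exact: ltnW.
have t2 : (tick n i./2 : R) \in `[0, 1] by apply/tick01/ltnW/half_ltn_pow.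
have d : `|tick n.+1 i - tick n i./2 : R| <= (2 ^+ n)^-1.
  have [|_] := @half_tick n i (tick n.+1 i) iN.
    by rewrite in_itv/= lexx tickS ltrDl invr_gt0 exprn_gt0.
  by rewrite in_itv/= tickS ler_norml; lra.
have := hf t1 t2 d; have := fg t1; rewrite !ler_norml; lra.
Qed.

Let kk' i : (i < 2 ^ n.+1)%N -> `|cell n.+1 (k' i) - cell n (k i)| <= 4 * a ^+ n.
Proof.
move=> iN; have := gf iN; have := fcell_dist n (f (tick n i./2)).
have := fcell_dist n.+1 (g (tick n.+1 i)); have := half_le n; have := halfS.
by rewrite -/(k i) -/(k' i) !ler_norml; lra.
Qed.

Let D_nohit i : (i < 2 ^ n.+1)%N -> ~ hit n f i -> D i = 0.
Proof.
move=> iN nh; rewrite /D !occ_eq0 ?mulr0 ?subrr// => u ui; apply/negP => xu; apply: nh;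
  exists u => //.
- have := fcell_dist n (f (tick n i./2)); have := half_le n; have := pV n.
  by move: xu; rewrite in_itv/= cellS -/(k i) !ler_norml; lra.
- have := gf iN; have := fcell_dist n.+1 (g (tick n.+1 i)); have := half_le n; have := halfS.
  move: xu; rewrite in_itv/= cellS -/(k i) -/(k' i) !ler_norml; have := pV n; have := pV n.+1.
  by lra.
Qed.

(** The regularity hypothesis covers finitely many cells per level. A hit places the cells near the
    path, which is bounded, and [n_large] brings their indices into the range: 8 is 2 for the number
    of cells per unit length times 4 for the growing space window. *)
Let int_bound m (l : int) (y : R) : `|cell m l - y| <= 10 -> `|y| <= bd -> bd + 12 <= 4 ^+ n.+1 ->
  (m <= n.+1)%N -> `|l| <= 8 ^+ n.+1.
Proof.
move=> ly yb bn mn.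
have H : `|l%:~R : R| <= 8 ^+ n.+1.
  rewrite (_ : l%:~R = 2 ^+ m * cell m l); last by rewrite /cell mulrC divfK// gt_eqF// exprn_gt0.
  rewrite normrM (_ : 8 = 2 * 4); last by ring.
  rewrite exprMn; apply: ler_pM => //.
    by rewrite ger0_norm ?exprn_ge0// ler_eXn2l// ltr1n.
  apply: le_trans bn; move: ly yb; rewrite !ler_norml; lra.
by rewrite -(ler_int R) intr_norm rmorphXn/=.
Qed.

Let an1 : a ^+ n <= 1.
Proof. by apply: exprn_ile1; exact: ltW. Qed.

Let D_hit i : (i < 2 ^ n.+1)%N -> hit n f i -> `|D i| <= C2 * p ^+ n.
Proof.
move=> iN [s si xs].
have s01 : s \in `[0, 1[.
  move: si; rewrite !in_itv/= => /andP[s1 s2].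
  have := tick01 (ltnW iN); have := @tick01 n.+1 i.+1 iN.
  by rewrite !in_itv/=; lra.
have := x_bd s01 => xb.
have := kk' iN; have := fcell_dist n (f (tick n i./2)); have := half_le n => h1 h2 h3.
apply: x_reg => //.
- apply: (@int_bound n _ (x s)) => //.
  by move: h1 h2 h3 xs an1; rewrite -/(k i) !ler_norml; lra.
- apply: (@int_bound n.+1 _ (x s)) => //.
  by move: h1 h2 h3 xs an1; rewrite -/(k i) !ler_norml; lra.
Qed.

Let m := band_width n.

(** After one hit the path stays in the band during the whole interval, as it moves by at most 2 C1
    r^n there. Each hit therefore adds the full length of the interval to [band], which makes the
    hits countable. *)
Let hit_band i : (i < 2 ^ n.+1)%N -> hit n f i ->
  occ x (tick n.+1 i) (tick n.+1 i.+1) (cell n (k i - m%:Z)) (cell n (k i + m%:Z + 1)) =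
  (2 ^+ n.+1)^-1.
Proof.
move=> iN [s si xs]; rewrite occ_full ?tickS ?lerDl ?invr_ge0 ?exprn_ge0//.
  by rewrite addrAC subrr add0r.
move=> u; rewrite -tickS => ui.
have [iN2 si2] := half_tick iN si; have [_ ui2] := half_tick iN ui.
have := x_osc iN2 si2; have := x_osc iN2 ui2; have := band_widthP n; rewrite -/m.
have := fcellP n (f (tick n i./2)); rewrite -/(k i) => kf bw o1 o2.
have xf : `|x u - f (tick n i./2)| <= 5 * a ^+ n + 2 * C1 * r ^+ n.
  by move: xs o1 o2; rewrite !ler_norml; lra.
have mb : 5 * a ^+ n + 2 * C1 * r ^+ n + (2 ^+ n)^-1 <= cell n m%:Z.
  rewrite /cell ler_pdivlMr ?exprn_gt0// mulrDl mulVf ?gt_eqF ?exprn_gt0//.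
  by rewrite mulrC.
move: kf; rewrite in_itv/= !cellS !cellD cellN.
by move: xf; rewrite ler_norml; lra.
Qed.

(* Only the time intervals on which the path comes near f contribute; [band]
   bounds their number, by comparison with the occupation along shifts of f. *)
Lemma level_occ_step :
  `|level_occ x n.+1 g - level_occ x n f| <= 2 * C2 * (15 + 4 * C1) * (2 * r * p) ^+ n * M.
Proof.
rewrite (level_occ_half mx n f) /level_occ -sumrB; apply: le_trans (ler_norm_sum _ _ _) _.
have M0 : 0 <= M by apply: le_trans (hM hf); exact: level_occ_ge0.
have C2p : 0 <= C2 * p ^+ n by rewrite mulr_ge0// exprn_ge0.
apply: (@le_trans _ _ (\sum_(i < 2 ^ n.+1) C2 * p ^+ n * 2 ^+ n.+1 *
    occ x (tick n.+1 i) (tick n.+1 i.+1) (cell n (k i - m%:Z)) (cell n (k i + m%:Z + 1)))).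
  apply: ler_sum => i _; rewrite -/(k' i) -/(k i) -/(D i).
  have [h|h] := pselect (hit n f i).
    rewrite hit_band// -mulrA divff ?gt_eqF ?exprn_gt0// mulr1.
    exact: D_hit.
  by rewrite D_nohit// normr0 mulr_ge0 ?occ_ge0// mulr_ge0// exprn_ge0.
rewrite -mulr_sumr.
have -> : \sum_(i < 2 ^ n.+1) occ x (tick n.+1 i) (tick n.+1 i.+1)
      (cell n (k i - m%:Z)) (cell n (k i + m%:Z + 1)) = band x n m f.
  rewrite /band expnS (sum_half (fun i => occ x (tick n.+1 i) (tick n.+1 i.+1)
      (cell n (k i - m%:Z)) (cell n (k i + m%:Z + 1)))).
  apply: eq_bigr => j _; rewrite /k.
  have -> : (2 * j)./2 = j by rewrite mul2n doubleK.
  have -> : (2 * j).+1./2 = j by rewrite mul2n /= uphalf_double.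
  move: (cell n (_ - _)) (cell n (_ + 1)) => u v.
  rewrite -(tick_half n j) -(tick_half n j.+1) mulnS.
  by rewrite -occ_time_split//; apply: tick_le.
rewrite band_level_occ//.
have H : \sum_(l < m.*2.+1) level_occ x n (fun t => f t + cell n (l%:Z - m%:Z)) <= (2 * m).+1%:R * M.
  apply: (@le_trans _ _ (\sum_(l < m.*2.+1) M)).
    by apply: ler_sum => l _; apply: hM; exact: curve_shift.
  by rewrite sumr_const card_ord mul2n mulr_natl.
apply: (@le_trans _ _ (C2 * p ^+ n * 2 ^+ n.+1 * ((2 ^+ n)^-1 * ((15 + 4 * C1) * (2 * r) ^+ n * M)))).
  apply: ler_wpM2l; first by rewrite mulr_ge0// exprn_ge0.
  apply: ler_wpM2l; first by rewrite invr_ge0 exprn_ge0.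
  by apply: le_trans H _; apply: ler_wpM2r => //; exact: band_width_le.
rewrite le_eqVlt; apply/orP; left; apply/eqP.
rewrite [in RHS]exprMn exprS; have : (2 ^+ n : R) != 0 by rewrite gt_eqF// exprn_gt0.
by move: (2 ^+ n : R) => N N0; field.
Qed.

End step.
End curve_recursion.

Lemma pow_small {R : realType} (z C e : R) : 0 <= z -> z < 1 -> 0 < e ->
  exists n0, forall n, (n0 <= n)%N -> C * z ^+ n <= e.
Proof.
move=> z0 z1 e0.
have : (fun n => C * z ^+ n) @ \oo --> C * 0.
  by apply: cvgM; [exact: cvg_cst|apply: cvg_expr; rewrite ger0_norm].
rewrite mulr0 => /cvgrPdist_le/(_ e e0)[n0 _ H]; exists n0 => n n0n.
by have := H n n0n; rewrite sub0r normrN; apply: le_trans; exact: ler_norm.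
Qed.

(** * Summation over the levels *)

Section curve_limit.
Context {R : realType}.
Variable x : R -> R.
Hypothesis mx : measurable_fun setT x.
Variables (a r p C1 C2 : R).
Hypothesis a_ge : 2^-1 <= a.
Hypothesis ar : a <= r.
Hypothesis r_lt1 : r < 1.
Hypothesis r_ge : 1 <= 2 * r.
Hypothesis p0 : 0 <= p.
Hypothesis rp_lt1 : 2 * r * p < 1.
Hypothesis C1_ge0 : 0 <= C1.
Hypothesis C2_ge0 : 0 <= C2.
Hypothesis x_osc : forall n j s, (j < 2 ^ n)%N -> s \in `[tick n j, tick n j.+1[ ->
  `|x s - x (tick n j)| <= C1 * r ^+ n.
Hypothesis x_reg : forall n i (k k' : int), (i < 2 ^ n.+1)%N ->
  `|k| <= 8 ^+ n.+1 -> `|k'| <= 8 ^+ n.+1 -> `|cell n.+1 k' - cell n k| <= 4 * a ^+ n ->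
  `|2 ^+ n.+1 * occ x (tick n.+1 i) (tick n.+1 i.+1) (cell n.+1 k') (cell n.+1 (k' + 1)) -
    2 ^+ n * occ x (tick n.+1 i) (tick n.+1 i.+1) (cell n k) (cell n (k + 1))| <=
  C2 * p ^+ n.

Let s := 2 * r * p.
Let K4 := 2 * C2 * (15 + 4 * C1).

Let a0 : 0 < a. Proof. by apply: lt_le_trans a_ge; rewrite invr_gt0. Qed.
Let a1 : a < 1. Proof. exact: le_lt_trans ar r_lt1. Qed.
Let s0 : 0 <= s. Proof. by rewrite mulr_ge0//; apply: le_trans r_ge. Qed.
Let K40 : 0 <= K4.
Proof. by rewrite mulr_ge0 ?mulr_ge0// addr_ge0// mulr_ge0. Qed.

Lemma occ_le_len u v c b : u <= v -> occ x u v c b <= v - u.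
Proof.
move=> uv; rewrite -[leRHS]mul1r.
have -> : 1 * (v - u) = \int[lebesgue_measure]_(z in `[u, v[) (cst 1 z) :> R.
  rewrite Rintegral_cst//; congr (_ * _).
  rewrite /= lebesgue_measure_itv/= lte_fin.
  by move: uv; rewrite le_eqVlt => /predU1P[->|->]; rewrite ?ltxx ?subrr.
apply: le_Rintegral => //.
- exact: occ_indic_integrable.
- apply: (@bounded_integrable_itv _ _ _ _ 1) => // z; by rewrite normr1.
- by move=> z _; rewrite indicE; case: (_ \in _).
Qed.

Let tickS n j : tick n j.+1 = tick n j + (2 ^+ n)^-1 :> R.
Proof. by rewrite /tick -natr1 mulrDl mul1r. Qed.

(** A crude bound, valid for every function, from which the recursion starts at a fixed level. *)
Lemma level_occ_le n f : level_occ x n f <= 2 ^+ n.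
Proof.
apply: (@le_trans _ _ (\sum_(j < 2 ^ n) 1)); last by rewrite sumr_const card_ord natrX.
apply: ler_sum => j _; rewrite mulrC -ler_pdivlMr ?exprn_gt0// div1r.
apply: le_trans (occ_le_len _ _ _) _; first exact: tick_le.
by rewrite tickS addrAC subrr add0r.
Qed.

Let large_pow : exists n1, forall n, (n1 <= n)%N -> `|x 0| + C1 + 12 <= 4 ^+ n.+1.
Proof.
have b0 : 0 < `|x 0| + C1 + 12.
  by apply: ltr_wpDl => //; rewrite addr_ge0.
have q0 : (0 : R) <= 4^-1 by rewrite invr_ge0.
have q1 : (4^-1 : R) < 1 by rewrite invf_lt1// ltr1n.
have [n1 H] := pow_small 1 q0 q1 (e := (`|x 0| + C1 + 12)^-1) (ltac:(by rewrite invr_gt0)).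
exists n1 => n n1n; have := H n.+1 (leqW n1n).
by rewrite mul1r exprVn lef_pV2 ?posrE// exprn_gt0.
Qed.

Let geo n : \sum_(l < n) s ^+ l <= (1 - s)^-1.
Proof.
have s1 : 0 < 1 - s by rewrite subr_gt0.
rewrite -div1r ler_pdivlMr// mulrC; have := subrXX 1 s n.
rewrite expr1n => E.
have -> : (1 - s) * \sum_(l < n) s ^+ l = 1 - s ^+ n.
  rewrite E; congr (_ * _); apply: eq_bigr => l _; rewrite expr1n mul1r//.
by rewrite gerBl exprn_ge0.
Qed.

(** The bound of one step is linear in the supremum of the previous level, so the suprema grow at
    most by the factors 1 + K4 s^l, whose product stays below [expR (K4 / (1 - s))]. With a uniform
    bound at hand the increments become geometric. The level [n1] is where the cells met by the path
    enter the range of [x_reg]. *)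
Lemma level_occ_cauchy : exists (n1 : nat) (M K : R), [/\ 0 <= K,
  (forall n f, (n1 <= n)%N -> curve a f -> level_occ x n f <= M) &
  (forall n m f g, (n1 <= n < m)%N -> curve a f -> curve a g ->
    (forall t, t \in `[0, 1] -> `|f t - g t| <= a ^+ n) ->
    `|level_occ x m g - level_occ x n f| <= K * s ^+ n)].
Proof.
have [n1 large] := large_pow.
have s1 : 0 < 1 - s by rewrite subr_gt0.
pose M := 2 ^+ n1 * expR (K4 / (1 - s)).
have ME n : 2 ^+ n1 * expR (K4 * \sum_(l < n) s ^+ l) <= M.
  by rewrite ler_wpM2l ?exprn_ge0// ler_expR ler_wpM2l.
have bnd n f : (n1 <= n)%N -> curve a f ->
    level_occ x n f <= 2 ^+ n1 * expR (K4 * \sum_(l < n) s ^+ l).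
  move=> n1n; rewrite -(subnKC n1n); elim: (n - n1)%N f => [|k IH] f hf.
    rewrite addn0; apply: le_trans (level_occ_le _ _) _.
    rewrite ler_peMr ?exprn_ge0// -expR0 ler_expR mulr_ge0// sumr_ge0// => l _.
    exact: exprn_ge0.
  rewrite addnS; set n' := (n1 + k)%N in IH *.
  set Mn := 2 ^+ n1 * _ in IH.
  have ff t : t \in `[0, 1] -> `|f t - f t| <= a ^+ n'.
    by move=> _; rewrite subrr normr0 exprn_ge0// ltW.
  have := level_occ_step mx a_ge ar r_lt1 r_ge p0 C1_ge0 C2_ge0 x_osc x_reg hf ff IH (large n' (leq_addr _ _)).
  rewrite -/s -/K4 => st.
  have h1 := IH _ hf.
  have : level_occ x n'.+1 f <= Mn * (1 + K4 * s ^+ n').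
    by move: st; rewrite ler_norml => /andP[_]; lra.
  move=> /le_trans; apply.
  rewrite big_ord_recr/= [K4 * (_ + _)]mulrDr expRD mulrA; apply: ler_wpM2l; last exact: expR_ge1Dx.
  by rewrite mulr_ge0 ?exprn_ge0 ?expR_ge0.
have M0 : 0 <= M by rewrite mulr_ge0 ?exprn_ge0 ?expR_ge0.
exists n1, M, (K4 * M / (1 - s)); split.
- by apply: divr_ge0; [exact: mulr_ge0|exact: ltW].
- by move=> n f n1n hf; apply: le_trans (bnd _ _ n1n hf) (ME n).
- move=> n m f g /andP[n1n nm] hf hg fg.
  have step k f' g' : (n1 <= k)%N -> curve a f' -> curve a g' ->
      (forall t, t \in `[0, 1] -> `|f' t - g' t| <= a ^+ k) ->
      `|level_occ x k.+1 g' - level_occ x k f'| <= K4 * s ^+ k * M.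
    move=> n1k hf' hg' fg'.
    apply: (level_occ_step mx a_ge ar r_lt1 r_ge p0 C1_ge0 C2_ge0 x_osc x_reg hf' fg' _ (large k n1k)).
    by move=> h hh; apply: le_trans (bnd _ _ n1k hh) (ME k).
  have gg k t : t \in `[0, 1] -> `|g t - g t| <= a ^+ k.
    by move=> _; rewrite subrr normr0 exprn_ge0// ltW.
  suff : `|level_occ x m g - level_occ x n f| <= K4 * M * ((s ^+ n - s ^+ m) / (1 - s)).
    move=> /le_trans; apply.
    have -> : K4 * M / (1 - s) * s ^+ n = K4 * M * (s ^+ n / (1 - s)) by ring.
    apply: ler_wpM2l; first exact: mulr_ge0.
    apply: ler_wpM2r; first by rewrite invr_ge0 ltW.
    by rewrite gerBl exprn_ge0.
  have key k : s ^+ k = (s ^+ k - s ^+ k.+1) / (1 - s).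
    by rewrite exprS; field; rewrite gt_eqF.
  (* The curve changes from [f] to [g] in the first step only; all later steps keep [g]. *)
  rewrite -(subnKC nm); elim: (m - n.+1)%N => [|k IH].
    rewrite addn0; apply: le_trans (step _ _ _ n1n hf hg fg) _.
    by rewrite mulrAC -key.
  rewrite addnS; set m' := (n.+1 + k)%N in IH *.
  have n1m' : (n1 <= m')%N by apply: leq_trans n1n _; rewrite /m' addSnnS leq_addr.
  have := step m' g g n1m' hg hg (gg m').
  rewrite [X in _ <= X]mulrAC {1}key => st.
  rewrite (_ : _ - _ = (level_occ x m'.+1 g - level_occ x m' g) + (level_occ x m' g - level_occ x n f)); last by ring.
  apply: le_trans (ler_normD _ _) _; apply: le_trans (lerD st IH) _.
  rewrite -mulrDr -mulrDl le_eqVlt; apply/orP; left; apply/eqP.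
  by congr (_ * (_ / _)); ring.
Qed.

End curve_limit.

(** * The limiting occupation density *)

Section curve_occ.
Context {R : realType}.
Local Notation mu := (@lebesgue_measure R).
Variable x : R -> R.
Hypothesis mx : measurable_fun setT x.
Variables (a s M K : R) (n1 : nat).
Hypothesis a_ge : 2^-1 <= a.
Hypothesis a_lt1 : a < 1.
Hypothesis s0 : 0 <= s.
Hypothesis s1 : s < 1.
Hypothesis K0 : 0 <= K.
Hypothesis bound : forall n f, (n1 <= n)%N -> curve a f -> level_occ x n f <= M.
Hypothesis close : forall n m f g, (n1 <= n < m)%N -> curve a f -> curve a g ->
    (forall t, t \in `[0, 1] -> `|f t - g t| <= a ^+ n) ->
    `|level_occ x m g - level_occ x n f| <= K * s ^+ n.

Definition curve_occ (f : R -> R) : R := limn (level_occ x ^~ f).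

Let a0 : 0 < a. Proof. by apply: lt_le_trans a_ge; rewrite invr_gt0. Qed.

Let ff n (f : R -> R) t : t \in `[0, 1] -> `|f t - f t| <= a ^+ n.
Proof. by move=> _; rewrite subrr normr0 exprn_ge0// ltW. Qed.

Lemma cvg_level_occ f : curve a f -> level_occ x ^~ f @ \oo --> curve_occ f.
Proof.
move=> hf; suff : cvgn (level_occ x ^~ f) by [].
apply: cauchy_cvg; apply: cauchy_exP => e e0.
have e20 : 0 < e / 2 by rewrite divr_gt0.
have [n0 H] := pow_small K s0 s1 e20.
pose n := maxn n0 n1; exists (level_occ x n f).
exists n.+1 => // m /= nm.
have := @close n m f f _ hf hf (ff n f); rewrite nm andbT leq_maxr => /(_ isT) h.
rewrite -ball_normE /= distrC; apply: le_lt_trans h _.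
by apply: le_lt_trans (H n (leq_maxl _ _)) _; rewrite ltr_pdivrMr//; lra.
Qed.

Lemma curve_occ_close n f g : (n1 <= n)%N -> curve a f -> curve a g ->
  (forall t, t \in `[0, 1] -> `|f t - g t| <= a ^+ n) ->
  `|level_occ x n f - curve_occ g| <= K * s ^+ n.
Proof.
move=> n1n hf hg fg.
have c : (fun m => `|level_occ x n f - level_occ x m g|) @ \oo --> `|level_occ x n f - curve_occ g|.
  by apply: cvg_norm; apply: cvgB; [exact: cvg_cst|exact: cvg_level_occ].
rewrite -(cvg_lim _ c)//; apply: limr_le; first by apply/cvg_ex; eexists; exact: c.
exists n.+1 => // m /= nm; rewrite distrC; apply: close => //.
by rewrite n1n.
Qed.

Lemma curve_occ_le f : curve a f -> curve_occ f <= M.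
Proof.
move=> hf; apply: limr_le; first by apply/cvg_ex; eexists; exact: cvg_level_occ.
by exists n1 => // n /= n1n; exact: bound.
Qed.

Lemma curve_occ_ge0 f : curve a f -> 0 <= curve_occ f.
Proof.
move=> hf; apply: limr_ge; first by apply/cvg_ex; eexists; exact: cvg_level_occ.
by exists 0%N => // n _; exact: level_occ_ge0.
Qed.

Lemma curve_occ_dist n f g : (n1 <= n)%N -> curve a f -> curve a g ->
  (forall t, t \in `[0, 1] -> `|f t - g t| <= a ^+ n) ->
  `|curve_occ f - curve_occ g| <= 2 * K * s ^+ n.
Proof.
move=> n1n hf hg fg; have h1 := curve_occ_close n1n hf hg fg.
have h2 := curve_occ_close n1n hf hf (ff n f).
move: h1 h2; move: (level_occ x n f) (curve_occ f) (curve_occ g) => u v l.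
by rewrite !ler_norml; lra.
Qed.

Lemma curve_occ_near n m f g : (n1 <= n < m)%N -> curve a f -> curve a g ->
  (forall t, t \in `[0, 1] -> `|f t - g t| <= a ^+ n) ->
  `|level_occ x m g - curve_occ f| <= 2 * K * s ^+ n.
Proof.
move=> nm hf hg fg; have h1 := close nm hf hg fg.
have /andP[n1n _] := nm; have h2 := curve_occ_close n1n hf hf (ff n f).
move: h1 h2; move: (level_occ x m g) (level_occ x n f) (curve_occ f) => u v l.
by rewrite !ler_norml; lra.
Qed.

(** * Occupation of a tube around the curve *)

Section occupation.
Variable f : R -> R.
Hypothesis hf : curve a f.
Hypothesis mf : measurable_fun setT f.

Definition tube (e : R) : R :=
  \int[mu]_(t in `[0, 1[) \1_(`]f t - e, f t + e[%classic) (x t).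

Let tube_fun e t : R := \1_(`]f t - e, f t + e[%classic) (x t).

Let tube_funE e t : tube_fun e t = (`|x t - f t| < e)%R%:R.
Proof.
rewrite /tube_fun indicE mem_setE in_itv/=; congr (nat_of_bool _)%:R.
by rewrite ltr_norml; lra.
Qed.

Let mtube e : measurable_fun setT (tube_fun e).
Proof.
rewrite (_ : tube_fun e = \1_[set t | `|x t - f t| < e]); last first.
  by apply/funext => t; rewrite tube_funE indicE; congr (nat_of_bool _)%:R; rewrite mem_setE.
apply: measurable_indic.
rewrite -[X in measurable X]setTI (_ : [set t | _] = (fun t => `|x t - f t|) @^-1` `]-oo, e[).
  apply: (_ : measurable_fun setT (fun t => `|x t - f t|)) => //.
  by apply: measurableT_comp => //; exact: measurable_funB.
by apply/seteqP; split=> t /=; rewrite in_itv.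
Qed.

Let tube1 e t : `|tube_fun e t| <= 1.
Proof. by rewrite tube_funE; case: (_ < _); rewrite ?normr1 ?normr0. Qed.

Let itube e u v : mu.-integrable `[u, v[ (EFin \o tube_fun e).
Proof. exact: bounded_integrable_itv (mtube e) (tube1 e). Qed.

Lemma tube_integrable e u v : mu.-integrable `[u, v[
  (EFin \o (fun t => \1_(`]f t - e, f t + e[%classic) (x t) : R)).
Proof. exact: itube. Qed.

Lemma tube_ticks e n : tube e =
  \sum_(j < 2 ^ n) \int[mu]_(t in `[tick n j, tick n j.+1[) tube_fun e t.
Proof.
have H k : \int[mu]_(t in `[0, tick n k[) tube_fun e t =
    \sum_(j < k) \int[mu]_(t in `[tick n j, tick n j.+1[) tube_fun e t.
  elim: k => [|k IH]; first by rewrite big_ord0 /tick mul0r set_itvco0 Rintegral_set0.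
  rewrite big_ord_recr/= -IH.
  apply: (Rintegral_itv_split _ _ (mtube e) (tube1 e)).
    by rewrite /tick divr_ge0// exprn_ge0.
  exact: tick_le.
rewrite -H /tick natrX divff ?gt_eqF ?exprn_gt0//.
Qed.

Let tick01 n j (t : R) : (j < 2 ^ n)%N -> t \in `[tick n j, tick n j.+1[ ->
  [/\ t \in `[0, 1], (tick n j : R) \in `[0, 1] & `|f t - f (tick n j)| <= a ^+ n].
Proof.
move=> jn; have N0 : (0 : R) < 2 ^+ n by exact: exprn_gt0.
have tS : tick n j.+1 = tick n j + (2 ^+ n)^-1 :> R by rewrite /tick -natr1 mulrDl mul1r.
rewrite in_itv/= => /andP[t1 t2].
have T0 : (0 : R) <= tick n j by rewrite /tick divr_ge0// ltW.
have T1 : (tick n j.+1 : R) <= 1.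
  by rewrite /tick ler_pdivrMr// mul1r -natrX ler_nat.
have h1 : t \in `[0, 1] by rewrite in_itv/=; lra.
have h2 : (tick n j : R) \in `[0, 1].
  by rewrite in_itv/= T0/=; lra.
split => //; apply: hf => //.
by rewrite ler_norml; lra.
Qed.

(** With its converse below, this encloses the tube between two bands of a much finer level. The
    margin a^n pays for freezing the curve on the time intervals. *)
Let tube_le_band e n m : e + a ^+ n <= cell n m%:Z -> tube e <= band x n m f.
Proof.
move=> em; rewrite (tube_ticks e n); apply: ler_sum => j _.
apply: le_Rintegral => //; first exact: occ_indic_integrable.
move=> t tj; have [_ _ ft] := tick01 (ltn_ord j) tj.
rewrite -/(tube_fun e t) tube_funE indicE.
case: (ltP `|x t - f t| e) => // xt; rewrite mem_set//=.
have := fcellP n (f (tick n j)); move: ft xt em.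
rewrite in_itv/= !cellD cellN ler_norml ltr_norml.
rewrite (_ : cell n 1 = (2 ^+ n)^-1); last by rewrite /cell mul1r.
have : (0 : R) < (2 ^+ n)^-1 by rewrite invr_gt0 exprn_gt0.
by lra.
Qed.

Let band_le_tube e n m : cell n m%:Z + 2 * (2 ^+ n)^-1 + a ^+ n <= e -> band x n m f <= tube e.
Proof.
move=> em; rewrite (tube_ticks e n); apply: ler_sum => j _.
apply: le_Rintegral => //; first exact: occ_indic_integrable.
move=> t tj; have [_ _ ft] := tick01 (ltn_ord j) tj.
rewrite -/(tube_fun e t) tube_funE indicE mem_setE.
case: (boolP (x t \in `[_, _[)) => [xt|_]; last by rewrite ler0n.
suff -> : `|x t - f t| < e by [].
have := fcellP n (f (tick n j)); move: ft xt em.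
rewrite in_itv/= !cellD cellN ler_norml ltr_norml.
rewrite (_ : cell n 1 = (2 ^+ n)^-1); last by rewrite /cell mul1r.
have : (0 : R) < (2 ^+ n)^-1 by rewrite invr_gt0 exprn_gt0.
by lra.
Qed.

(** A band averages [level_occ] over 2 m + 1 shifts of f, all of them within a^n of f; hence each
    term is close to the limit for f itself. *)
Let band_near n m k : (n1 <= n < k)%N -> cell k m%:Z <= a ^+ n ->
  `|band x k m f - (2 ^+ k)^-1 * m.*2.+1%:R * curve_occ f| <=
  (2 ^+ k)^-1 * m.*2.+1%:R * (2 * K * s ^+ n).
Proof.
move=> nk ma; rewrite band_level_occ//.
have -> : (2 ^+ k)^-1 * m.*2.+1%:R * curve_occ f =
    (2 ^+ k)^-1 * \sum_(l < m.*2.+1) curve_occ f.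
  by rewrite sumr_const card_ord -mulrA mulr_natl.
set S1 := \sum_(l < _) level_occ _ _ _.
have -> : (2 ^+ k)^-1 * S1 - (2 ^+ k)^-1 * \sum_(l < m.*2.+1) curve_occ f =
    (2 ^+ k)^-1 * \sum_(l < m.*2.+1)
      (level_occ x k (fun t => f t + cell k (l%:Z - m%:Z)) - curve_occ f).
  by rewrite sumrB mulrBr.
rewrite normrM ger0_norm ?invr_ge0 ?exprn_ge0// -[leRHS]mulrA.
apply: ler_wpM2l; first by rewrite invr_ge0 exprn_ge0.
apply: le_trans (ler_norm_sum _ _ _) _.
apply: (@le_trans _ _ (\sum_(l < m.*2.+1) 2 * K * s ^+ n)); last first.
  by rewrite sumr_const card_ord [leRHS]mulr_natl.
apply: ler_sum => l _; apply: (curve_occ_near nk) => //; first exact: curve_shift.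
move=> t _; rewrite opprD addrA subrr add0r normrN; apply: le_trans ma.
have N0 : (0 : R) < 2 ^+ k by exact: exprn_gt0.
rewrite /cell normrM [`|_^-1|]ger0_norm ?invr_ge0 ?exprn_ge0// ler_pM2r ?invr_gt0//.
rewrite -intr_norm ler_int; have := ltn_ord l; lia.
Qed.

Lemma tube_near (n : nat) (e d : R) : (n1 <= n)%N -> 0 < d -> 2 * K * s ^+ n <= d ->
  0 < e -> 2 * e < a ^+ n ->
  `|(2 * e)^-1 * tube e - curve_occ f| <= 2 * d.
Proof.
move=> n1n d0 nd e0 en.
have L0 := curve_occ_ge0 hf; set L := curve_occ f in L0 *.
(* Two scales are at work: [n] is fixed and limits the width of the tube, while [k] depends on [e].
   The choice of [C] and [mn] gives 10 a^k <= e and 10 a^k (L + d) <= e d, which absorbs the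
   rounding of [e] to a whole number of cells. *)
pose C := 10 * (L + d) + 10.
pose mn := Num.min (e * d) e.
have mn0 : 0 < mn by rewrite lt_min mulr_gt0// e0.
have [k0 Hk] := pow_small C (ltW a0) a_lt1 mn0.
pose k := maxn k0 n.+1.
have /andP[Cd Ce] : (C * a ^+ k <= e * d) && (C * a ^+ k <= e).
  by rewrite -le_min; apply: Hk; exact: leq_maxl.
have nk : (n1 <= n < k)%N by rewrite n1n leq_maxr.
set A := a ^+ k in Cd Ce.
have A0 : 0 < A by exact: exprn_gt0.
have N0 : (0 : R) < 2 ^+ k by exact: exprn_gt0.
have VA : (2 ^+ k)^-1 <= A by rewrite -exprVn lerXn2r// nnegrE ?invr_ge0// ltW.
have V0 : (0 : R) < (2 ^+ k)^-1 by rewrite invr_gt0.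
have band_near' m : cell k m%:Z <= a ^+ n ->
  `|band x k m f - (2 ^+ k)^-1 * m.*2.+1%:R * L| <= (2 ^+ k)^-1 * m.*2.+1%:R * d.
  move=> h; apply: le_trans (band_near nk h) _; apply: ler_wpM2l nd.
  by apply: mulr_ge0 => //; exact: ltW.
have cellE (m : nat) : cell k m%:Z = (2 ^+ k)^-1 * m%:R by rewrite /cell mulrC.
have oddE (m : nat) : (2 ^+ k)^-1 * m.*2.+1%:R = 2 * ((2 ^+ k)^-1 * m%:R) + (2 ^+ k)^-1 :> R.
  by rewrite [m.*2.+1%:R]mulrSr -mul2n natrM; ring.
set V : R := (2 ^+ k)^-1 in VA V0 band_near' cellE oddE.
have LA : 0 <= L * A by rewrite mulr_ge0// ltW.
have dA : 0 <= d * A by rewrite mulr_ge0// ltW.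
have Ce' : 10 * A <= e by move: Ce; rewrite /C; lra.
have Cd' : 10 * (L * A) + 10 * (d * A) <= e * d by move: Cd; rewrite /C; lra.
have VN y : V * (2 ^+ k * y) = y by rewrite mulrA mulVf ?mul1r// gt_eqF.
have up : tube e <= 2 * e * (L + 2 * d).
  pose m := (Num.truncn (2 ^+ k * (e + A))).+1.
  have m1 : e + A <= V * m%:R.
    by rewrite -{1}[e + A]VN ler_pM2l//; apply/ltW/truncnS_gt.
  have m2 : V * m%:R <= e + A + V.
    have : (Num.truncn (2 ^+ k * (e + A)))%:R <= 2 ^+ k * (e + A).
      by rewrite truncn_le mulr_ge0// ?ltW// addr_gt0.
    by rewrite -(ler_pM2l V0) VN /m; set q := Num.truncn _; rewrite [q.+1%:R]mulrSr mulrDr mulr1; lra.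
  have := @tube_le_band e k m; rewrite cellE -/A => /(_ m1) tb.
  have := band_near' m; rewrite cellE => bn; have ym : V * m%:R <= a ^+ n by move: m1 m2; move: (V * m%:R) => y; clearbody A V; move=> ? ?; lra.
  have {}bn := bn ym.
  rewrite oddE in bn; set y := V * m%:R in m1 m2 bn.
  have y1 : 2 * y + V <= 2 * e + 5 * A by lra.
  have y2 : (2 * y + V) * (L + d) <= (2 * e + 5 * A) * (L + d).
    by apply: ler_wpM2r => //; rewrite addr_ge0// ltW.
  by move: bn; rewrite ler_norml => /andP[_ bn]; lra.
have lo : 2 * e * (L - 2 * d) <= tube e.
  (* The two cells taken off are the margin in [band_le_tube]; [m3] shows that the natural
     subtraction does not truncate. *)
  pose m := (Num.truncn (2 ^+ k * (e - A)) - 2)%N.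
  have eA : 0 <= 2 ^+ k * (e - A) by rewrite mulr_ge0// ?ltW//; lra.
  have m3 : (2 <= Num.truncn (2 ^+ k * (e - A)))%N.
    by rewrite truncn_ge_nat// -(ler_pM2l V0) VN; lra.
  have mE : m%:R = (Num.truncn (2 ^+ k * (e - A)))%:R - 2 :> R by rewrite natrB.
  have m1 : V * m%:R + 2 * V + A <= e.
    have : (Num.truncn (2 ^+ k * (e - A)))%:R <= 2 ^+ k * (e - A) by rewrite truncn_le.
    by rewrite -(ler_pM2l V0) VN mE; set q := Num.truncn _; rewrite mulrBr; lra.
  have m2 : e - A - 3 * V <= V * m%:R.
    have : 2 ^+ k * (e - A) <= (Num.truncn (2 ^+ k * (e - A))).+1%:R by apply/ltW/truncnS_gt.
    by rewrite -(ler_pM2l V0) VN mE; set q := Num.truncn _; rewrite mulrBr [q.+1%:R]mulrSr mulrDr mulr1; lra.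
  have := @band_le_tube e k m; rewrite cellE -/A -/V => /(_ m1) tb.
  have := band_near' m; rewrite cellE => bn; have ym : V * m%:R <= a ^+ n by move: m1 m2; move: (V * m%:R) => y; clearbody A V; move=> ? ?; lra.
  have {}bn := bn ym.
  rewrite oddE in bn; set y := V * m%:R in m1 m2 bn.
  have y1 : 2 * e - 7 * A <= 2 * y + V by lra.
  have y2 : (2 * e - 7 * A) * L <= (2 * y + V) * L by apply: ler_wpM2r.
  have y3 : (2 * y + V) * d <= 2 * e * d by apply: ler_wpM2r; [exact: ltW|lra].
  by move: bn; rewrite ler_norml => /andP[bn _]; lra.
have e2 : 0 < 2 * e by lra.
have E : 2 * e * ((2 * e)^-1 * tube e) = tube e by rewrite mulrA mulfV ?mul1r// gt_eqF.
rewrite -E !ler_pM2l// in up lo.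
by rewrite ler_norml; apply/andP; split; lra.
Qed.

Lemma cvg_tube : (2 * e)^-1 * tube e @[e --> 0^'+] --> curve_occ f.
Proof.
apply/cvgrPdist_le => eps eps0.
have d0 : 0 < eps / 2 by rewrite divr_gt0.
have [n0 H] := pow_small (2 * K) s0 s1 d0.
pose n := maxn n0 n1.
have an : 0 < a ^+ n / 2 by rewrite divr_gt0// exprn_gt0.
near=> e.
have e0 : 0 < e by near: e; exact: nbhs_right_gt.
have ea : e < a ^+ n / 2 by near: e; exact: nbhs_right_lt.
have ea2 : 2 * e < a ^+ n by lra.
have := tube_near (leq_maxr _ _) d0 (H n (leq_maxl _ _)) e0 ea2.
rewrite distrC => /le_trans; apply; lra.
Unshelve. all: by end_near.
Qed.

End occupation.
End curve_occ.

(** * Almost sure estimates *)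

Section exp_union.
Context {R : realType} {d : measure_display} {T : measurableType d}.
Variable P : probability T R.

Lemma pow2_le_expR (k : nat) : 2 ^+ k <= expR (k%:R : R).
Proof.
rewrite -[k%:R]mulr1 expRM_natl lerXn2r// ?nnegrE ?expR_ge0//.
by have := expR_ge1Dx (1 : R); lra.
Qed.

Lemma weighted_card_le (N C0 q n : nat) (B : R) : 0 <= B -> (N <= C0 * 2 ^ (q * n))%N ->
  expR (- (q.+1 * n)%:R) * B *+ N <= C0%:R * B * 2^-1 ^+ n.
Proof.
move=> B0 NC; rewrite -mulr_natr expRN.
apply: (@le_trans _ _ ((2 ^+ (q.+1 * n))^-1 * B * (C0%:R * 2 ^+ (q * n)))).
  apply: ler_pM => //; first by rewrite mulr_ge0// invr_ge0 expR_ge0.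
    apply: ler_wpM2r => //; rewrite lef_pV2 ?posrE ?expR_gt0 ?exprn_gt0//.
    exact: pow2_le_expR.
  by rewrite -natrX -natrM ler_nat.
rewrite mulSn exprD exprVn; set u := 2 ^+ n; set v := 2 ^+ (q * n).
have v0 : v != 0 by rewrite expf_neq0.
rewrite invfM (_ : u^-1 / v * B * _ = C0%:R * B * u^-1 * (v^-1 * v)).
  by rewrite mulVf// mulr1.
by move: (u^-1) (v^-1) => u' v'; ring.
Qed.

(* Markov's inequality and a union bound in one stroke: the weighted sum of
   all the [expR (Z n c)] has a finite integral, so it is finite a.s. *)
Lemma exp_moment_linear_bound (F : nat -> finType) (Z : forall n, F n -> T -> R)
    (B : R) (C0 q : nat) : 0 <= B -> (forall n, (#|F n| <= C0 * 2 ^ (q * n))%N) ->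
  (forall n c, measurable_fun setT (Z n c)) ->
  (forall n c, (\int[P]_w (expR (Z n c w))%:E <= B%:E)%E) ->
  {ae P, forall w, exists C, forall n c, Z n c w <= C + (q.+1 * n)%:R}.
Proof.
move=> B0 cF mZ ZB.
pose v n : R := expR (- (q.+1 * n)%:R).
pose g n (c : F n) w := ((v n)%:E * (expR (Z n c w))%:E)%E.
pose G n w := (\sum_(c : F n) g n c w)%E.
have g0 n c w : (0 <= g n c w)%E by rewrite mule_ge0// lee_fin expR_ge0.
have mg n c : measurable_fun setT (g n c).
  by apply: measurable_funeM; apply/measurable_EFinP; exact: measurableT_comp.
have G0 n w : (0 <= G n w)%E by apply: sume_ge0.
have mG n : measurable_fun setT (G n) by apply: emeasurable_sum.
have IG n : (\int[P]_w G n w <= (C0%:R * B * 2^-1 ^+ n)%:E)%E.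
  rewrite ge0_integral_sum//.
  apply: (@le_trans _ _ (\sum_(c : F n) (v n * B)%:E)%E).
    apply: lee_sum => c _; rewrite ge0_integralZl//.
    - by rewrite EFinM lee_wpmul2l ?lee_fin ?expR_ge0.
    - by apply/measurable_EFinP; exact: measurableT_comp.
    - by rewrite lee_fin expR_ge0.
  rewrite sumEFin sumr_const lee_fin; apply: weighted_card_le => //; exact: cF.
pose S w := (\sum_(0 <= n <oo) G n w)%E.
have IS : (\int[P]_w S w < +oo)%E.
  rewrite integral_nneseries//.
  apply: (@le_lt_trans _ _ (2 * (C0%:R * B))%:E); last exact: ltry.
  apply: lime_le; first by apply: is_cvg_nneseries => n _ _; exact: integral_ge0.
  apply: nearW => n; apply: (@le_trans _ _ (2 * (C0%:R * B) * (1 - 2^-1 ^+ n))%:E); last first.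
    by rewrite lee_fin ler_piMr// ?mulr_ge0// gerBl exprn_ge0// invr_ge0.
  elim: n => [|n IH]; first by rewrite big_geq// expr0 subrr mulr0.
  rewrite big_nat_recr//=; apply: (le_trans (leeD IH (IG n))).
  by rewrite -EFinD lee_fin exprS; move: (_ ^+ n) => y; lra.
have mS : measurable_fun setT S.
  by apply: ge0_emeasurable_sum => // n w _ _; exact: G0.
have iS : P.-integrable setT S.
  apply/integrableP; split => //; rewrite (eq_integral S)// => w _.
  by rewrite gee0_abs// nneseries_ge0.
have := integrable_ae measurableT iS.
apply: filterS => w /(_ I) Sw; exists (fine (S w)) => n c.
have h : (g n c w <= S w)%E.
  apply: (@le_trans _ _ (G n w)).
    by rewrite /G (bigD1 c)//= leeDl// sume_ge0.
  apply: (@le_trans _ _ (\sum_(0 <= i < n.+1) G i w)%E).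
    by rewrite big_nat_recr//= leeDr// sume_ge0.
  by apply: nneseries_lim_ge.
have : v n * expR (Z n c w) <= fine (S w) by rewrite -lee_fin fineK// EFinM.
rewrite /v -expRD addrC => {}h.
have := expR_ge1Dx (Z n c w - (q.+1 * n)%:R); lra.
Qed.
End exp_union.

(** * A continuous and jointly measurable version of the path *)

Section joint_measurability.
Context {R : realType} {d : measure_display} {T : measurableType d}.

Let grid (n : nat) (t : R) : R := (Num.truncn (t * n.+1%:R))%:R / n.+1%:R.

Let cvg_grid (t : R) : grid ^~ t @ \oo --> Num.max t 0.
Proof.
apply/cvgrPdist_le => e e0; near=> n.
have n0 : (0 : R) < n.+1%:R by [].
have ne : n.+1%:R^-1 <= e.
  by near: n; apply: filterS (near_infty_natSinv_lt (PosNum e0)) => n /ltW.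
apply: le_trans ne.
rewrite -(ler_pM2r n0) mulVf ?gt_eqF// -[X in _ * X]gtr0_norm// -normrM mulrBl.
rewrite /grid divfK ?gt_eqF// maxr_pMl ?ltW// mul0r.
have [t0|t0] := leP 0 (t * n.+1%:R).
  have := truncn_itv t0; move: (Num.truncn _) => k; rewrite -natr1 => /andP[h1 h2].
  by rewrite ger0_norm; lra.
rewrite (_ : Num.truncn _ = 0%N) ?subrr ?normr0//.
by apply/truncn0Pn; rewrite -ltNge; apply: lt_trans t0 _.
Unshelve. all: by end_near.
Qed.

(** The process is a limit of processes that are constant in time between grid points, whose
    preimages are countable unions of rectangles. Negative times truncate to 0, hence the
    maximum. *)
Lemma continuous_measurable_process (Y : R -> T -> R) :
  (forall t, measurable_fun setT (Y t)) -> (forall w, continuous (Y ^~ w)) ->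
  measurable_fun setT (fun z : R * T => Y (Num.max z.1 0) z.2).
Proof.
move=> mY cY.
apply: (@measurable_fun_cvg _ _ R setT (fun n (z : R * T) => Y (grid n z.1) z.2)); last first.
  move=> [t w] _ /=; apply: (@cvg_comp _ _ _ (grid ^~ t) (Y ^~ w)); first exact: cvg_grid.
  exact: cY.
move=> n _ B mB; rewrite setTI.
rewrite (_ : _ @^-1` _ = \bigcup_k ([set t : R | Num.truncn (t * n.+1%:R) = k] `*`
  (Y (k%:R / n.+1%:R) @^-1` B))); last first.
  apply/seteqP; split => [[t w] /= h|[t w] [k _] [/= <-]]//.
  by exists (Num.truncn (t * n.+1%:R)).
apply: bigcupT_measurable => k; apply: measurableX.
  apply: is_interval_measurable => x y /= xk yk z /andP[xz zy]; apply/eqP.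
  by rewrite eqn_leq -{1}yk -[X in _ && (X <= _)%N]xk !le_truncn// ler_pM2r.
by rewrite -[X in measurable X]setTI; exact: mY.
Qed.

End joint_measurability.

Section clean_path.
Context {R : realType} {d : measure_display} {T : measurableType d}.
Variable P : probability T R.
Variable W : R -> {RV P >-> R}.

(** Fubini's theorem needs joint measurability and the pathwise arguments need continuity for every
    outcome. So the path is set to 0 on a null set and frozen at its initial value for negative
    times. *)
Lemma continuous_path_version : brownian_motion W ->
  exists Y : R -> T -> R,
    [/\ measurable_fun setT (fun z : R * T => Y z.1 z.2),
        forall w, continuous (Y ^~ w), forall w, Y 0 w = 0 &
        {ae P, forall w t, 0 <= t -> Y t w = W t w}].
Proof.
move=> [W0 _ _ Wc].
have : {ae P, forall w, W 0 w = 0 /\ {within `[0, +oo[, continuous (fun t : R => W t w)}}.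
  by near do split; [exact: W0 | exact: Wc].
move=> [N [mN PN HN]].
have GN w : w \notin N -> W 0 w = 0 /\ {within `[0, +oo[, continuous (fun t : R => W t w)}.
  by move=> /negP wN; apply: contrapT => h; apply: wN; rewrite inE; exact: HN.
pose Y (t : R) w : R := \1_(~` N) w * W (Num.max t 0) w.
have YN t w : w \notin N -> Y t w = W (Num.max t 0) w.
  by move=> wN; rewrite /Y indicE in_setC wN mul1r.
have Y0 t w : w \in N -> Y t w = 0 by move=> wN; rewrite /Y indicE in_setC wN mul0r.
have mY t : measurable_fun setT (Y t).
  apply: measurable_funM => //; apply: measurable_indic; exact: measurableC.
have cY w : continuous (Y ^~ w).
  have [wN|wN] := boolP (w \in N).
    by rewrite (_ : Y ^~ w = cst 0) ?funeqE => [|t]; [exact: cst_continuous|rewrite Y0].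
  have [_ /subspace_continuousP cW] := GN _ wN.
  rewrite (_ : Y ^~ w = (fun t => W t w) \o (fun t => Num.max t 0)); last first.
    by apply/funext => t /=; rewrite YN.
  move=> t; apply: (@cvg_comp _ _ _ _ _ _ (within `[0, +oo[ (nbhs (Num.max t 0)))); last first.
    by apply: cW; rewrite /= in_itv/= andbT le_max lexx orbT.
  have cm : (fun t : R => Num.max t 0) @ t --> Num.max t 0.
    by apply: (@continuous_max R R id (cst 0) t); [exact: cvg_id|exact: cvg_cst].
  move=> A tA; have hA : nbhs t [set u : R |
      [set` `[0, +oo[] (Num.max u 0) -> A (Num.max u 0)] := cm _ tA.
  suff : nbhs t [set u : R | A (Num.max u 0)] by [].
  apply: filterS hA => u /=; apply.
  by rewrite /= in_itv/= andbT le_max lexx orbT.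
exists Y; split => //.
- have := continuous_measurable_process mY cY.
  by congr (measurable_fun _ _); apply/funext => z; rewrite /Y -maxA maxxx.
- move=> w; have [/Y0//|wN] := boolP (w \in N).
  by rewrite YN// maxxx; case: (GN _ wN).
- exists N; split => // w /= h; apply: contrapT => wN; apply: h => t t0.
  by rewrite YN ?max_l//; apply/negP; rewrite inE.
Unshelve. all: by end_near.
Qed.

End clean_path.

Lemma double_or_succ (u v : nat) : (v < (2 * u).+2)%N -> (2 * u < v.+1)%N ->
  v = (2 * u)%N \/ v = (2 * u).+1.
Proof. lia. Qed.

(** * From dyadic increments to oscillation *)

Section dyadic_paths.
Context {R : realType}.

(** The union bound costs a factor linear in n, which is absorbed by enlarging the ratio from [z] to
    [r]; Bernoulli's inequality bounds (r / z)^n from below. *)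
Lemma linear_geometric_le (C c z r : R) : 0 < z -> z < r ->
  exists2 D, 0 <= D & forall n : nat, (C + c * n%:R) * z ^+ n <= D * r ^+ n.
Proof.
move=> z0 zr; pose h := r / z - 1.
have h0 : 0 < h by rewrite subr_gt0 ltr_pdivlMr// mul1r.
have rE : r = z * (1 + h) by rewrite addrCA subrr addr0 mulrC divfK ?gt_eqF.
have bern n : 1 + n%:R * h <= (1 + h) ^+ n.
  elim: n => [|n IH]; first by rewrite mul0r addr0.
  rewrite exprS -natr1; apply: (@le_trans _ _ ((1 + h) * (1 + n%:R * h))).
    have : 0 <= h * (n%:R * h) by rewrite !mulr_ge0// ltW.
    by move: (n%:R : R) => y; lra.
  by rewrite ler_pM2l// addr_gt0.
exists (`|C| + `|c| / h) => [|n]; first by rewrite addr_ge0// divr_ge0// ltW.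
have zn : 0 < z ^+ n by exact: exprn_gt0.
rewrite rE exprMn mulrCA mulrC; apply: ler_wpM2l; first exact: ltW.
apply: (@le_trans _ _ ((`|C| + `|c| / h) * (1 + n%:R * h))); last first.
  by apply: ler_wpM2l => //; rewrite addr_ge0// divr_ge0// ltW.
set w := `|c| / h; have cE : `|c| = w * h by rewrite divfK// gt_eqF.
have -> : (`|C| + w) * (1 + n%:R * h) = `|C| + `|c| * n%:R + w + `|C| * (n%:R * h).
  by rewrite cE; move: (n%:R : R) `|C| => u v; ring.
have h1 := ler_norm C.
have h2 : c * n%:R <= `|c| * n%:R by rewrite ler_wpM2r// ler_norm.
have h3 : 0 <= w by rewrite divr_ge0// ltW.
have h4 : 0 <= `|C| * (n%:R * h) by rewrite !mulr_ge0// ltW.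
lra.
Qed.

Let dtick (n : nat) (s : R) : R := tick n (Num.truncn (2 ^+ n * s)).

Lemma cvg_dtick (s : R) : 0 <= s -> dtick ^~ s @ \oo --> s.
Proof.
move=> s0; apply/cvgrPdist_le => e e0.
have v0 : (0 : R) <= 2^-1 by rewrite invr_ge0.
have v1 : (2^-1 : R) < 1 by rewrite invf_lt1// ltr1n.
have [n0 H] := pow_small 1 v0 v1 e0.
exists n0 => // n /= /H; rewrite mul1r exprVn => /(le_trans _); apply.
have N0 : (0 : R) < 2 ^+ n by exact: exprn_gt0.
rewrite /dtick /tick.
rewrite -(ler_pM2r N0) mulVf ?gt_eqF// -[X in _ * X <= _](gtr0_norm N0) -normrM mulrBl.
rewrite divfK ?gt_eqF// [s * _]mulrC.
have := truncn_itv (mulr_ge0 (ltW N0) s0).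
move: (Num.truncn _) => k; rewrite -natr1 => /andP[h1 h2].
by rewrite ger0_norm; lra.
Qed.

(** Chaining along the dyadic approximations of [s] from below: each is either equal to the previous
    one or its right neighbour on the finer level, so increments over single dyadic intervals
    suffice. Continuity passes to the limit. *)
Lemma dyadic_chaining (y : R -> R) (D rho : R) : continuous y ->
  0 <= rho -> rho < 1 ->
  (forall m k, (k < 2 ^ m)%N -> `|y (tick m k.+1) - y (tick m k)| <= D * rho ^+ m) ->
  forall n j s, (j < 2 ^ n)%N -> s \in `[tick n j, tick n j.+1[ ->
  `|y s - y (tick n j)| <= D / (1 - rho) * rho ^+ n.
Proof.
move=> cy rho0 rho1 inc n j s jn; rewrite in_itv/= => /andP[sj sj1].
have D0 : 0 <= D by have := inc 0%N 0%N isT; rewrite expr0 mulr1; apply: le_trans.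
have q0 : 0 < 1 - rho by rewrite subr_gt0.
have N0 m : (0 : R) < 2 ^+ m by exact: exprn_gt0.
have s0 : 0 <= s by apply: le_trans sj; rewrite /tick divr_ge0// ltW.
have s1 : s < 1.
  apply: lt_le_trans sj1 _; rewrite /tick ler_pdivrMr// mul1r -natrX ler_nat//.
have ms m : 0 <= 2 ^+ m * s by apply: mulr_ge0 => //; exact: ltW.
pose k m := Num.truncn (2 ^+ m * s).
have kn : k n = j.
  apply/eqP; rewrite truncn_eq//; move: sj sj1.
  rewrite /tick ler_pdivrMr// ltr_pdivlMr// => h1 h2.
  by rewrite [2 ^+ n * s]mulrC h1 h2.
have km m : (k m < 2 ^ m)%N.
  rewrite truncn_lt_nat// natrX -[ltRHS]mulr1.
  by rewrite ltr_pM2l.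
have kS m : k m.+1 = (2 * k m)%N \/ k m.+1 = (2 * k m).+1.
  have /andP[h1 h2] := truncn_itv (ms m).
  have /andP[h3 h4] := truncn_itv (ms m.+1).
  move: h1 h2 h3 h4; rewrite -/(k m) -/(k m.+1) exprS -mulrA.
  move: (k m) (k m.+1) (2 ^+ m * s) => u v z h1 h2 h3 h4.
  apply: double_or_succ.
    by rewrite -(ltr_nat R) -addn2 natrD natrM; move: h2; rewrite -natr1; lra.
  by rewrite -(ltr_nat R) natrM; lra.
have ystep m : `|y (dtick m.+1 s) - y (dtick m s)| <= D * rho ^+ m.
  apply: (@le_trans _ _ (D * rho ^+ m.+1)); last first.
    by rewrite ler_wpM2l// exprS ler_piMl ?exprn_ge0// ltW.
  rewrite /dtick -/(k m) -/(k m.+1) -(tick_half m (k m)).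
  have := km m; case: (kS m) => -> kmm.
    by rewrite subrr normr0 mulr_ge0// exprn_ge0.
  by apply: inc; rewrite expnS; lia.
have tele i : `|y (dtick (n + i) s) - y (tick n j)| <=
    D / (1 - rho) * rho ^+ n * (1 - rho ^+ i).
  elim: i => [|i IH].
    by rewrite addn0 /dtick -/(k n) kn !subrr normr0 mulr0.
  rewrite addnS (_ : _ - _ = (y (dtick (n + i).+1 s) - y (dtick (n + i) s)) +
    (y (dtick (n + i) s) - y (tick n j))); last by rewrite addrA subrK.
  apply: le_trans (ler_normD _ _) _; apply: le_trans (lerD (ystep _) IH) _.
  have -> : D * rho ^+ (n + i) = D / (1 - rho) * rho ^+ n * (rho ^+ i * (1 - rho)).
    by rewrite exprD -{1}[D](divfK (lt0r_neq0 q0)); move: (D / _) => E; ring.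
  rewrite -mulrDr exprS (_ : rho ^+ i * (1 - rho) + _ = 1 - rho * rho ^+ i)//.
  by move: (rho ^+ i) => u; ring.
have cys : (fun i => `|y (dtick i s) - y (tick n j)|) @ \oo --> `|y s - y (tick n j)|.
  apply: cvg_norm; apply: cvgB; last exact: cvg_cst.
  by apply: (@cvg_comp _ _ _ (dtick ^~ s) y); [exact: cvg_dtick|exact: cy].
rewrite -(cvg_lim _ cys)//; apply: limr_le; first by apply/cvg_ex; eexists; exact: cys.
exists n => // m /= nm; rewrite -(subnKC nm); apply: le_trans (tele _) _.
have E0 : 0 <= D / (1 - rho) * rho ^+ n.
  by rewrite mulr_ge0 ?exprn_ge0//; apply: divr_ge0 => //; exact: ltW.
by apply: ler_piMr => //; rewrite gerBl exprn_ge0.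
Qed.

End dyadic_paths.

Section regularity.
Context {R : realType} {d : measure_display} {T : measurableType d}.
Variable P : probability T R.
Variable W : R -> {RV P >-> R}.
Hypothesis bmW : brownian_motion W.

(** The sign [b] serves both tails at once. Completing the square turns the centred density into the
    one with mean [b * q], which integrates to 1. *)
Lemma brownian_increment_exp (b s t : R) : b ^+ 2 = 1 -> 0 <= s -> s < t ->
  (\int[P]_w (expR (b * ((Num.sqrt (t - s))^-1 * (W t w - W s w))))%:E =
   (expR (2^-1))%:E)%E.
Proof.
move=> b2 s0 st; case: bmW => _ _ law _.
set q := Num.sqrt (t - s); have q0 : 0 < q by rewrite sqrtr_gt0 subr_gt0.
have mf : measurable_fun setT (fun y : R => (expR (b * (q^-1 * y)))%:E).
  apply/measurable_EFinP; apply: measurableT_comp => //.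
  by apply: measurable_funM => //; apply: measurable_funM.
rewrite (@ge0_integral_normal_law _ _ _ P (fun w => W t w - W s w) 0 q
   (fun y => (expR (b * (q^-1 * y)))%:E))//.
- transitivity (\int[lebesgue_measure]_y ((expR 2^-1)%:E * (normal_pdf (b * q) q y)%:E))%E.
    apply: eq_integral => y _; rewrite -!EFinM /normal_pdf gt_eqF//; congr (_%:E).
    rewrite mulrCA [RHS]mulrCA /normal_fun; congr (_ * _); rewrite -!expRD; congr expR.
    rewrite subr0 sqrrB exprMn b2; field.
    by rewrite gt_eqF.
  rewrite ge0_integralZl//.
  + by rewrite integral_normal_pdf mule1.
  + by apply/measurable_EFinP; exact: measurable_normal_pdf.
  + by move=> y _; rewrite lee_fin normal_pdf_ge0.
- exact: measurable_funB.
- by move=> B mB; apply: law.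
Qed.

Variable Y : R -> T -> R.
Hypothesis mY : measurable_fun setT (fun z : R * T => Y z.1 z.2).
Hypothesis YW : {ae P, forall w t, 0 <= t -> Y t w = W t w}.

Let mYt t : measurable_fun setT (Y t).
Proof.
rewrite (_ : Y t = (fun z : R * T => Y z.1 z.2) \o pair t)//.
by apply: measurableT_comp => //; exact: measurable_pair1.
Qed.

Lemma path_increment_bound : {ae P, forall w, exists C, forall m k, (k < 2 ^ m)%N ->
  `|Y (tick m k.+1) w - Y (tick m k) w| <= (C + 2 * m%:R) * Num.sqrt 2^-1 ^+ m}.
Proof.
pose sg (b : bool) : R := if b then 1 else -1.
pose q m : R := Num.sqrt (tick m 1).
have tS m k : tick m k.+1 - tick m k = tick m 1 :> R.
  by rewrite /tick -mulrBl -natr1 addrAC subrr add0r.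
pose Z m (c : 'I_(2 ^ m) * bool) w : R :=
  sg c.2 * ((q m)^-1 * (Y (tick m c.1.+1) w - Y (tick m c.1) w)).
(* The index is a dyadic interval together with a sign, to control the absolute value; 2 * 2^m
   indices mean [q = 1], hence the slope 2. *)
have := @exp_moment_linear_bound _ _ _ P (fun m => ('I_(2 ^ m) * bool)%type : finType) Z
  (expR 2^-1) 2 1 (expR_ge0 _).
have h1 : forall n, (#|{: 'I_(2 ^ n) * bool}| <= 2 * 2 ^ (1 * n))%N.
  by move=> n; rewrite card_prod card_ord card_bool mulnC mul1n.
have h2 : forall n c, measurable_fun setT (Z n c).
  move=> n c; do 2!apply: measurable_funM => //; exact: measurable_funB.
have h3 : forall n c, (\int[P]_w (expR (Z n c w))%:E <= (expR 2^-1)%:E)%E.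
  move=> n [k b].
  have lt : (tick n k : R) < tick n k.+1.
    by rewrite /tick ltr_pM2r ?invr_gt0 ?exprn_gt0// ltr_nat.
  have t0 : (0 : R) <= tick n k by rewrite /tick divr_ge0 ?exprn_ge0.
  rewrite -(@brownian_increment_exp (sg b) _ _ _ t0 lt); last first.
    by rewrite /sg; case: b; rewrite ?sqrrN expr1n.
  rewrite (ge0_ae_eq_integral measurableT (g := fun w => (expR (sg b * ((Num.sqrt (tick n k.+1 - tick n k))^-1 * (W (tick n k.+1) w - W (tick n k) w))))%:E))//.
  - by apply/measurable_EFinP; apply: measurableT_comp => //; exact: h2.
  - apply/measurable_EFinP; apply: measurableT_comp => //.
    by do 2!apply: measurable_funM => //; exact: measurable_funB.
  - apply: filterS YW => w h _; rewrite /Z/= /q tS !h//.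
    by apply: le_trans t0 _; exact: ltW.
move=> /(_ h1 h2 h3); apply: filterS => w [C HC]; exists C => m k km.
have q0 : 0 < q m by rewrite sqrtr_gt0 /tick divr_gt0// exprn_gt0.
have qE : q m = Num.sqrt 2^-1 ^+ m.
  rewrite /q /tick div1r -exprVn; elim: m {q0 km} => [|m IH]; first by rewrite !expr0 sqrtr1.
  by rewrite !exprS sqrtrM ?invr_ge0// IH.
have := HC m (Ordinal km, true); have := HC m (Ordinal km, false).
rewrite /Z/= /sg !mul1r mulN1r natrM -qE => i1 i2.
rewrite -[Y _ _ - _](mulVKf (lt0r_neq0 q0)) mulrC normrM (gtr0_norm q0) ler_pM2r//.
by rewrite ler_norml; move: i1 i2; move: (_ * (_ - _)) (m%:R : R) => u v; lra.
Qed.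

End regularity.

Lemma shift_intP (N : nat) (m : int) : `|m| <= N%:Z ->
  (`|(m + N%:Z)%R|%N < (2 * N).+1)%N /\ `|(m + N%:Z)%R|%N%:Z - N%:Z = m.
Proof. by lia. Qed.

Section regularity.
Context {R : realType} {d : measure_display} {T : measurableType d}.
Variable P : probability T R.
Variable W : R -> {RV P >-> R}.
Hypothesis bmW : brownian_motion W.
Variable Y : R -> T -> R.
Hypothesis mY : measurable_fun setT (fun z : R * T => Y z.1 z.2).
Hypothesis YW : {ae P, forall w t, 0 <= t -> Y t w = W t w}.
Hypothesis cY : forall w, continuous (Y ^~ w).

Lemma path_oscillation (r : R) : Num.sqrt 2^-1 < r -> r < 1 ->
  {ae P, forall w, exists2 C1, 0 <= C1 & forall n j s, (j < 2 ^ n)%N ->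
    s \in `[tick n j, tick n j.+1[ -> `|Y s w - Y (tick n j) w| <= C1 * r ^+ n}.
Proof.
move=> ur r1; apply: filterS (path_increment_bound bmW mY YW) => w [C HC].
have u0 : 0 < Num.sqrt 2^-1 :> R by rewrite sqrtr_gt0 invr_gt0.
have [D D0 HD] := linear_geometric_le C 2 u0 ur.
exists (D / (1 - r)); first by apply: divr_ge0 => //; rewrite subr_ge0 ltW.
have inc m k : (k < 2 ^ m)%N -> `|Y (tick m k.+1) w - Y (tick m k) w| <= D * r ^+ m.
  by move=> km; apply: le_trans (HC m k km) (HD m).
exact: (dyadic_chaining (@cY w) (ltW (lt_trans u0 ur)) r1 inc).
Qed.

Let X n i (k k' : int) w : R :=
  2 ^+ n.+1 * occ (Y ^~ w) (tick n.+1 i) (tick n.+1 i.+1) (cell n.+1 k') (cell n.+1 (k' + 1)) -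
  2 ^+ n * occ (Y ^~ w) (tick n.+1 i) (tick n.+1 i.+1) (cell n k) (cell n (k + 1)).

Let cell_lt n (k : int) : (cell n k : R) < cell n (k + 1).
Proof. by rewrite /cell ltr_pM2r ?invr_gt0 ?exprn_gt0// ltr_int ltrDl. Qed.

Let cell_len n (k : int) : ((cell n (k + 1) : R) - cell n k)^-1 = 2 ^+ n.
Proof. by rewrite /cell -mulrBl -intrB addrAC subrr add0r div1r invrK. Qed.

Let tickS m i : (tick m i : R) + (2 ^+ m)^-1 = tick m i.+1.
Proof. by rewrite /tick -[i.+1%:R]natr1 mulrDl mul1r. Qed.

Let XE n i k k' w : X n i k k' w = \int[lebesgue_measure]_(t in `[tick n.+1 i, tick n.+1 i + (2 ^+ n.+1)^-1[)
    cell_diff (cell n.+1 k') (cell n.+1 (k' + 1)) (cell n k) (cell n (k + 1)) (Y t w).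
Proof.
rewrite integral_cell_diff; last exact: measurable_path.
by rewrite !cell_len tickS.
Qed.

Let XNE n i k k' w : - X n i k k' w = \int[lebesgue_measure]_(t in `[tick n.+1 i, tick n.+1 i + (2 ^+ n.+1)^-1[)
    cell_diff (cell n k) (cell n (k + 1)) (cell n.+1 k') (cell n.+1 (k' + 1)) (Y t w).
Proof.
rewrite integral_cell_diff; last exact: measurable_path.
by rewrite !cell_len tickS opprB.
Qed.

Variable a : R.
Hypothesis a_ge : 2^-1 <= a.

Let a0 : 0 < a. Proof. by apply: lt_le_trans a_ge; rewrite invr_gt0. Qed.

Let u : R := Num.sqrt 2^-1.
(** For h = 6 a^n and tau = 2^-(n+1) the smallness condition of [path_exp_bound] reads
    [lam * (G * z ^+ n) <= 1]; see [scaleE]. *)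
Let z : R := root4 a * root4 u ^+ 3.
Let G : R := 20 * root4 6 * root4 u ^+ 3.

Let u0 : 0 < u. Proof. by rewrite sqrtr_gt0 invr_gt0. Qed.
Let z0 : 0 < z. Proof. by rewrite mulr_gt0 ?exprn_gt0 ?root4_gt0// gt_eqF. Qed.
Let G0 : 0 < G. Proof. by rewrite !mulr_gt0 ?exprn_gt0 ?root4_gt0// gt_eqF. Qed.

Let sqrtX m : Num.sqrt (2 ^+ m)^-1 = u ^+ m.
Proof.
rewrite -exprVn; elim: m => [|m IH]; first by rewrite !expr0 sqrtr1.
by rewrite !exprS sqrtrM ?invr_ge0// IH.
Qed.

Let root4_exp (x : R) m : root4 (x ^+ m) = root4 x ^+ m.
Proof.
by elim: m => [|m IH]; rewrite ?expr0 ?root4_1// !exprS root4M IH.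
Qed.

Let scaleE n : 20 * root4 (6 * a ^+ n) * root4 (Num.sqrt (2 ^+ n.+1)^-1) ^+ 3 = G * z ^+ n.
Proof.
rewrite sqrtX root4M !root4_exp exprAC /G /z; move: (root4 u ^+ 3) => g.
rewrite exprS exprMn; move: (root4 6) (root4 a ^+ n) (g ^+ n) => e f h; ring.
Qed.

Let aV n : (2 ^+ n)^-1 <= a ^+ n.
Proof. by rewrite -exprVn lerXn2r// nnegrE ?invr_ge0// ltW. Qed.

(** The constant 6 allows 4 a^n between the left ends and a^n for the length of each cell. *)
Let close_cells n (k k' : int) y y' : `|cell n.+1 k' - cell n k| <= 4 * a ^+ n ->
  y \in `[cell n.+1 k', cell n.+1 (k' + 1)[ -> y' \in `[cell n k, cell n (k + 1)[ ->
  `|y - y'| <= 6 * a ^+ n.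
Proof.
rewrite !in_itv/= !cellS; have := aV n.
have : (2 ^+ n.+1)^-1 <= (2 ^+ n)^-1 :> R.
  by rewrite lef_pV2 ?posrE ?exprn_gt0// ler_eXn2l// ltr1n.
rewrite !ler_norml; move: (cell n.+1 k') (cell n k) => c c'.
by move: (2 ^+ n.+1)^-1 (2 ^+ n)^-1 (a ^+ n) => v v' e; lra.
Qed.

Let X_exp_bound (b : bool) n i k k' : `|cell n.+1 k' - cell n k| <= 4 * a ^+ n ->
  (\int[P]_w (expR ((G * z ^+ n)^-1 * (if b then X n i k k' w else - X n i k k' w)))%:E
    <= (4 * expR 1)%:E)%E.
Proof.
move=> kk.
have YWt t : 0 <= t -> {ae P, forall w, Y t w = W t w}.
  by move=> t0; apply: filterS YW => w; apply.
have T0 : (0 : R) <= tick n.+1 i by rewrite /tick divr_ge0// exprn_ge0.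
have V0 : (0 : R) < (2 ^+ n.+1)^-1 by rewrite invr_gt0 exprn_gt0.
have lam0 : 0 <= (G * z ^+ n)^-1 by rewrite invr_ge0 mulr_ge0// ?exprn_ge0// ltW.
have cond : 20 * (G * z ^+ n)^-1 * root4 (6 * a ^+ n) *
    root4 (Num.sqrt (2 ^+ n.+1)^-1) ^+ 3 <= 1.
  have E (e l f g : R) : e * l * f * g = l * (e * f * g) by ring.
  by rewrite E scaleE mulVf// gt_eqF// mulr_gt0// exprn_gt0.
case: b.
  under eq_integral do rewrite XE.
  apply: (path_exp_bound bmW mY YWt (h := 6 * a ^+ n)) => //.
  by move=> y y'; apply: close_cells.
under eq_integral do rewrite XNE.
apply: (path_exp_bound bmW mY YWt (h := 6 * a ^+ n)) => //.
by move=> y y' hy hy'; rewrite distrC; apply: close_cells kk _ _.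
Qed.

Lemma path_occupation_regular (p : R) : z < p ->
  {ae P, forall w, exists2 C2, 0 <= C2 & forall n i (k k' : int), (i < 2 ^ n.+1)%N ->
    `|k| <= 8 ^+ n.+1 -> `|k'| <= 8 ^+ n.+1 ->
    `|(cell n.+1 k' : R) - cell n k| <= 4 * a ^+ n ->
    `|2 ^+ n.+1 * occ (Y ^~ w) (tick n.+1 i) (tick n.+1 i.+1) (cell n.+1 k') (cell n.+1 (k' + 1)) -
      2 ^+ n * occ (Y ^~ w) (tick n.+1 i) (tick n.+1 i.+1) (cell n k) (cell n (k + 1))| <=
    C2 * p ^+ n}.
Proof.
move=> zp.
pose F n : finType := ('I_(2 ^ n.+1) * 'I_(2 * 8 ^ n.+1).+1 * 'I_(2 * 8 ^ n.+1).+1 * bool)%type.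
pose ix n (l : 'I_(2 * 8 ^ n.+1).+1) : int := l%:Z - (8 ^ n.+1)%:Z.
(* Pairs of distant cells receive the value 0, whose exponential moment is 1; the index set can then
   be a full product. The ordinal [l] encodes the integer l - 8^(n+1), and the Boolean the sign. *)
pose Z n (c : F n) w : R :=
  if `|(cell n.+1 (ix n c.1.2) : R) - cell n (ix n c.1.1.2)| <= 4 * a ^+ n then
    (G * z ^+ n)^-1 * (if c.2 then X n c.1.1.1 (ix n c.1.1.2) (ix n c.1.2) w
                       else - X n c.1.1.1 (ix n c.1.1.2) (ix n c.1.2) w)
  else 0.
have h0 : 0 <= 4 * expR 1 :> R by rewrite mulr_ge0// expR_ge0.
(* One factor 2^n counts time intervals and two factors 8^n count cells, so [q = 7], and the linear
   term has slope 8. *)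
have h1 n : (#|F n| <= 4096 * 2 ^ (7 * n))%N.
  rewrite !card_prod !card_ord card_bool.
  have := expnM 2 3 n; rewrite (_ : 2 ^ 3 = 8)%N// => e8.
  rewrite (_ : 7 * n = n + 3 * n + 3 * n)%N; last by lia.
  move: e8; move: (3 * n)%N => m e8; rewrite !expnD e8 !expnS.
  have := expn_gt0 8 n; have := expn_gt0 2 n; move: (2 ^ n)%N (8 ^ n)%N => A B /= A0 B0.
  by nia.
have h2 n c : measurable_fun setT (Z n c).
  have mX i k k' : measurable_fun setT (X n i k k').
    by apply: measurable_funB; apply: measurable_funM => //; exact: measurable_occ.
  rewrite /Z; case: (_ <= _) => //; apply: measurable_funM => //.
  by case: c.2 => //; exact: measurable_funN.
have h3 n c : (\int[P]_w (expR (Z n c w))%:E <= (4 * expR 1)%:E)%E.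
  rewrite /Z; case E : (_ <= _); first exact: X_exp_bound.
  under eq_integral do rewrite expR0.
  rewrite -[leRHS]mule1 -(probability_setT P) -integral_cst//.
  apply: ge0_le_integral => // w _; rewrite [leLHS](@probability_setT _ _ _ P) lee_fin.
  by have := expR_ge1Dx (1 : R); lra.
have := exp_moment_linear_bound h0 h1 h2 h3.
apply: filterS => w [C HC].
have [D D0 HD] := linear_geometric_le C 8 z0 zp.
exists (G * D) => [|n i k k' ni kn kn' kk]; first by rewrite mulr_ge0// ltW.
have ixP (m : int) : `|m| <= 8 ^+ n.+1 -> exists l, ix n l = m.
  move=> mn; have mn' : `|m| <= (8 ^ n.+1)%N%:Z by rewrite -natz natrX.
  have [h e] := shift_intP mn'.
  by exists (Ordinal h).
have [l lk] := ixP _ kn; have [l' lk'] := ixP _ kn'.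
have Gz : 0 < G * z ^+ n by rewrite mulr_gt0// exprn_gt0.
have := HC n (Ordinal ni, l, l', false); have := HC n (Ordinal ni, l, l', true).
rewrite /Z/= lk lk' kk -/(X n i k k' w) ![_^-1 * _]mulrC !ler_pdivrMr// => i1 i2.
apply: (@le_trans _ _ ((C + (8 * n)%:R) * (G * z ^+ n))).
  by rewrite ler_norml lerNl i1 i2.
rewrite mulrCA -[leRHS]mulrA natrM; apply: ler_wpM2l (HD n); exact: ltW.
Qed.

End regularity.

Section exponents.
Context {R : realType}.

(* With [u = 2^(-1/2)], [(2 u z)^4 = 2 u a], which is below 1 exactly because
   [alpha > 1/2], i.e. [a < u]. *)
Lemma exists_exponents (a : R) : 2^-1 <= a -> a < Num.sqrt 2^-1 ->
  exists r p, [/\ Num.sqrt 2^-1 < r, r < 1,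
    root4 a * root4 (Num.sqrt 2^-1) ^+ 3 < p & 2 * r * p < 1].
Proof.
set u := Num.sqrt 2^-1 => a_ge au; set z := root4 a * _.
have a0 : 0 < a by apply: lt_le_trans a_ge; rewrite invr_gt0.
have u0 : 0 < u by apply: lt_trans au.
have u2 : u ^+ 2 = 2^-1 by rewrite sqr_sqrtr// invr_ge0.
have z0 : 0 < z by rewrite mulr_gt0 ?exprn_gt0 ?root4_gt0// gt_eqF.
have uz : 2 * u * z < 1.
  rewrite ltNge; apply/negP => /(exprn_ege1 4).
  have -> : (2 * u * z) ^+ 4 = 2 ^+ 4 * u ^+ 4 * (root4 a ^+ 4 * (root4 u ^+ 4) ^+ 3).
    by rewrite /z; ring.
  rewrite !root4X !gtr0_norm//.
  have -> : 2 ^+ 4 * u ^+ 4 * (a * u ^+ 3) = 16 * (u ^+ 2) ^+ 3 * (u * a) by ring.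
  rewrite u2; have : u * a < u * u by rewrite ltr_pM2l.
  rewrite -expr2 u2; move: (u * a) => v; lra.
have u1 : u < 1.
  by rewrite ltNge; apply/negP => /(exprn_ege1 2); rewrite u2; lra.
have ltV (x y : R) : 0 < y -> (x < y^-1) = (x * y < 1).
  by move=> y0; rewrite -ltr_pdivlMr// div1r.
have z20 : 0 < 2 * z by rewrite pmulr_rgt0.
pose r := (u + Num.min 1 (2 * z)^-1) / 2.
have uzV : u < (2 * z)^-1.
  by rewrite ltV// mulrCA mulrA.
have um : u < Num.min 1 (2 * z)^-1 by rewrite lt_min u1.
have ur : u < r by rewrite midf_lt.
have rm : r < Num.min 1 (2 * z)^-1 by rewrite midf_lt.
move: rm; rewrite lt_min => /andP[r1 rz].
have r0 : 0 < r by apply: lt_trans ur.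
have r20 : 0 < 2 * r by rewrite pmulr_rgt0.
have zr : z < (2 * r)^-1.
  by move: rz; rewrite !ltV// [z * _]mulrC mulrCA mulrA.
exists r, ((z + (2 * r)^-1) / 2); split => //.
- by rewrite midf_lt.
- have : (z + (2 * r)^-1) / 2 < (2 * r)^-1 by rewrite midf_lt.
  by rewrite ltV// [_ * (2 * r)]mulrC.
Qed.

End exponents.

Section regular_path.
Context {R : realType}.

(* Allowing different curves f and g on the two levels gives at once the
   convergence of [level_occ] and the continuity of its limit in the curve. *)
Definition regular_path (x : R -> R) (a s : R) := exists (n1 : nat) (M K : R),
  [/\ 0 <= K, forall n f, (n1 <= n)%N -> curve a f -> level_occ x n f <= M
    & forall n m f g, (n1 <= n < m)%N -> curve a f -> curve a g ->
      (forall t, t \in `[0, 1] -> `|f t - g t| <= a ^+ n) ->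
      `|level_occ x m g - level_occ x n f| <= K * s ^+ n].

End regular_path.

Section brownian_paths.
Context {R : realType} {d : measure_display} {T : measurableType d}.
Variable P : probability T R.
Variable W : R -> {RV P >-> R}.
Hypothesis bmW : brownian_motion W.
Variable Y : R -> T -> R.
Hypothesis mY : measurable_fun setT (fun z : R * T => Y z.1 z.2).
Hypothesis YW : {ae P, forall w t, 0 <= t -> Y t w = W t w}.
Hypothesis cY : forall w, continuous (Y ^~ w).

Lemma ae_regular_path (a : R) : 2^-1 <= a -> a < Num.sqrt 2^-1 ->
  exists s, [/\ 0 <= s, s < 1 & {ae P, forall w, regular_path (Y ^~ w) a s}].
Proof.
move=> a_ge au; have [r [p [ur r1 zp rp]]] := exists_exponents a_ge au.
have ar : a <= r by apply: ltW; apply: lt_trans ur.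
have r12 : 1 <= 2 * r by have := le_trans a_ge ar; lra.
have p0 : 0 <= p.
  by apply: le_trans (ltW zp); rewrite mulr_ge0 ?exprn_ge0 ?root4_ge0.
exists (2 * r * p); split => //; first by rewrite !mulr_ge0//; lra.
have h1 := path_oscillation bmW mY YW cY ur r1.
have h2 := path_occupation_regular bmW mY YW a_ge zp.
apply: filterS2 h1 h2 => w [C1 C10 H1] [C2 C20 H2].
exact: (level_occ_cauchy (measurable_path mY w) a_ge ar r1 r12 p0 rp C10 C20 H1 H2).
Qed.

End brownian_paths.

(** * Identification with the local time *)

Section integral_limits.
Context {R : realType} {d : measure_display} {T : measurableType d}.

(* [ge0_le_integral] would require [g] to be measurable, which the supremum of
   [is_local_time] may fail to be. *)
Lemma ge0_le_lower_integral (mu : measure T R) (f g : T -> \bar R) :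
  (forall w, 0 <= f w)%E -> (forall w, f w <= g w)%E ->
  (\int[mu]_w f w <= \int[mu]_w g w)%E.
Proof.
move=> f0 fg; have g0 w : (0 <= g w)%E by exact: le_trans (fg w).
rewrite !ge0_integralTE//; apply: le_ereal_sup => _ [h /= hf <-].
by exists h => //= w; exact: le_trans (fg w).
Qed.

(** Fatou's lemma bounds the second moment of X - V by the lower limit of the second moments of D n
    - V, which is 0. *)
Lemma ae_eq_mean_square_limit (P : probability T R) (D : nat -> T -> R) (X V : T -> R) :
  measurable_fun setT X -> measurable_fun setT V ->
  (forall n, measurable_fun setT (D n)) ->
  {ae P, forall w, D ^~ w @ \oo --> X w} ->
  (fun n => \int[P]_w (`|D n w - V w| ^+ 2)%:E)%E @ \oo --> 0%E ->
  {ae P, forall w, X w = V w}.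
Proof.
move=> mX mV mD DX DV.
pose q n w := (`|D n w - V w| ^+ 2)%:E.
have q0 n w : (0 <= q n w)%E by rewrite lee_fin sqr_ge0.
have mq n : measurable_fun setT (q n).
  apply/measurable_EFinP; apply: measurable_funX; apply: measurableT_comp => //.
  exact: measurable_funB.
have mXV : measurable_fun setT (fun w => (`|X w - V w| ^+ 2)%:E).
  apply/measurable_EFinP; apply: measurable_funX; apply: measurableT_comp => //.
  exact: measurable_funB.
have F := fatou P measurableT mq (fun n w _ => q0 n w).
rewrite (cvg_limn_einf_sup DV) in F.
have E : (\int[P]_w `|(`|X w - V w| ^+ 2)%:E| = 0)%E.
  apply/eqP; rewrite eq_le; apply/andP; split; last exact: integral_ge0.
  apply: le_trans F.
  rewrite le_eqVlt; apply/orP; left; apply/eqP.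
  apply: ge0_ae_eq_integral => //.
  - exact: measurableT_comp.
  - apply: measurableT_comp; first by [].
    by apply: measurable_fun_limn_esup => n; exact: measurableT_comp.
  - move=> w _; rewrite limn_einf_lim; apply: lime_ge; first exact: is_cvg_einfs.
    by apply: nearW => n; apply: le_ereal_inf_tmp => _ [k /= _ <-].
  - apply: filterS DX => w h _ /=.
    have c : q ^~ w @ \oo --> (`|X w - V w| ^+ 2)%:E.
      apply: cvg_EFin; first exact: nearW.
      have cN : (fun n => `|D n w - V w|) @ \oo --> `|X w - V w|.
        by apply: cvg_norm; apply: cvgB => //; exact: cvg_cst.
      exact: (cvgM cN cN).
    by rewrite (cvg_limn_einf_sup c) ger0_norm// sqr_ge0.
have /(ae_eq_integral_abs _ measurableT mXV) := E.
apply: filterS => w /(_ I)/= [] /eqP.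
by rewrite sqrf_eq0 normr_eq0 subr_eq0 => /eqP.
Qed.

End integral_limits.

Section tubes.
Context {R : realType} {d : measure_display} {T : measurableType d}.
Local Notation mu := (@lebesgue_measure R).
Variable Y : R -> T -> R.
Hypothesis mY : measurable_fun setT (fun z : R * T => Y z.1 z.2).

Let tube_funE (e : R) (f : R -> R) t w :
  (\1_(`]f t - e, f t + e[%classic) (Y t w) : R) = \1_(`]- e, e[%classic) (Y t w - f t).
Proof.
rewrite !indicE !mem_setE !in_itv/=; congr (nat_of_bool _)%:R.
by lra.
Qed.

Lemma measurable_tube (f : R -> R) (e : R) : measurable_fun setT f ->
  measurable_fun setT (fun w => tube (Y ^~ w) f e).
Proof.
move=> mf.
pose H (z : R * T) : \bar R :=
  (\1_(`[0, 1[%classic) z.1 * \1_(`]- e, e[%classic) (Y z.1 z.2 - f z.1))%:E.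
have mH : measurable_fun setT (H : measurableTypeR R * T -> \bar R).
  have mH' : measurable_fun setT H.
    apply/measurable_EFinP; apply: measurable_funM.
      by apply: (measurableT_comp _ measurable_fst); exact: measurable_indic.
    have mg : measurable_fun setT (fun z : R * T => Y z.1 z.2 - f z.1).
      by apply: measurable_funB => //; apply: (measurableT_comp mf); exact: measurable_fst.
    by apply: (measurableT_comp _ mg); exact: measurable_indic.
  exact: mH'.
have H0 z : (0 <= H z)%E by rewrite lee_fin mulr_ge0.
have mG := @measurable_fun_fubini_tonelli_G _ _ (measurableTypeR R) T R mu H mH H0.
apply/measurable_EFinP; apply: (eq_measurable_fun _ _ mG) => w _.
rewrite /fubini_G /=.
have -> : tube (Y ^~ w) f e =
    \int[mu]_(t in `[0, 1[) \1_(`]- e, e[%classic) (Y t w - f t).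
  by apply: eq_Rintegral => t _; exact: tube_funE.
rewrite /Rintegral fineK; last first.
  apply: integrable_fin_num => //.
  apply: (@bounded_integrable_itv _ 0 1 _ 1).
    have mg : measurable_fun setT (fun t => Y t w - f t).
      by apply: measurable_funB => //; exact: measurable_path.
    by apply: (measurableT_comp _ mg); exact: measurable_indic.
  by move=> t; rewrite indicE; case: (_ \in _); rewrite ?normr1 ?normr0.
rewrite [RHS]integral_mkcond; apply: eq_integral => r _.
by rewrite /H patchE indicE /=; case: ifPn => _; rewrite ?mul1r ?mul0r.
Qed.

End tubes.

Section clamp.
Context {R : realType}.
Implicit Types (f g x : R -> R) (a : R).

(** Outside [0, 1] a curve is arbitrary and may fail to be measurable. Composed with [clamp] it is
    continuous on the whole line, while its values on [0, 1], the only ones that matter, stay the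
    same. *)
Definition clamp (t : R) : R := Num.min (Num.max t 0) 1.

Lemma clamp_itv t : clamp t \in `[0, 1].
Proof.
rewrite in_itv/= /clamp; apply/andP; split; first by rewrite le_min le_max lexx orbT ler01.
by rewrite ge_min lexx orbT.
Qed.

Lemma clamp_id t : t \in `[0, 1] -> clamp t = t.
Proof. by rewrite in_itv/= => /andP[t0 t1]; rewrite /clamp max_l// min_l. Qed.

Lemma clamp_dist s t : `|clamp s - clamp t| <= `|s - t|.
Proof.
rewrite /clamp /Num.min /Num.max; do !case: ifPn; rewrite -?leNgt !ler_norml.
all: have := ler_norm (s - t); have := ler_norm (- (s - t)); rewrite normrN.
all: move: `|s - t| => v; lra.
Qed.

Lemma curve_clamp a f : curve a f -> curve a (f \o clamp).
Proof. by move=> hf n s t hs ht st /=; rewrite !clamp_id//; apply: hf. Qed.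

Lemma measurable_curve_clamp a f : 0 < a -> a < 1 -> curve a f ->
  measurable_fun setT (f \o clamp).
Proof.
move=> a0 a1 hf; apply: continuous_measurable_fun => t.
apply/cvgrPdist_le => e e0.
have [n /(_ n (leqnn n))] := pow_small 1 (ltW a0) a1 e0; rewrite mul1r => ne.
near=> s; apply: le_trans ne; apply: hf; try exact: clamp_itv.
apply: le_trans (clamp_dist _ _) _; near: s.
by exists (2 ^+ n)^-1 => [/=|s /= /ltW//]; rewrite invr_gt0 exprn_gt0.
Unshelve. all: by end_near.
Qed.

Lemma eq_level_occ x n f g : {in `[0, 1], f =1 g} -> level_occ x n f = level_occ x n g.
Proof.
move=> fg; apply: eq_bigr => j _; rewrite fg// in_itv/= /tick divr_ge0 ?exprn_ge0//=.
by rewrite ler_pdivrMr ?exprn_gt0// mul1r -natrX ler_nat ltnW.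
Qed.

Lemma eq_curve_occ x f g : {in `[0, 1], f =1 g} -> curve_occ x f = curve_occ x g.
Proof.
by move=> fg; rewrite /curve_occ; congr (limn _); apply/funext => n; exact: eq_level_occ.
Qed.

Lemma holder_curve alpha f : 0 < alpha -> holder_class alpha f -> curve (2 `^ (- alpha)) f.
Proof.
move=> alpha0 [_ hf] n s t hs ht st; apply: le_trans (hf s t hs ht) _.
apply: (@le_trans _ _ ((2 ^+ n)^-1 `^ alpha)).
  by apply: ge0_ler_powR => //; rewrite ?nnegrE ?invr_ge0 ?exprn_ge0// ltW.
rewrite (_ : (2 ^+ n)^-1 = 2 `^ (- n%:R)); last by rewrite powRN powR_mulrn.
by rewrite -[leRHS]powR_mulrn ?powR_ge0// -!powRrM !mulNr mulrC.
Qed.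

Lemma sup_norm_le f (e : R) : (sup_norm f <= e%:E)%E -> forall t, t \in `[0, 1] -> `|f t| <= e.
Proof.
move=> fe t ht; rewrite -lee_fin; apply: le_trans fe; apply: ereal_sup_ubound.
by exists t.
Qed.

End clamp.

Section measurability.
Context {R : realType} {d : measure_display} {T : measurableType d}.
Variable Y : R -> T -> R.
Hypothesis mY : measurable_fun setT (fun z : R * T => Y z.1 z.2).

Lemma measurable_level_occ n (f : R -> R) :
  measurable_fun setT (fun w => level_occ (Y ^~ w) n f).
Proof.
apply: measurable_sum => j; apply: measurable_funM => //; exact: measurable_occ.
Qed.

End measurability.

Section tube_limit.
Context {R : realType} {d : measure_display} {T : measurableType d}.
Variable P : probability T R.
Variable W : R -> {RV P >-> R}.
Variable Y : R -> T -> R.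
Hypothesis mY : measurable_fun setT (fun z : R * T => Y z.1 z.2).
Variable N : set T.
Hypothesis mN : measurable N.
Hypothesis PN : P N = 0%E.
Hypothesis YW : forall w, ~ N w -> forall t, 0 <= t -> Y t w = W t w.

Lemma occupation_tube f e w : measurable_fun setT (f \o clamp) -> ~ N w ->
  occupation W f e 1 w = (2 * e)^-1 * tube (Y ^~ w) (f \o clamp) e.
Proof.
move=> mf Nw; rewrite /occupation /tube; congr (_ * _).
rewrite Rintegral_itv_bndo_bndc; last first.
  exact: (tube_integrable (measurable_path mY w) mf).
apply: eq_Rintegral => t; rewrite inE/= => ht.
by rewrite clamp_id// YW//; move: ht; rewrite in_itv/= => /andP[].
Qed.

(** Mean square convergence is needed along e = 1/(n + 1) and at t = 1 only, where the supremum over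
    t dominates; the pathwise limit must then coincide with the mean square limit. *)
Lemma local_time_1 f (L : R -> {RV P >-> R}) (X : T -> R) :
  measurable_fun setT (f \o clamp) -> measurable_fun setT X ->
  (forall w, ~ N w -> (2 * e)^-1 * tube (Y ^~ w) (f \o clamp) e @[e --> 0^'+] --> X w) ->
  is_local_time W f L -> {ae P, forall w, X w = L 1 w}.
Proof.
move=> mf mX tX [_ _ cL].
pose e (n : nat) : R := n.+1%:R^-1.
have e_cvg : e @ \oo --> 0^'+.
  move=> A [r /= r0 Ar]; have := near_infty_natSinv_lt (PosNum r0).
  apply: filterS => n /= nr; apply: Ar; last by rewrite /e/= invr_gt0.
  by rewrite /ball_/= sub0r normrN ger0_norm// invr_ge0.
pose D n w := (2 * e n)^-1 * tube (Y ^~ w) (f \o clamp) (e n).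
have mD n : measurable_fun setT (D n).
  by apply: measurable_funM => //; exact: measurable_tube.
apply: (@ae_eq_mean_square_limit _ _ _ P D) => //.
  exists N; split => // w /= h; apply: contrapT => Nw; apply: h.
  apply: (@cvg_comp _ _ _ e (fun e => (2 * e)^-1 * tube (Y ^~ w) (f \o clamp) e)).
    exact: e_cvg.
  exact: tX.
have cLe : (fun n => \int[P]_w ereal_sup
    [set (`|occupation W f (e n) t w - L t w| ^+ 2)%:E | t in `[0%R, 1%R]])%E @ \oo --> 0%E.
  apply: (@cvg_comp _ _ _ e (fun e => \int[P]_w ereal_sup
    [set (`|occupation W f e t w - L t w| ^+ 2)%:E | t in `[0%R, 1%R]])%E).
    exact: e_cvg.
  exact: cL.
apply: (squeeze_cvge _ (cvg_cst _) cLe).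
apply: nearW => n /=; apply/andP; split.
  by apply: integral_ge0 => w _; rewrite lee_fin sqr_ge0.
set E := fun w => ereal_sup _.
(* The comparison of integrals under a possibly non-measurable supremum needs domination at every
   outcome. The indicator removes the null set on which tube and occupation may differ. *)
pose q w := (\1_(~` N) w * `|D n w - L 1 w| ^+ 2)%:E.
have mq : measurable_fun setT (fun w => (`|D n w - L 1 w| ^+ 2)%:E).
  apply/measurable_EFinP; apply: measurable_funX; apply: measurableT_comp => //.
  exact: measurable_funB.
have -> : (\int[P]_w (`|D n w - L 1 w| ^+ 2)%:E = \int[P]_w q w)%E.
  apply: ge0_ae_eq_integral => //.
  - rewrite /q; apply/measurable_EFinP; apply: measurable_funM.
      by apply: measurable_indic; exact: measurableC.
    exact/measurable_EFinP.
  - by move=> w _; rewrite lee_fin mulr_ge0// sqr_ge0.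
  - exists N; split => // w /= h; apply: contrapT => Nw; apply: h => _.
    by rewrite /q indicE mem_set// mul1r.
apply: ge0_le_lower_integral => w; first by rewrite lee_fin mulr_ge0// sqr_ge0.
have E1 : ((`|occupation W f (e n) 1 w - L 1 w| ^+ 2)%:E <= E w)%E.
  by apply: ereal_sup_ubound; exists 1 => //=; rewrite in_itv/= ler01 lexx.
have [Nw|Nw] := pselect (N w).
  rewrite /q indicE memNset; last exact.
  rewrite mul0r.
  by apply: le_trans E1; rewrite lee_fin sqr_ge0.
apply: le_trans E1; rewrite /q indicE mem_set// mul1r.
by rewrite occupation_tube.
Qed.

End tube_limit.

Theorem theorem3p6 (R : realType) (d : measure_display) (T : measurableType d)
    (P : probability T R) (W : R -> {RV P >-> R}) (alpha : R)
    (L : (R -> R) -> R -> {RV P >-> R}) :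
  brownian_motion W ->
  1 / 2 < alpha -> alpha <= 1 ->
  (forall f, holder_class alpha f -> is_local_time W f (L f)) ->
  exists Lt : (R -> R) -> R -> {RV P >-> R},
    [/\ forall f, holder_class alpha f ->
          {ae P, forall w, forall t : R, t \in `[0, 1] -> Lt f t w = L f t w},
        {ae P, forall w,
          sup_norm_continuous (holder_class alpha) (fun f => Lt f 1 w)} &
        {ae P, forall w,
          (ereal_sup [set (Lt f 1 w)%:E | f in holder_class alpha] < +oo)%E}].
Proof.
move=> bmW alpha12 alpha1 locL.
have alpha0 : 0 < alpha by lra.
(* [alpha <= 1] makes a cell no longer than the variation a^n allowed to a curve; [1 / 2 < alpha]
   puts [a] below the ratio 2^(-1/2) of Brownian oscillation. *)
pose a : R := 2 `^ (- alpha).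
have a_ge : 2^-1 <= a.
  by rewrite -[leLHS]powR_inv1// ler_powR ?lerN2// ler1n.
have au : a < Num.sqrt 2^-1.
  rewrite -powR12_sqrt ?invr_ge0// (_ : 2^-1 `^ 2^-1 = 2 `^ (- 2^-1)); last first.
    by rewrite -mulN1r powRrM powRN powRr1.
  rewrite /a /powR gt_eqF// ltr_expR ltr_pM2r ?ln_gt0 ?ltr1n// ltrN2; lra.
have a0 : 0 < a by apply: lt_le_trans a_ge; rewrite invr_gt0.
have a1 : a < 1.
  by apply: (lt_le_trans au); rewrite -[leRHS]sqrtr1 ler_wsqrtr// invf_le1// ler1n.
have hc f : holder_class alpha f -> curve a f by exact: holder_curve.
have [Y [mY cY _ YW]] := continuous_path_version bmW.
have [s [s0 s1 reg]] := ae_regular_path bmW mY YW cY a_ge au.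
have [N [mN PN HN]] : {ae P, forall w, regular_path (Y ^~ w) a s /\
    forall t, 0 <= t -> Y t w = W t w}.
  by apply: filterS2 reg YW.
have {}HN w : ~ N w -> regular_path (Y ^~ w) a s /\ forall t, 0 <= t -> Y t w = W t w.
  by move=> Nw; apply: contrapT => h; apply: Nw; exact: HN.
have NW w (Nw : ~ N w) := (HN w Nw).2.
(* On the null set the levels need not converge; the indicator makes [X f] an everywhere limit of
   measurable functions. *)
pose X f w : R := \1_(~` N) w * curve_occ (Y ^~ w) f.
have XN f w : ~ N w -> X f w = curve_occ (Y ^~ w) f.
  by move=> Nw; rewrite /X indicE mem_set// mul1r.
have mX f : holder_class alpha f -> measurable_fun setT (X f).
  move=> hf; apply: (@measurable_fun_cvg _ _ R setT
    (fun n w => \1_(~` N) w * level_occ (Y ^~ w) n f)).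
    move=> n; apply: measurable_funM; last exact: measurable_level_occ.
    by apply: measurable_indic; exact: measurableC.
  move=> w _; rewrite /X indicE; have [Nw|Nw] := pselect (N w).
    rewrite memNset; last exact.
    by under eq_fun do rewrite mul0r; rewrite mul0r; exact: cvg_cst.
  apply: cvgMr; have [[n1 [M [K [K0 bd cl]]]] _] := HN w Nw.
  by apply: (cvg_level_occ a_ge s0 s1 cl); exact: hc.
have /choice[V VX] : forall f, exists v : {RV P >-> R},
    holder_class alpha f -> forall w, v w = X f w.
  move=> f.
  (* Measurability of [X f] is known on the Hoelder class; elsewhere [L f 1] serves as an arbitrary
     random variable. *)
  have [hf|hf] := pselect (holder_class alpha f); last by exists (L f 1).
  by exists (mfun_Sub (mem_set (mX f hf))).
have VN f w : holder_class alpha f -> ~ N w -> V f w = curve_occ (Y ^~ w) f.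
  by move=> hf Nw; rewrite VX// XN.
have NP (Q : T -> Prop) : (forall w, ~ N w -> Q w) -> {ae P, forall w, Q w}.
  by move=> h; exists N; split => // w /= Qw; apply: contrapT => /h.
(* Only time 1 calls for a new version. *)
pose Lt f t := if t == 1 then V f else L f t.
exists Lt; split.
- move=> f hf; have mf := measurable_curve_clamp a0 a1 (hc f hf).
  have tX w : ~ N w ->
      (2 * e)^-1 * tube (Y ^~ w) (f \o clamp) e @[e --> 0^'+] --> X f w.
    move=> Nw; have [[n1 [M [K [K0 bd cl]]]] _] := HN w Nw.
    rewrite XN// -(@eq_curve_occ _ _ (f \o clamp) f); last first.
      by move=> t ht; rewrite /= clamp_id.
    apply: (cvg_tube (measurable_path mY w) a_ge a1 s0 s1 K0 cl _ mf).
    by apply: curve_clamp; exact: hc.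
  have := local_time_1 mY mN PN NW mf (mX f hf) tX (locL f hf).
  apply: filterS => w XL t _; rewrite /Lt; case: eqVneq => [->|//].
  by rewrite VX.
- apply: NP => w Nw f hf e e0.
  have [[n1 [M [K [K0 bd cl]]]] _] := HN w Nw.
  have e20 : 0 < e / 2 by rewrite divr_gt0.
  have [n0 H] := pow_small (2 * K) s0 s1 e20.
  pose n := maxn n0 n1; exists (a ^+ n); first exact: exprn_gt0.
  move=> g hg fg; rewrite /Lt eqxx !VN//.
  have fg' t : t \in `[0, 1] -> `|f t - g t| <= a ^+ n := sup_norm_le (ltW fg) (t := t).
  have := curve_occ_dist a_ge s0 s1 cl (leq_maxr n0 n1) (hc f hf) (hc g hg) fg'.
  move=> /le_lt_trans; apply; apply: le_lt_trans (H n (leq_maxl _ _)) _.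
  by rewrite ltr_pdivrMr//; lra.
- apply: NP => w Nw; have [[n1 [M [K [K0 bd cl]]]] _] := HN w Nw.
  apply: (@le_lt_trans _ _ M%:E); last exact: ltry.
  apply: ge_ereal_sup => _ [f hf <-]; rewrite /Lt eqxx VN// lee_fin.
  by apply: (curve_occ_le a_ge s0 s1 bd cl); exact: hc.
Qed.
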